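(* Let $F\in C^3(\mathbb{R}^d)$, $f=\nabla F$, and let $M:[0,\infty)\to\mathbb{R}^{d\times d}$ be a (measurable) matrix function. Assume: (a) there exist $R_0>0$, $C_F>0$ such that $-\nabla F(x)\cdot x\ge C_F|x|^2$ whenever $|x|\ge R_0$; (b) $x'=f(x)$ has a finite number of equilibria, all hyperbolic, with transversally intersecting stable and unstable manifolds; (c) $A\in C^1([0,\infty);\mathbb{R}^{d\times d})$, $A(s)$ is symmetric positive definite for every $s\ge 0$, and for constants $C_A,\overline{D_A},\overline{D_M}>0$: $\left(\frac{dA(s)}{ds}u,u\right)\le -C_A(A(s)u,u)$ for a.e. $s>0$ and all $u\in\mathbb{R}^d$; $\lambda_{\max}(A(s))\le\overline{D_A}^2\lambda_{\min}(A(s))$ and $\|M(s)\|\le\overline{D_M}^2\lambda_{\min}(A(s))$ for all $s\ge0$; and $\int_0^\infty M(s)\,ds$ is symmetric. Then there exists $\varepsilon_0>0$ such that, if there exists a connection from the equilibrium $e_i$ to the equilibrium $e_j$ via the ODE $x'=f(x)$, then for every $\varepsilon\in(0,\varepsilon_0]$ there exists a connection from the corresponding equilibrium $(0,e_i^\varepsilon)$ to the corresponding equilibrium $(0,e_j^\varepsilon)$ via the semiflow $S^\varepsilon$.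
   Context: $|\cdot|$ and $(\cdot,\cdot)$ are the Euclidean norm and inner product, $\|\cdot\|$ of a matrix is the operator norm, $\lambda_{\min},\lambda_{\max}$ the extreme eigenvalues of a symmetric matrix. $L^2_A(\mathbb{R}^+)^d$ is the space of $\eta:[0,\infty)\to\mathbb{R}^d$ with $\|\eta\|^2=\int_0^\infty(A(s)\eta(s),\eta(s))\,ds<\infty$. Semiflow $S^\varepsilon(t)$ on $L^2_A(\mathbb{R}^+)^d\times\mathbb{R}^d$ (globally defined for small $\varepsilon\ge 0$): $S^\varepsilon(t)(\eta^0,x_0)=(\eta^t,x(t))$, where $x\in C^1([0,\infty);\mathbb{R}^d)$, $x(0)=x_0$, solves $x'(t)=f(x(t))+\varepsilon\left(\int_0^\infty M(s)\,ds\right)x(t)+\varepsilon\int_0^\infty M(s)\eta^t(s)\,ds$, with $\eta^t(s)=x(t-s)-x(t)$ for $0\le s\le t$ and $\eta^t(s)=x_0+\eta^0(s-t)-x(t)$ for $s>t$. Corresponding equilibria: for all sufficiently small $\varepsilon>0$ every equilibrium of $S^\varepsilon$ has the form $(0,e^\varepsilon)$ with $f(e^\varepsilon)+\varepsilon\int_0^\infty M(s)\,ds\,e^\varepsilon=0$, and each equilibrium $e$ of $x'=f(x)$ has a fixed ($\varepsilon$-independent) compact neighbourhood $N^e$ in $\mathbb{R}^d$, with these neighbourhoods pairwise disjoint, such that exactly one equilibrium $(0,e^\varepsilon)$ of $S^\varepsilon$ satisfies $e^\varepsilon\in N^e$, and all equilibria of $S^\varepsilon$ arise in this way; $(0,e^\varepsilon)$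 is the equilibrium corresponding to $e$ (and $e^\varepsilon\to e$ as $\varepsilon\to0$). A connection from an equilibrium $p$ to an equilibrium $q$ of a system is a bounded complete solution $\gamma$ defined on $\mathbb{R}$ (so for $S^\varepsilon$: $S^\varepsilon(t)\gamma(\tau)=\gamma(t+\tau)$ for all $\tau\in\mathbb{R}$, $t\ge0$) with $\gamma(t)\to p$ as $t\to-\infty$ and $\gamma(t)\to q$ as $t\to+\infty$. *)

(* Defs.v *)
From HB Require Import structures.
From mathcomp Require Import all_boot all_order all_algebra.
From mathcomp.real_closed Require Import complex.
From mathcomp Require Import all_classical all_reals all_analysis.

Set Implicit Arguments.
Unset Strict Implicit.
Unset Printing Implicit Defensive.
Import Order.TTheory GRing.Theory Num.Theory.
Import numFieldNormedType.Exports.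
Local Open Scope classical_set_scope.
Local Open Scope ring_scope.

(* R^d is the space 'cV[R]_d of column vectors.  Its
   library norm is the sup norm, which is used only through its topology; the
   Euclidean structure is given by [dot] and [enorm]. *)

Definition dot (R : realType) (d : nat) (u v : 'cV[R]_d) : R :=
  \sum_(i < d) u i 0 * v i 0.

Definition enorm (R : realType) (d : nat) (u : 'cV[R]_d) : R :=
  Num.sqrt (dot u u).

Definition opnorm (R : realType) (d : nat) (B : 'M[R]_d) : R :=
  sup [set enorm (B *m u) | u in [set u : 'cV[R]_d | enorm u <= 1]].

Definition lambda_min (R : realType) (d : nat) (B : 'M[R]_d) : R :=
  inf [set l : R | eigenvalue B l].

Definition lambda_max (R : realType) (d : nat) (B : 'M[R]_d) : R :=
  sup [set l : R | eigenvalue B l].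

Definition sym_posdef (R : realType) (d : nat) (B : 'M[R]_d) : Prop :=
  B^T = B /\ forall u : 'cV[R]_d, u != 0 -> 0 < dot (B *m u) u.

Definition partial (R : realType) (d : nat) (V : normedModType R) (i : 'I_d)
  (g : 'cV[R]_d -> V) : 'cV[R]_d -> V := 'D_(delta_mx i 0) g.

Fixpoint Ck (R : realType) (d : nat) (k : nat) (g : 'cV[R]_d -> R) : Prop :=
  continuous g /\
  match k with
  | 0 => True
  | k'.+1 => forall i : 'I_d,
      (forall x, derivable g x (delta_mx i 0)) /\ Ck k' (partial i g)
  end.

Definition grad (R : realType) (d : nat) (F : 'cV[R]_d -> R) (x : 'cV[R]_d) :
  'cV[R]_d := \col_i partial i F x.

(* The library's 'J is only available for maps between row vectors. *)
Definition jac (R : realType) (d : nat) (f : 'cV[R]_d -> 'cV[R]_d)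
  (x : 'cV[R]_d) : 'M[R]_d := \matrix_(i, j) partial j f x i 0.

Definition halfline (R : realType) : set R := `[0, +oo[.
Arguments halfline R : clear implicits.

(* Derivative relative to [0, +oo[: two-sided for t > 0, one-sided at t = 0. *)
Definition is_derive_halfline (R : realType) (V : normedModType R)
  (g : R -> V) (t : R) (l : V) : Prop :=
  (y - t)^-1 *: (g y - g t) @[y --> within (halfline R) t^'] --> l.

(* g is C^1 on [0, +oo[ with derivative dg; values at t < 0 are irrelevant. *)
Definition C1_halfline (R : realType) (V : normedModType R)
  (g dg : R -> V) : Prop :=
  (forall t : R, 0 <= t -> is_derive_halfline g t (dg t)) /\
  {within halfline R, continuous dg}.

Definition equilibrium (R : realType) (d : nat) (f : 'cV[R]_d -> 'cV[R]_d)
  (e : 'cV[R]_d) : Prop := f e = 0.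

Definition hyperbolic (R : realType) (d : nat) (f : 'cV[R]_d -> 'cV[R]_d)
  (e : 'cV[R]_d) : Prop :=
  forall l : R[i],
    eigenvalue (map_mx (real_complex R) (jac f e)) l -> complex.Re l != 0.

Definition stable_set (R : realType) (d : nat) (f : 'cV[R]_d -> 'cV[R]_d)
  (e : 'cV[R]_d) : set 'cV[R]_d :=
  [set x0 | exists x : R -> 'cV[R]_d,
    [/\ x 0 = x0,
        forall t : R, 0 <= t -> is_derive_halfline x t (f (x t))
      & x t @[t --> +oo] --> e]].

(* Time reversal: the solution of x' = - f x through x0 on [0, +oo[ is the
   solution of x' = f x on ]-oo, 0] traversed backwards. *)
Definition unstable_set (R : realType) (d : nat) (f : 'cV[R]_d -> 'cV[R]_d)
  (e : 'cV[R]_d) : set 'cV[R]_d := stable_set (fun x => - f x) e.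

(* Velocities at x of the C^1 curves of R^d lying in W.  For an embedded
   submanifold W this is T_x W; stable and unstable manifolds of hyperbolic
   equilibria of a gradient system are embedded. *)
Definition tangent_space (R : realType) (d : nat) (W : set 'cV[R]_d)
  (x : 'cV[R]_d) : set 'cV[R]_d :=
  [set v | exists c : R -> 'cV[R]_d, exists2 delta : R, 0 < delta &
    [/\ c 0 = x, derive1 c 0 = v
      & forall t : R, `|t| < delta ->
          [/\ W (c t), derivable c t 1 & {for t, continuous (derive1 c)}]]].

Definition transversal_sets (R : realType) (d : nat) (W1 W2 : set 'cV[R]_d) : Prop :=
  forall x : 'cV[R]_d, W1 x -> W2 x ->
  forall v : 'cV[R]_d, exists v1 v2 : 'cV[R]_d,
    [/\ tangent_space W1 x v1, tangent_space W2 x v2 & v = v1 + v2].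

Definition ode_connection (R : realType) (d : nat)
  (f : 'cV[R]_d -> 'cV[R]_d) (p q : 'cV[R]_d) : Prop :=
  exists g : R -> 'cV[R]_d,
    [/\ forall t : R, is_derive t 1 g (f (g t)),
        exists K : R, forall t : R, enorm (g t) <= K,
        g t @[t --> -oo] --> p
      & g t @[t --> +oo] --> q].

Definition measurable_halfline (R : realType) (m n : nat)
  (B : R -> 'M[R]_(m, n)) : Prop :=
  forall i j, measurable_fun (halfline R) (fun s : R => B s i j).

(* Entrywise integral over [0, +oo[. *)
Definition int_halfline (R : realType) (m n : nat) (B : R -> 'M[R]_(m, n)) :
  'M[R]_(m, n) :=
  \matrix_(i, j) (\int[lebesgue_measure]_(s in halfline R) B s i j)%R.

(* Pairs (eta, x).  Only the values eta s for s >= 0 matter, and these only up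
   to almost everywhere equality. *)
Definition state (R : realType) (d : nat) : Type :=
  ((R -> 'cV[R]_d) * 'cV[R]_d)%type.

Definition in_L2A (R : realType) (d : nat) (A : R -> 'M[R]_d)
  (eta : R -> 'cV[R]_d) : Prop :=
  measurable_halfline eta /\
  (\int[lebesgue_measure]_(s in halfline R)
     (dot (A s *m eta s) (eta s))%:E < +oo)%E.

Definition L2A_norm (R : realType) (d : nat) (A : R -> 'M[R]_d)
  (eta : R -> 'cV[R]_d) : R :=
  Num.sqrt (\int[lebesgue_measure]_(s in halfline R)
              dot (A s *m eta s) (eta s))%R.

Definition state_dist (R : realType) (d : nat) (A : R -> 'M[R]_d)
  (p q : state R d) : R :=
  Num.sqrt (L2A_norm A (fun s => p.1 s - q.1 s) ^+ 2
            + enorm (p.2 - q.2) ^+ 2).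

Definition rest_state (R : realType) (d : nat) (x : 'cV[R]_d) : state R d :=
  ((fun=> 0), x).

(* eta^t, for the trajectory x with initial relative history eta0. *)
Definition history (R : realType) (d : nat) (eta0 : R -> 'cV[R]_d)
  (x : R -> 'cV[R]_d) (t s : R) : 'cV[R]_d :=
  if s <= t then x (t - s) - x t else x 0 + eta0 (s - t) - x t.

(* The graph of S^eps(t): [semiflow M f eps t p q] means S^eps(t) p = q. *)
Definition semiflow (R : realType) (d : nat) (M : R -> 'M[R]_d)
  (f : 'cV[R]_d -> 'cV[R]_d) (eps t : R) (p q : state R d) : Prop :=
  exists x dx : R -> 'cV[R]_d,
    [/\ C1_halfline x dx,
        x 0 = p.2,
        forall r : R, 0 <= r ->
          dx r = f (x r) + eps *: (int_halfline M *m x r)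
                 + eps *: int_halfline (fun s => M s *m history p.1 x r s),
        {ae lebesgue_measure, forall s : R, 0 <= s -> q.1 s = history p.1 x t s}
      & q.2 = x t].

Definition semiflow_equilibrium (R : realType) (d : nat) (A M : R -> 'M[R]_d)
  (f : 'cV[R]_d -> 'cV[R]_d) (eps : R) (p : state R d) : Prop :=
  in_L2A A p.1 /\ forall t : R, 0 <= t -> semiflow M f eps t p p.

Definition semiflow_connection (R : realType) (d : nat) (A M : R -> 'M[R]_d)
  (f : 'cV[R]_d -> 'cV[R]_d) (eps : R) (p q : state R d) : Prop :=
  exists g : R -> state R d,
    [/\ forall tau : R, in_L2A A (g tau).1,
        forall tau t : R, 0 <= t -> semiflow M f eps t (g tau) (g (t + tau)),
        exists K : R, forall t : R, state_dist A (g t) (rest_state 0) <= K,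
        state_dist A (g t) p @[t --> -oo] --> (0 : R)
      & state_dist A (g t) q @[t --> +oo] --> (0 : R)].

(* (0, E e eps) is the equilibrium of S^eps corresponding to the equilibrium e
   of x' = f x, for all eps in ]0, eps0], with isolating neighbourhoods N e. *)
Definition corresponding_equilibria (R : realType) (d : nat)
  (A M : R -> 'M[R]_d) (f : 'cV[R]_d -> 'cV[R]_d) (eps0 : R)
  (N : 'cV[R]_d -> set 'cV[R]_d) (E : 'cV[R]_d -> R -> 'cV[R]_d) : Prop :=
  [/\ forall e, equilibrium f e -> compact (N e) /\ nbhs e (N e),
      forall e e', equilibrium f e -> equilibrium f e' -> e <> e' ->
        N e `&` N e' = set0,
      forall eps : R, 0 < eps <= eps0 -> forall e, equilibrium f e ->
        [/\ N e (E e eps),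
            f (E e eps) + eps *: (int_halfline M *m E e eps) = 0,
            semiflow_equilibrium A M f eps (rest_state (E e eps))
          & forall p, semiflow_equilibrium A M f eps p -> N e p.2 ->
              p.2 = E e eps],
      forall eps : R, 0 < eps <= eps0 ->
        forall p, semiflow_equilibrium A M f eps p ->
          {ae lebesgue_measure, forall s : R, 0 <= s -> p.1 s = 0} /\
          exists2 e, equilibrium f e & p.2 = E e eps
    & forall e, equilibrium f e -> E e eps @[eps --> 0^'+] --> e].

(* Main.v *)
(* A connection of the semiflow is the same as a bounded solution [x : R -> R^d] of
   [x' = f x + eps K x], where [K x t] is the integral of [M s x (t - s)] over
   [s >= 0]: the history component is determined by the past of [x], and the terms
   with the integral of [M] cancel.  The kernel [M] decays exponentially because
   the eigenvalues of [A] do.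

   Let [x0] be a connection of [x' = f x].  Transversality makes
   [y' = Df(x0) y + h] solvable with a bound [|y| <= k |h|] in the sup norm on
   [R].  Indeed near both ends [Df(x0)] is close to the symmetric invertible
   matrices [Df(ei)] and [Df(ej)], where bounded solutions exist, and the mismatch
   at [t = 0] is the sum of a tangent vector of the unstable set and one of the
   stable set, along which the solutions of the linearized equation stay bounded
   on the corresponding half-line.  An iteration then yields a bounded solution
   [x = x0 + y] of the perturbed equation.

   Near an end, [x - e^eps] solves a hyperbolic linear equation whose forcing is
   eventually at most a small multiple of any eventual bound of [x - e^eps]; so
   every eventual bound can be halved, and [x] tends to [e^eps]. *)

Require Import Defs.
From HB Require Import structures.
From mathcomp Require Import all_boot all_order all_algebra.
From mathcomp.real_closed Require Import complex.
From mathcomp Require Import all_classical all_reals all_analysis measurable_realfun.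
From mathcomp Require Import ring lra.

Set Implicit Arguments.
Unset Strict Implicit.
Unset Printing Implicit Defensive.
Import Order.TTheory GRing.Theory Num.Theory.
Import numFieldNormedType.Exports.
Local Open Scope classical_set_scope.
Local Open Scope ring_scope.

(** * Euclidean structure and Gronwall inequalities *)

(** The main obstacle is that stable and unstable sets are bare sets, known only through the
    velocities of curves they contain. A tangent vector becomes a bounded solution of the linearized
    equation by following the orbits issued from the points of such a curve: their difference
    quotients with the reference orbit stay bounded for all time. For this, orbits with the same
    limit that start near the reference orbit must stay near it for ever, and here the gradient
    structure acts: the potential forbids large excursions close to the equilibrium. Neither
    invariant manifolds nor dichotomy projections are built. Linear equations enter through
    solvability with a bound, a property that survives small perturbations and gluing and is what
    the iteration consumes. The data on the field are kept in a form that also holds for the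
    reversed field, so the unstable side is the stable side in reversed time. The constants depend
    on one chosen connection for each ordered pair of equilibria; finiteness of the set of
    equilibria then yields a single [eps0]. *)

Section euclidean.
Context {R : realType} {d : nat}.
Implicit Types (u v w : 'cV[R]_d) (B : 'M[R]_d) (c : R).

Lemma coord_le_norm (m n : nat) (B : 'M[R]_(m, n)) i j : `|B i j| <= `|B|.
Proof.
rewrite [leRHS]/Num.Def.normr/= mx_normrE.
exact: (le_bigmax _ (fun ij : 'I_m * 'I_n => `|B ij.1 ij.2|) (i, j)).
Qed.

Lemma norm_le_coord (m n : nat) (B : 'M[R]_(m, n)) c : 0 <= c ->
  (forall i j, `|B i j| <= c) -> `|B| <= c.
Proof.
move=> c0 Bc; rewrite [leLHS]/Num.Def.normr/= mx_normrE.
by apply: bigmax_le => // -[i j] _; exact: Bc.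
Qed.

Lemma norm_le_col v c : 0 <= c -> (forall i, `|v i 0| <= c) -> `|v| <= c.
Proof. by move=> c0 vc; apply: norm_le_coord => // i j; rewrite ord1. Qed.

Lemma norm_mulmx_le B u : `|B *m u| <= d%:R * `|B| * `|u|.
Proof.
apply: norm_le_col => [|i]; first by rewrite !mulr_ge0.
rewrite mxE (le_trans (ler_norm_sum _ _ _))//.
rewrite (@le_trans _ _ (\sum_(j < d) `|B| * `|u|))//; last first.
  by rewrite sumr_const card_ord -mulrA mulr_natl.
by apply: ler_sum => j _; rewrite normrM ler_pM// coord_le_norm.
Qed.

Lemma dotC u v : dot u v = dot v u.
Proof. by apply: eq_bigr => i _; rewrite mulrC. Qed.

Lemma dotDl u v w : dot (u + v) w = dot u w + dot v w.
Proof. by rewrite /dot -big_split/=; apply: eq_bigr => i _; rewrite mxE mulrDl. Qed.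

Lemma dotZl c u v : dot (c *: u) v = c * dot u v.
Proof. by rewrite /dot big_distrr/=; apply: eq_bigr => i _; rewrite mxE mulrA. Qed.

Lemma dotNl u v : dot (- u) v = - dot u v.
Proof. by rewrite -scaleN1r dotZl mulN1r. Qed.

Lemma dotDr u v w : dot w (u + v) = dot w u + dot w v.
Proof. by rewrite dotC dotDl !(dotC _ w). Qed.

Lemma dotNr u v : dot u (- v) = - dot u v.
Proof. by rewrite dotC dotNl dotC. Qed.

Lemma dot0l v : dot 0 v = 0.
Proof. by rewrite /dot big1// => i _; rewrite mxE mul0r. Qed.

Lemma dot_trmx B u v : dot (B *m u) v = dot u (B^T *m v).
Proof.
rewrite /dot; under eq_bigr do rewrite mxE big_distrl/=.
rewrite exchange_big/=; apply: eq_bigr => j _; rewrite mxE big_distrr/=.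
by apply: eq_bigr => i _; rewrite mxE; ring.
Qed.

Lemma dot_ge0 u : 0 <= dot u u.
Proof. by apply: sumr_ge0 => i _; rewrite -expr2 sqr_ge0. Qed.

Lemma dot_le u v : `|dot u v| <= d%:R * (`|u| * `|v|).
Proof.
rewrite (le_trans (ler_norm_sum _ _ _))//.
rewrite (@le_trans _ _ (\sum_(j < d) `|u| * `|v|))//; last first.
  by rewrite sumr_const card_ord mulr_natl.
by apply: ler_sum => j _; rewrite normrM ler_pM// coord_le_norm.
Qed.

Lemma coord2_le_dot u i : `|u i 0| ^+ 2 <= dot u u.
Proof.
rewrite /dot (bigD1 i)//= real_normK ?num_real// expr2 lerDl.
by apply: sumr_ge0 => j _; rewrite -expr2 sqr_ge0.
Qed.

Lemma norm_le_enorm u : `|u| <= enorm u.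
Proof.
apply: norm_le_col => [|i]; first exact: sqrtr_ge0.
by rewrite -[leLHS]ger0_norm// -sqrtr_sqr ler_sqrt ?dot_ge0// coord2_le_dot.
Qed.

Lemma enorm_sqr u : enorm u ^+ 2 = dot u u.
Proof. by rewrite sqr_sqrtr// dot_ge0. Qed.

Lemma enorm_le u c : 0 <= c -> (enorm u <= c) = (dot u u <= c ^+ 2).
Proof.
by move=> c0; rewrite -(ler_pXn2r (n:=2))// ?nnegrE ?sqrtr_ge0// enorm_sqr.
Qed.

Lemma norm2_le_dot u : `|u| ^+ 2 <= dot u u.
Proof. by rewrite -enorm_sqr ler_pXn2r ?nnegrE ?sqrtr_ge0// norm_le_enorm. Qed.

Lemma dot_le_norm2 u : dot u u <= d%:R * `|u| ^+ 2.
Proof. by rewrite expr2 (le_trans (ler_norm _))// dot_le. Qed.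

Lemma dot2_le u v : 2 * dot u v <= dot u u + dot v v.
Proof.
have := dot_ge0 (u - v); rewrite dotDl !dotDr !dotNl !dotNr (dotC v u); lra.
Qed.

Lemma dotB_le u v : dot (u - v) (u - v) <= 2 * dot u u + 2 * dot v v.
Proof.
have := dot_ge0 (u + v); rewrite !dotDl !dotDr !dotNl !dotNr (dotC v u); lra.
Qed.

Lemma dotD_le u v : dot (u + v) (u + v) <= 2 * dot u u + 2 * dot v v.
Proof. by have := dotB_le u (- v); rewrite opprK dotNl dotNr opprK. Qed.

Lemma dot_eq0 u : dot u u = 0 -> u = 0.
Proof.
move=> u0; apply/eqP; rewrite -normr_eq0 -sqrf_eq0 eq_le sqr_ge0 andbT.
by rewrite -u0 norm2_le_dot.
Qed.

End euclidean.

Section scalar_calculus.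
Context {R : realType}.
Implicit Types (f df : R -> R) (a b t : R).

Lemma is_derive_cts f t l : is_derive t 1 f l -> {for t, continuous f}.
Proof. by move=> [df _]; apply/differentiable_continuous/derivable1_diffP. Qed.

Lemma is_derive_within f df a b :
  (forall t, a <= t <= b -> is_derive t 1 f (df t)) ->
  {within `[a, b], continuous f}.
Proof.
move=> fd; apply: continuous_in_subspaceT => t; rewrite inE/= in_itv/= => tab.
exact: is_derive_cts (fd _ tab).
Qed.

Lemma le_of_derive_le0 f df a b : a <= b ->
  (forall t, a <= t <= b -> is_derive t 1 f (df t)) ->
  (forall t, a <= t <= b -> df t <= 0) -> f b <= f a.
Proof.
move=> ab fd f0.
have [|c] := MVT_segment (df := df) ab _ (is_derive_within fd).
  by move=> x; rewrite in_itv/= => /andP[ax xb]; apply: fd; rewrite !ltW.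
rewrite in_itv/= => cab E; rewrite -subr_le0 E mulr_le0_ge0 ?f0 ?subr_ge0//.
Qed.

Lemma ge_of_derive_ge0 f df a b : a <= b ->
  (forall t, a <= t <= b -> is_derive t 1 f (df t)) ->
  (forall t, a <= t <= b -> 0 <= df t) -> f a <= f b.
Proof.
move=> ab fd f0; rewrite -lerN2.
apply: (@le_of_derive_le0 (\- f) (\- df)) => // t /[dup] tab.
  by move=> /fd ?; apply: is_deriveN.
by move=> /f0; rewrite oppr_le0.
Qed.

Lemma lipschitz_of_derive f df c a b : a <= b ->
  (forall t, a <= t <= b -> is_derive t 1 f (df t)) ->
  (forall t, a <= t <= b -> `|df t| <= c) -> `|f b - f a| <= c * (b - a).
Proof.
move=> ab fd fc.
have [|x] := MVT_segment (df := df) ab _ (is_derive_within fd).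
  by move=> x; rewrite in_itv/= => /andP[ax xb]; apply: fd; rewrite !ltW.
rewrite in_itv/= => xab ->; rewrite normrM [`|b - a|]ger0_norm ?subr_ge0//.
by rewrite ler_wpM2r ?subr_ge0// fc.
Qed.

Lemma is_derive_reparam f (s c t l : R) : is_derive (s * t + c) 1 f l ->
  is_derive t 1 (fun x => f (s * x + c)) (s * l).
Proof.
move=> fl; have -> : (fun x => f (s * x + c)) = f \o (fun x => s * x + c) by [].
have sd : is_derive t 1 ((s \*: id) + cst c : R -> R) (s *: 1 + 0).
  by apply: is_deriveD.
by rewrite mulrC; apply: is_derive1_comp; rewrite addr0 [_ *: _]mulr1 in sd.
Qed.

Lemma gronwall_homogeneous (u du : R -> R) (k t : R) : 0 <= t ->
  (forall x : R, 0 <= x <= t -> is_derive x 1 u (du x)) ->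
  (forall x : R, 0 <= x <= t -> du x <= k * u x) -> u t <= expR (k * t) * u 0.
Proof.
move=> t0 ud ub.
pose e (x : R) := expR (- k * x + 0).
have ed (x : R) : is_derive x 1 e (- k * e x).
  exact: (is_derive_reparam (f:=expR)).
have gd (x : R) : 0 <= x <= t -> is_derive x 1 (e * u) (e x * (du x - k * u x)).
  move=> xt; have ux := ud _ xt.
  have H : is_derive x 1 (e * u) (e x *: du x + u x *: (- k * e x)).
    exact: is_deriveM.
  by apply: (is_derive_eq H); rewrite /GRing.scale/=; ring.
have : (e * u) t <= (e * u) 0.
  apply: le_of_derive_le0 t0 gd _ => x xt; rewrite mulr_ge0_le0 ?expR_ge0//.
  by rewrite subr_le0 ub.
rewrite !fctE /e mulr0 !addr0 expR0 mul1r mulNr => H.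
rewrite -(ler_pM2l (expR_gt0 (- (k * t)))) mulrA -expRD addNr.
by rewrite expR0 mul1r.
Qed.

Lemma gronwall (u du : R -> R) (k b t : R) : 0 < k -> 0 <= t ->
  (forall x : R, 0 <= x <= t -> is_derive x 1 u (du x)) ->
  (forall x : R, 0 <= x <= t -> du x <= k * u x + b) ->
  u t + b / k <= expR (k * t) * (u 0 + b / k).
Proof.
move=> k0 t0 ud ub.
apply: (@gronwall_homogeneous (u + cst (b / k)) du) => // x xt.
  by rewrite -[du x]addr0; apply: is_deriveD; exact: ud.
by rewrite (le_trans (ub _ xt))// !fctE mulrDr mulrCA mulfV ?mulr1// gt_eqF.
Qed.

End scalar_calculus.

(** * Primitives and bounded solutions of scalar linear equations *)

Section primitive.
Context {R : realType}.

(** The fundamental theorem of calculus gives two-sided derivatives at interior points of the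
    segment only; starting at [-1] makes [0] interior. *)
Lemma primitive_right (f : R -> R) : continuous f ->
  exists G : R -> R, forall t : R, -1 < t -> is_derive t 1 G (f t).
Proof.
move=> cf.
exists (fun x => (\int[lebesgue_measure]_(s in `[(-1 : R), x]) f s)%R) => t t1.
have tt : t < t + 1 by rewrite ltrDl.
have fi : lebesgue_measure.-integrable `[(-1 : R), t + 1] (EFin \o f).
  by apply: continuous_compact_integrable; [exact: segment_compact|
     exact: continuous_subspaceT].
have [dF <-] := continuous_FTC1_closed tt fi t1 (cf t).
by rewrite derive1E; exact: derivableP.
Qed.

(** A primitive on the left is the reflection of a primitive of [f (- t)]. It overlaps with the
    right one on []-1, 0]], where both have the same derivative and so agree once normalized at [0];
    hence the glued function is differentiable at [0] too. *)
Lemma primitive (f : R -> R) : continuous f ->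
  exists F : R -> R, F 0 = 0 /\ forall t : R, is_derive t 1 F (f t).
Proof.
move=> cf; have [G Gd] := primitive_right cf.
have cfN : continuous (f \o -%R).
  by move=> x; apply: continuous_comp; [exact: opp_continuous|exact: cf].
have [H Hd] := primitive_right cfN.
pose K (t : R) := - H (- t).
have Kd (t : R) : t < 1 -> is_derive t 1 K (f t).
  move=> t1; have := @is_derive_reparam _ H (-1) 0 t (f t).
  rewrite mulN1r addr0 => /(_ _)/wrap[|].
    by have := Hd (- t); rewrite /= opprK; apply; rewrite ltrN2.
  move=> /(@is_deriveN _ _ _ _ _ _ _); rewrite mulN1r opprK.
  by congr is_derive; apply/funext => s; rewrite /K /= fctE mulN1r addr0.
have GK (t : R) : -1 < t -> t <= 0 -> G t - G 0 = K t - K 0.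
  move=> t1 t0.
  have GKd (x : R) : t <= x <= 0 -> is_derive x 1 (G - K) (f x - f x).
    move=> /andP[tx x0]; apply: is_deriveB.
      by apply: Gd; exact: lt_le_trans tx.
    by apply: Kd; exact: le_lt_trans x0 _.
  have := lipschitz_of_derive (c := 0) t0 GKd.
  rewrite mul0r normr_le0 => /(_ _)/wrap[x _|]; first by rewrite subrr normr0.
  by move/eqP; rewrite !fctE; lra.
exists (fun t => if 0 <= t then G t - G 0 else K t - K 0); split.
  by rewrite lexx subrr.
move=> t; have [t0|t0] := leP 0 t.
- apply: (@near_eq_is_derive _ _ _ (G \- cst (G 0))); last first.
    by rewrite -[f t]subr0; apply: is_deriveB; apply: Gd; exact: lt_le_trans t0.
  have : \forall s \near t, -1 < s.
    by apply: lt_nbhsr; exact: lt_le_trans t0.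
  by apply: filterS => s s1 /=; case: leP => // s0; rewrite GK// ltW.
- apply: (@near_eq_is_derive _ _ _ (K \- cst (K 0))); last first.
    by rewrite -[f t]subr0; apply: is_deriveB; apply: Kd; exact: lt_trans t0 _.
  have : \forall s \near t, s < 0 by exact: lt_nbhsl.
  by apply: filterS => s s1 /=; rewrite leNgt s1.
Qed.

(* The constant [C] is the limit at +oo of the primitive of [exp(-l t) h t],
   obtained as a supremum. *)
Lemma bounded_solution_gt0 (l m : R) (h : R -> R) : 0 < l -> continuous h ->
  (forall t, `|h t| <= m) -> exists y : R -> R,
  (forall t : R, is_derive t 1 y (l * y t + h t)) /\ forall t, `|y t| <= m / l.
Proof.
move=> l0 ch hm.
pose e (c t : R) := expR (c * t + 0).
have ed c (t : R) : is_derive t 1 (e c) (c * e c t).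
  exact: (is_derive_reparam (f:=expR)).
have ce c : continuous (e c) by move=> t; exact: is_derive_cts (ed c t).
have [P [_ Pd]] : exists P : R -> R, P 0 = 0 /\
    forall t : R, is_derive t 1 P (e (- l) t * h t).
  apply: (primitive (f := e (- l) \* h)) => t.
  by apply: continuousM; [exact: ce|exact: ch].
(* As [m] bounds [h], the function [a] is nondecreasing and [b] nonincreasing, and [C] lies between
   them. Their distance to [P] is [m / l] times [exp(-l t)], which after multiplication by
   [exp(l t)] is exactly the bound [m / l]. *)
pose a := P + (- (m / l)) \*: e (- l); pose b := P + (m / l) \*: e (- l).
have ad (t : R) : is_derive t 1 a (e (- l) t * (h t + m)).
  have H : is_derive t 1 a (e (- l) t * h t + (- (m / l)) *: (- l * e (- l) t)).
    exact: is_deriveD.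
  by apply: (is_derive_eq H); rewrite /GRing.scale/=; field; exact: lt0r_neq0.
have bd (t : R) : is_derive t 1 b (e (- l) t * (h t - m)).
  have H : is_derive t 1 b (e (- l) t * h t + (m / l) *: (- l * e (- l) t)).
    exact: is_deriveD.
  by apply: (is_derive_eq H); rewrite /GRing.scale/=; field; exact: lt0r_neq0.
have a_nd (s t : R) : s <= t -> a s <= a t.
  move=> st; apply: (ge_of_derive_ge0 st (fun t _ => ad t)) => x _.
  by rewrite mulr_ge0 ?expR_ge0//; have := hm x; rewrite ler_norml; lra.
have b_ni (s t : R) : s <= t -> b t <= b s.
  move=> st; apply: (le_of_derive_le0 st (fun t _ => bd t)) => x _.
  by rewrite mulr_ge0_le0 ?expR_ge0//; have := hm x; rewrite ler_norml; lra.
have m0 : 0 <= m by exact: le_trans (hm 0).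
have ab_t (t : R) : a t <= b t.
  rewrite /a /b !fctE lerD2l /GRing.scale/= ler_wpM2r ?expR_ge0//.
  by rewrite (@le_trans _ _ 0)// ?oppr_le0 divr_ge0// ltW.
have ab (s t : R) : a s <= b t.
  have [st|/ltW ts] := leP s t.
    exact: le_trans (a_nd _ _ st) (ab_t t).
  exact: le_trans (ab_t s) (b_ni _ _ ts).
pose C := sup (range a).
have aC t : a t <= C.
  by apply: ub_le_sup; [exists (b 0) => _ [s _ <-]|exists t].
have Cb t : C <= b t.
  by apply: ge_sup; [exists (a 0), 0|move=> _ [s _ <-]].
exists (e l * (P - cst C)); split=> t.
  have H : is_derive t 1 (e l * (P - cst C))
      (e l t *: (e (- l) t * h t - 0) + (P t - C) *: (l * e l t)).
    by apply: is_deriveM; exact: is_deriveB.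
  apply: (is_derive_eq H).
  rewrite /GRing.scale/= !fctE subr0 mulrA /e -expRD !addr0 mulNr addrN expR0.
  by ring.
have eE : e l t * e (- l) t = 1 by rewrite /e -expRD !addr0 mulNr addrN expR0.
have h1 : C <= P t + m / l * e (- l) t := Cb t.
have h2 : P t - m / l * e (- l) t <= C by rewrite -mulNr; exact: aC t.
rewrite !fctE normrM gtr0_norm ?expR_gt0//.
rewrite -[m / l]mulr1 -eE mulrCA ler_wpM2l ?expR_ge0// ler_norml.
by move: h1 h2; set q := m / l * _ => h1 h2; apply/andP; split; lra.
Qed.

(** Reversing time changes the sign of the rate, so only positive rates need an argument. *)
Lemma bounded_solution (l m : R) (h : R -> R) : l != 0 -> continuous h ->
  (forall t, `|h t| <= m) -> exists y : R -> R,
  (forall t : R, is_derive t 1 y (l * y t + h t)) /\ forall t, `|y t| <= m / `|l|.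
Proof.
move=> l0 ch hm; have [lp|ln|l_eq] := ltgtP l 0; last by rewrite l_eq eqxx in l0.
- have chN : continuous (fun t => - h (- t)).
    have cc : continuous (h \o -%R).
      by move=> x; apply: continuous_comp; [exact: opp_continuous|exact: ch].
    by move=> x; apply: continuousN; exact: cc.
  have [||y [yd ym]] := @bounded_solution_gt0 (- l) m _ _ chN.
  + by rewrite oppr_gt0.
  + by move=> t; rewrite normrN.
  exists (fun t => y (-1 * t + 0)); split=> t; last by rewrite (ltr0_norm lp).
  have := is_derive_reparam (yd (-1 * t + 0)) => H; apply: (is_derive_eq H).
  by rewrite addr0 mulN1r opprK; ring.
- by have := bounded_solution_gt0 ln ch hm; rewrite (gtr0_norm ln).
Qed.

End primitive.

(** * Vector-valued derivatives and hyperbolic symmetric matrices *)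

Section vector_calculus.
Context {R : realType} {d : nat}.
Implicit Types (y z : R -> 'cV[R]_d) (t c : R) (u v w : 'cV[R]_d).

(** Coordinatewise form of differentiability, equivalent to [is_derive] by [vderP]; rules for vector
    functions then follow from the scalar ones entry by entry. *)
Definition vder y t v := forall i, is_derive t 1 (fun s => y s i 0) (v i 0).

Lemma vderP y t v : vder y t v <-> is_derive t 1 y v.
Proof.
split=> [yv|[yd <-] i].
- have yd : derivable y t 1.
    by apply/derivable_mxP => i j; rewrite ord1; have [] := yv i.
  apply: DeriveDef => //; rewrite derive_mx//; apply/matrixP => i j.
  by rewrite mxE ord1; have [_ ->] := yv i.
- rewrite derive_mx// mxE; apply: derivableP.
  by move/derivable_mxP : yd; exact.
Qed.

Lemma is_derive_bigsum n (h : 'I_n -> R -> R) t (dh : 'I_n -> R) :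
  (forall i, is_derive t 1 (h i) (dh i)) ->
  is_derive t 1 (fun s => \sum_(i < n) h i s) (\sum_(i < n) dh i).
Proof. by move=> hd; rewrite -fct_sumE; exact: is_derive_sum. Qed.

Lemma is_deriveZ_R (f : R -> R) c t (l : R) : is_derive t 1 f l ->
  is_derive t 1 (fun s => c * f s) (c * l).
Proof. by move=> fl; exact: (@is_deriveZ _ _ _ f c). Qed.

Lemma is_deriveM_R (f g : R -> R) t (l k : R) : is_derive t 1 f l ->
  is_derive t 1 g k -> is_derive t 1 (fun s => f s * g s) (l * g t + f t * k).
Proof.
move=> fl gk; have H : is_derive t 1 (f * g) (f t *: k + g t *: l).
  exact: is_deriveM.
by apply: (is_derive_eq H); rewrite /GRing.scale/=; ring.
Qed.

Lemma vder_eq y t v w : vder y t v -> v = w -> vder y t w.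
Proof. by move=> ? <-. Qed.

Lemma vderD y z t v w : vder y t v -> vder z t w ->
  vder (fun s => y s + z s) t (v + w).
Proof.
move=> yv zw i; rewrite mxE.
have -> : (fun s => (y s + z s) i 0) = (fun s => y s i 0) + (fun s => z s i 0).
  by apply/funext => s; rewrite mxE.
exact: is_deriveD.
Qed.

Lemma vderZ y t v c : vder y t v -> vder (fun s => c *: y s) t (c *: v).
Proof.
move=> yv i; rewrite mxE.
have -> : (fun s => (c *: y s) i 0) = (fun s => c * y s i 0).
  by apply/funext => s; rewrite mxE.
exact: is_deriveZ_R.
Qed.

Lemma vderN y t v : vder y t v -> vder (fun s => - y s) t (- v).
Proof.
move=> /(@vderZ _ _ _ (-1)); rewrite scaleN1r.
by congr vder; apply/funext => s; rewrite scaleN1r.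
Qed.

Lemma vderB y z t v w : vder y t v -> vder z t w ->
  vder (fun s => y s - z s) t (v - w).
Proof. by move=> ? ?; apply: vderD => //; exact: vderN. Qed.

Lemma vder_cst u t : vder (fun=> u) t 0.
Proof. by move=> i; rewrite mxE; exact: is_derive_cst. Qed.

Lemma vder_mulmx (B : 'M[R]_d) y t v : vder y t v ->
  vder (fun s => B *m y s) t (B *m v).
Proof.
move=> yv i; rewrite mxE.
have -> : (fun s => (B *m y s) i 0) = (fun s => \sum_j B i j * y s j 0).
  by apply/funext => s; rewrite mxE.
by apply: is_derive_bigsum => j; exact: is_deriveZ_R.
Qed.

Lemma vder_sum n (y : 'I_n -> R -> 'cV[R]_d) t (v : 'I_n -> 'cV[R]_d) :
  (forall k, vder (y k) t (v k)) ->
  vder (fun s => \sum_(k < n) y k s) t (\sum_(k < n) v k).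
Proof.
move=> yv i; rewrite summxE.
have -> : (fun s => (\sum_(k < n) y k s) i 0) =
  (fun s => \sum_(k < n) y k s i 0) by apply/funext => s; rewrite summxE.
by apply: is_derive_bigsum => k; exact: yv.
Qed.

Lemma vder_reparam y (s c t : R) v : vder y (s * t + c) v ->
  vder (fun x => y (s * x + c)) t (s *: v).
Proof.
by move=> yv i; rewrite mxE; exact: (is_derive_reparam (f := fun x => y x i 0)).
Qed.

Lemma vder_shift y (c t : R) v : vder y (t + c) v -> vder (fun x => y (x + c)) t v.
Proof.
move=> yv; have := @vder_reparam y 1 c t v; rewrite mul1r scale1r => /(_ yv).
by congr vder; apply/funext => s; rewrite mul1r.
Qed.

Lemma vder_opp y t v : vder y (- t) v -> vder (fun x => y (- x)) t (- v).
Proof.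
move=> yv; have := @vder_reparam y (-1) 0 t v.
rewrite mulN1r addr0 scaleN1r => /(_ yv).
by congr vder; apply/funext => s; rewrite mulN1r addr0.
Qed.

Lemma is_derive_dot y z t v w : vder y t v -> vder z t w ->
  is_derive t 1 (fun s => dot (y s) (z s)) (dot v (z t) + dot (y t) w).
Proof.
move=> yv zw; rewrite /dot -big_split/=.
by apply: is_derive_bigsum => i; exact: is_deriveM_R.
Qed.

Lemma vder_cts y t v : vder y t v -> {for t, continuous y}.
Proof.
move=> /vderP[yd _]; exact/differentiable_continuous/derivable1_diffP.
Qed.

End vector_calculus.

(** * Continuity of matrix-valued maps *)

Section matrix_continuity.
Context {R : realType} {T : topologicalType}.

Lemma continuous_mxP (m n : nat) (B : T -> 'M[R]_(m, n)) (t : T) :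
  {for t, continuous B} <-> forall i j, {for t, continuous (fun s => B s i j)}.
Proof.
split=> [Bc i j|Bc].
  by apply: (@continuous_comp _ _ _ B (fun M => M i j)) => //; exact: coord_continuous.
apply/cvgrPdist_le => e e0.
have : \forall s \near t, forall ij : 'I_m * 'I_n, `|B t ij.1 ij.2 - B s ij.1 ij.2| <= e.
  by apply: filter_forall => -[i j]; move/cvgrPdist_le : (Bc i j); exact.
apply: filterS => s H; apply: norm_le_coord => [|i j]; first exact: ltW.
by rewrite !mxE; exact: (H (i, j)).
Qed.

Lemma continuous_bigsum n (h : 'I_n -> T -> R) (t : T) :
  (forall i, {for t, continuous (h i)}) ->
  {for t, continuous (fun s => \sum_(i < n) h i s)}.
Proof.
move=> hc; rewrite -fct_sumE.
apply: (big_ind (fun f : T -> R => {for t, continuous f})) => [|f g ? ?|i _].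
- exact: cst_continuous.
- exact: continuousD.
- exact: hc.
Qed.

Lemma continuous_mulmx (m n p : nat) (B : T -> 'M[R]_(m, n)) (C : T -> 'M[R]_(n, p)) (t : T) :
  {for t, continuous B} -> {for t, continuous C} ->
  {for t, continuous (fun s => B s *m C s)}.
Proof.
move=> /continuous_mxP Bc /continuous_mxP Cc; apply/continuous_mxP => i j.
have -> : (fun s => (B s *m C s) i j) = (fun s => \sum_k B s i k * C s k j).
  by apply/funext => s; rewrite mxE.
by apply: continuous_bigsum => k; apply: continuousM; [exact: Bc|exact: Cc].
Qed.

Lemma continuous_epsP (V : normedModType R) (f : T -> V) (t : T) :
  {for t, continuous f} <->
  forall e, 0 < e -> \forall s \near t, `|f t - f s| <= e.
Proof. by split=> [/cvgrPdist_le|H]; [exact|apply/cvgrPdist_le]. Qed.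

Lemma continuous_norm (V : normedModType R) (f : T -> V) :
  continuous f -> continuous (fun t => `|f t|).
Proof. by move=> fc t; apply: cvg_norm; exact: fc. Qed.

Lemma continuous_add (V : normedModType R) (f g : T -> V) :
  continuous f -> continuous g -> continuous (fun t => f t + g t).
Proof. by move=> fc gc t; apply: cvgD; [exact: fc|exact: gc]. Qed.

Lemma continuous_sub (V : normedModType R) (f g : T -> V) :
  continuous f -> continuous g -> continuous (fun t => f t - g t).
Proof. by move=> fc gc t; apply: cvgB; [exact: fc|exact: gc]. Qed.

Lemma continuous_product (m n p : nat) (B : T -> 'M[R]_(m, n)) (C : T -> 'M[R]_(n, p)) :
  continuous B -> continuous C -> continuous (fun s => B s *m C s).
Proof. by move=> Bc Cc t; apply: continuous_mulmx; [exact: Bc|exact: Cc]. Qed.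

Lemma continuous_cst (V : topologicalType) (v : V) : continuous (fun _ : T => v).
Proof. by move=> t; exact: cvg_cst. Qed.

End matrix_continuity.

(** * Spectral resolution of symmetric hyperbolic matrices *)

Section spectral.
Context {R : realType} {d : nat}.
Implicit Types H : 'M[R]_d.

(* A symmetric invertible matrix, through a resolution of the identity into
   matrices of eigenvectors; no orthogonality of the [P k] is required. *)
Definition saddle H := H^T = H /\
  exists (P : 'I_d -> 'M[R]_d) (l : 'I_d -> R), \sum_k P k = 1%:M /\
  forall k, H *m P k = l k *: P k /\ l k != 0.

Lemma saddleN H : saddle H -> saddle (- H).
Proof.
move=> [Hs [P [l [P1 HP]]]]; split; first by rewrite linearN/= Hs.
exists P, (fun k => - l k); split=> // k; have [HPk lk] := HP k.
by rewrite mulNmx HPk scaleNr oppr_eq0.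
Qed.

Lemma map_mx_Re_sum n (Q : 'I_n -> 'M[R[i]]_d) :
  map_mx (@complex.Re R) (\sum_k Q k) = \sum_k map_mx (@complex.Re R) (Q k).
Proof.
have ReD : {morph @complex.Re R : a b / a + b} by move=> [? ?] [? ?].
apply/matrixP => i j; rewrite mxE !summxE (big_morph _ ReD (erefl _)).
by apply: eq_bigr => k _; rewrite mxE.
Qed.

Lemma Re_realM (a : R) (z : R[i]) : complex.Re (a%:C%C * z) = a * complex.Re z.
Proof. by case: z => x y /=; rewrite mul0r subr0. Qed.

Lemma map_mx_Re_mul H (Q : 'M[R[i]]_d) :
  map_mx (@complex.Re R) (map_mx (real_complex R) H *m Q) =
  H *m map_mx (@complex.Re R) Q.
Proof.
have ReD : {morph @complex.Re R : a b / a + b} by move=> [? ?] [? ?].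
apply/matrixP => i j; rewrite mxE !mxE (big_morph _ ReD (erefl _)).
by apply: eq_bigr => k _; rewrite !mxE Re_realM.
Qed.

Lemma map_mx_Re_scale (a : R) (Q : 'M[R[i]]_d) :
  map_mx (@complex.Re R) (a%:C%C *: Q) = a *: map_mx (@complex.Re R) Q.
Proof. by apply/matrixP => i j; rewrite !mxE Re_realM. Qed.

(** The complex spectral theorem gives eigenprojections [Q k], conjugates of the diagonal matrix
    units by the unitary matrix [U], that sum to the identity. Since [H] and its eigenvalues are
    real, entrywise real parts preserve both relations; they need not be projections any more. *)
Lemma saddle_of_symmetric H : H^T = H ->
  (forall l : R[i], eigenvalue (map_mx (real_complex R) H) l -> complex.Re l != 0) ->
  saddle H.
Proof.
move=> Hs Hh; split=> //.
pose Hc := map_mx (real_complex R) H.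
have Hc_herm : Hc \is hermsymmx.
  apply: realsym_hermsym.
    apply/is_hermitianmxP; rewrite expr0 scale1r /Hc map_mx_id// map_trmx.
    by rewrite Hs.
  by apply/mxOverP => i j; rewrite mxE; apply/complex_realP; exists (H i j).
have /hermitian_normalmx/orthomx_spectralP HE := Hc_herm.
have := hermitian_spectral_diag_real Hc_herm.
set U := spectralmx Hc in HE *; set D := spectral_diag Hc in HE * => Dr.
have Uu : U \in unitmx by exact: spectral_unit.
pose l k := complex.Re (D 0 k).
have lE k : D 0 k = (l k)%:C%C.
  by rewrite /l RRe_real//; exact: (mxOverP Dr).
pose Q k := invmx U *m delta_mx k k *m U.
have QH k : Hc *m Q k = (l k)%:C%C *: Q k.
  have dE : diag_mx D *m delta_mx k k = (l k)%:C%C *: delta_mx k k.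
    apply/matrixP => i j; rewrite mul_diag_mx !mxE -lE.
    by have [->|] := eqVneq i k; rewrite //= !mulr0.
  by rewrite HE /Q !mulmxA mulmxK// -(mulmxA (invmx U) (diag_mx D)) dE -scalemxAr -scalemxAl.
exists (fun k => map_mx (@complex.Re R) (Q k)), l.
split=> [|k]; [|split].
- rewrite -map_mx_Re_sum /Q -mulmx_suml -mulmx_sumr.
  have -> : \sum_k delta_mx k k = 1%:M :> 'M[R[i]]_d.
    apply/matrixP => i j; rewrite summxE !mxE (bigD1 i)//= big1 ?addr0.
      by rewrite mxE eqxx eq_sym.
    by move=> k ki; rewrite mxE eq_sym (negbTE ki).
  rewrite mulmx1 mulVmx//; apply/matrixP => i j; rewrite !mxE.
  by case: (i == j).
- by rewrite -map_mx_Re_mul QH map_mx_Re_scale.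
- suff : eigenvalue Hc (D 0 k) by rewrite lE => /Hh.
  apply/eigenvalueP; exists (row k U); last first.
    apply/eqP => Uk; have : row k (U *m invmx U) = 0 by rewrite row_mul Uk mul0mx.
    rewrite mulmxV// => /rowP/(_ k); rewrite !mxE eqxx => /eqP.
    by rewrite oner_eq0.
  by rewrite -row_mul HE !mulmxA mulmxV// mul1mx row_mul row_diag_mx -scalemxAl -rowE.
Qed.

(** Dividing each [P k] by its eigenvalue gives a right inverse, because the [P k] sum to the
    identity. *)
Lemma saddle_inv H : saddle H -> exists K, K *m H = 1%:M.
Proof.
move=> [_ [P [l [P1 HP]]]]; exists (\sum_k (l k)^-1 *: P k); apply: mulmx1C.
rewrite mulmx_sumr -P1; apply: eq_bigr => k _; have [HPk lk] := HP k.
by rewrite -scalemxAr HPk scalerA mulVf// scale1r.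
Qed.

Lemma saddle_coercive H : saddle H -> exists2 c : R, 0 < c &
  forall u, c * dot u u <= dot (H *m u) (H *m u).
Proof.
move=> /saddle_inv[K KH]; pose q := d%:R * (d%:R * `|K|) ^+ 2 + 1.
have q0 : 0 < q by rewrite ltr_pwDr// mulr_ge0// exprn_ge0// mulr_ge0.
exists q^-1 => [|u]; first by rewrite invr_gt0.
rewrite mulrC ler_pdivrMr// (le_trans (dot_le_norm2 u))//.
have : `|u| <= d%:R * `|K| * `|H *m u|.
  by rewrite -{1}[u]mul1mx -KH -mulmxA norm_mulmx_le.
move=> uK; have : `|u| ^+ 2 <= (d%:R * `|K|) ^+ 2 * dot (H *m u) (H *m u).
  rewrite (le_trans (lerXn2r 2 _ _ uK)) ?nnegrE ?mulr_ge0// exprMn.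
  by rewrite ler_wpM2l ?exprn_ge0 ?mulr_ge0// norm2_le_dot.
move=> u2; rewrite (@le_trans _ _ (d%:R * ((d%:R * `|K|) ^+ 2 * dot (H *m u) (H *m u))))//.
  by rewrite ler_wpM2l.
by rewrite /q mulrA mulrC ler_wpM2l ?dot_ge0// lerDl.
Qed.

(* Plays the role of an exponential dichotomy of [y' = A y] on the whole line,
   without asking for uniqueness or linearity of the bounded solution. *)
Definition bsolvable (A : R -> 'M[R]_d) (K : R) :=
  forall (h : R -> 'cV[R]_d) m, continuous h -> (forall t, `|h t| <= m) ->
  exists y, (forall t, vder y t (A t *m y t + h t)) /\ forall t, `|y t| <= K * m.

(** Each entry of [z k] solves a scalar equation with rate [l k] and the same forcing [h]; the sum
    of the [P k *m z k] solves the system since [H *m P k] is [l k *: P k] and the [P k] resolve the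
    identity. *)
Lemma saddle_bsolvable H : saddle H -> exists2 K, 0 < K & bsolvable (fun=> H) K.
Proof.
move=> [_ [P [l [P1 HP]]]].
pose K := \sum_k d%:R * `|P k| * `|l k|^-1 + 1.
have K0 : 0 <= \sum_k d%:R * `|P k| * `|l k|^-1.
  by apply: sumr_ge0 => k _; rewrite !mulr_ge0.
exists K => [|h m hc hm]; first by rewrite ltr_pwDr.
have m0 : 0 <= m by exact: le_trans (hm 0).
have /choice[z zP] : forall k, exists z : R -> 'cV[R]_d,
    (forall t, vder z t (l k *: z t + h t)) /\ forall t, `|z t| <= m / `|l k|.
  move=> k; have /choice[z zP] : forall i, exists z : R -> R,
      (forall t : R, is_derive t 1 z (l k * z t + h t i 0)) /\
      forall t, `|z t| <= m / `|l k|.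
    move=> i; apply: bounded_solution; first by have [] := HP k.
      by move=> t; have /continuous_mxP := hc t; exact.
    by move=> t; rewrite (le_trans (coord_le_norm _ _ _)).
  exists (fun t => \col_i z i t); split=> [t i|t].
    rewrite !mxE; have [zi _] := zP i.
    by under eq_fun do rewrite mxE.
  apply: norm_le_col => [|i]; first by rewrite divr_ge0.
  by rewrite mxE; have [] := zP i.
exists (fun t => \sum_k P k *m z k t); split=> t.
  have -> : H *m (\sum_k P k *m z k t) + h t =
      \sum_k P k *m (l k *: z k t + h t).
    rewrite -[h t in LHS]mul1mx -P1 mulmx_sumr mulmx_suml -big_split/=.
    apply: eq_bigr => k _; rewrite mulmxDr mulmxA; have [-> _] := HP k.
    by rewrite -scalemxAl scalemxAr.
  by apply: vder_sum => k; apply: vder_mulmx; have [] := zP k.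
rewrite (le_trans (ler_norm_sum _ _ _))//.
rewrite (@le_trans _ _ (\sum_k d%:R * `|P k| * `|l k|^-1 * m))//; last first.
  by rewrite -mulr_suml /K ler_wpM2r// lerDl.
apply: ler_sum => k _; rewrite (le_trans (norm_mulmx_le _ _))//.
rewrite -[leRHS]mulrA ler_wpM2l ?mulr_ge0// mulrC.
by have [_ ] := zP k; exact.
Qed.

End spectral.

(** * Bounded solutions by iteration *)

Section limits.
Context {R : realType}.

Lemma le_of_eq (x y : R) : x = y -> x <= y.
Proof. by move=> ->. Qed.

Lemma continuous_scale (T : topologicalType) (c : R) (f : T -> R) :
  continuous f -> continuous (fun t => c * f t).
Proof. by move=> fc t; apply: cvgM; [exact: cvg_cst|exact: fc]. Qed.

Lemma le_add_geometric (x b c : R) : (forall n : nat, x <= b + c / 2 ^+ n) -> x <= b.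
Proof.
move=> xb; apply/ler_addgt0Pl => e e0.
pose n := Num.Def.archi_bound (`|c| / e).
apply: (le_trans (xb n)); rewrite addrC lerD2r ler_pdivrMr ?exprn_gt0//.
rewrite (le_trans (ler_norm _))// -ler_pdivrMl// mulrC.
rewrite (le_trans (ltW (archi_boundP _)))//; first by rewrite divr_ge0// ltW.
by rewrite -natrX ler_nat ltnW// ltn_expl.
Qed.

(** The intervals of centre [u n] and radius [r n], the sum of all later increments, are nested; the
    supremum of their left ends lies in each of them. *)
Lemma geometric_limit (u : nat -> R) (c : R) :
  (forall n, `|u n.+1 - u n| <= c / 2 ^+ n) ->
  exists l, forall n, `|l - u n| <= 2 * c / 2 ^+ n.
Proof.
move=> uc.
have c0 : 0 <= c by have := le_trans (normr_ge0 _) (uc 0%N); rewrite expr0 divr1.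
pose r n := 2 * c / 2 ^+ n.
have rS n : r n.+1 = c / 2 ^+ n.
  by rewrite /r exprS; field; rewrite expf_neq0.
have rE n : r n = 2 * (c / 2 ^+ n) by rewrite /r mulrA.
have r0 n : 0 <= r n by rewrite /r divr_ge0 ?mulr_ge0// exprn_ge0.
pose a n := u n - r n; pose b n := u n + r n.
have aS n m : (n <= m)%N -> a n <= a m.
  move: n m; apply: (@homo_leq _ a (fun x y => is_true (x <= y))) => //.
    by move=> x y z; exact: le_trans.
  move=> n; rewrite /a rS rE; have := uc n; rewrite ler_norml; lra.
have bS n m : (n <= m)%N -> b m <= b n.
  move: n m; apply: (@homo_leq _ b (fun x y => is_true (y <= x))) => //.
    by move=> x y z xy yz; exact: le_trans yz xy.
  move=> n; rewrite /b rS rE; have := uc n; rewrite ler_norml; lra.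
have ab n m : a n <= b m.
  have [nm|/ltnW mn] := leqP n m.
    by rewrite (le_trans (aS _ _ nm))// /a /b; have := r0 m; lra.
  by rewrite (le_trans _ (bS _ _ mn))// /a /b; have := r0 n; lra.
exists (sup (range a)) => n; have h1 : a n <= sup (range a).
  by apply: ub_le_sup; [exists (b 0%N) => _ [m _ <-]|exists n].
have h2 : sup (range a) <= b n.
  by apply: ge_sup; [exists (a 0%N), 0%N|move=> _ [m _ <-]].
by move: h1 h2; rewrite /a /b ler_norml -/(r n); lra.
Qed.

Lemma geometric_limit_col d (u : nat -> 'cV[R]_d) (c : R) :
  (forall n, `|u n.+1 - u n| <= c / 2 ^+ n) ->
  exists l, forall n, `|l - u n| <= 2 * c / 2 ^+ n.
Proof.
move=> uc.
have c0 : 0 <= c by have := le_trans (normr_ge0 _) (uc 0%N); rewrite expr0 divr1.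
have /choice[l lP] : forall i, exists l, forall n, `|l - u n i 0| <= 2 * c / 2 ^+ n.
  move=> i; apply: geometric_limit => n; rewrite (le_trans _ (uc n))//.
  by have := coord_le_norm (u n.+1 - u n) i 0; rewrite !mxE.
exists (\col_i l i) => n; apply: norm_le_col => [|i].
  by rewrite divr_ge0 ?mulr_ge0// exprn_ge0.
by rewrite !mxE.
Qed.

Lemma is_derive_eps (f : R -> R) (t l : R) : is_derive t 1 f l <->
  forall e, 0 < e -> exists2 dl, 0 < dl &
    forall h, `|h| < dl -> `|f (h + t) - f t - h * l| <= e * `|h|.
Proof.
have fE h : h != 0 -> l - h^-1 *: (f (h *: 1 + t) - f t) =
    - (h^-1 * (f (h + t) - f t - h * l)).
  by move=> h0; rewrite /GRing.scale/= mulr1; field.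
split=> [[fd fl] e e0|H].
  have : h^-1 *: (f (h *: 1 + t) - f t) @[h --> 0^'] --> l.
    by rewrite -fl; exact: fd.
  move=> /cvgrPdist_le /(_ e e0); rewrite near_withinE => -[dl /= dl0 H].
  exists dl => // h hdl; have [->|h0] := eqVneq h 0.
    by rewrite add0r subrr mul0r subr0 normr0 mulr0.
  have := H h; rewrite /= sub0r normrN => /(_ hdl h0); rewrite fE// normrN normrM.
  by rewrite normfV mulrC ler_pdivrMr// normr_gt0.
have H' : h^-1 *: (f (h *: 1 + t) - f t) @[h --> 0^'] --> l.
  apply/cvgrPdist_le => e e0; rewrite near_withinE.
  have [dl dl0 Hd] := H e e0; exists dl => //= h.
  rewrite /= sub0r normrN => hdl h0; rewrite fE// normrN normrM normfV mulrC.
  by rewrite ler_pdivrMr ?normr_gt0// Hd.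
apply: DeriveDef; first by apply/cvg_ex; exists l.
exact/cvg_lim.
Qed.

(** Continuity of [w] at [t] makes both convergences uniform near [t]. The mean value inequality for
    [yn n s - g t * s] bounds its increment by [e * |h|] up to a term that vanishes as [n] grows. *)
Lemma is_derive_limit (y g w : R -> R) (yn gn : nat -> R -> R) (t : R) :
  (forall n (s : R), is_derive s 1 (yn n) (gn n s)) ->
  {for t, continuous g} -> {for t, continuous w} ->
  (forall n s, `|y s - yn n s| <= w s / 2 ^+ n) ->
  (forall n s, `|g s - gn n s| <= w s / 2 ^+ n) ->
  is_derive t 1 y (g t).
Proof.
move=> ynd gc wc yyn ggn; apply/is_derive_eps => e e0.
have : \forall s \near t, `|g s - g t| <= e /\ w s <= w t + 1.
  apply: filterI.
    by move/cvgrPdist_le : gc => /(_ e e0); apply: filterS => s; rewrite distrC.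
  move/cvgrPdist_le : wc => /(_ 1 ltr01); apply: filterS => s.
  by rewrite ler_norml; lra.
move=> /nbhs_ballP[dl /= dl0 B]; exists dl => // h hdl.
have Bs s : `|s - t| <= `|h| -> `|g s - g t| <= e /\ w s <= w t + 1.
  by move=> st; apply: B; rewrite /ball/= distrC; exact: le_lt_trans hdl.
apply: (@le_add_geometric _ _ ((w t + 1) * (`|h| + 2))) => n.
have n2 : 0 < 2 ^+ n :> R by rewrite exprn_gt0.
have w2 s : `|s - t| <= `|h| -> w s / 2 ^+ n <= (w t + 1) / 2 ^+ n.
  by move=> /Bs[_ ?]; rewrite ler_pM2r ?invr_gt0.
have zd (s : R) : is_derive s 1 (fun s => yn n s - g t * s) (gn n s - g t * 1).
  by apply: is_deriveB; exact: is_deriveZ_R.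
have step (a b : R) : a <= b -> (forall s, a <= s <= b -> `|s - t| <= `|h|) ->
    b - a = `|h| ->
    `|(yn n b - g t * b) - (yn n a - g t * a)| <=
      (e + (w t + 1) / 2 ^+ n) * `|h|.
  move=> ab Hs <-; apply: (lipschitz_of_derive ab (fun s _ => zd s)).
  move=> s /Hs st; rewrite mulr1.
  have -> : gn n s - g t = (g s - g t) - (g s - gn n s) by ring.
  rewrite (le_trans (ler_normB _ _))// lerD//; first by have [] := Bs _ st.
  by rewrite (le_trans (ggn n s))// w2.
have key : `|(yn n (h + t) - g t * (h + t)) - (yn n t - g t * t)| <=
    (e + (w t + 1) / 2 ^+ n) * `|h|.
  have [h0|h0] := leP 0 h.
    apply: step; rewrite ?ger0_norm//; first by rewrite lerDr.
    - by move=> s /andP[ts sh]; rewrite ger0_norm ?subr_ge0// lerBlDr.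
    - by rewrite addrK.
  rewrite distrC; apply: step; rewrite ?ltr0_norm//.
  - by rewrite gerDr ltW.
  - by move=> s /andP[ts sh]; rewrite ler0_norm ?subr_le0// opprB; lra.
  - by ring.
have k1 := le_trans (yyn n (h + t)) (w2 (h + t) _).
have k2 := le_trans (yyn n t) (w2 t _).
have {}k1 : `|y (h + t) - yn n (h + t)| <= (w t + 1) / 2 ^+ n by rewrite k1// addrK.
have {}k2 : `|y t - yn n t| <= (w t + 1) / 2 ^+ n by rewrite k2// subrr normr0.
have -> : y (h + t) - y t - h * g t = (yn n (h + t) - g t * (h + t) - (yn n t - g t * t))
  + (y (h + t) - yn n (h + t)) - (y t - yn n t) by ring.
have -> : (e * `|h| + (w t + 1) * (`|h| + 2) / 2 ^+ n) =
  (e + (w t + 1) / 2 ^+ n) * `|h| + (w t + 1) / 2 ^+ n + (w t + 1) / 2 ^+ n by ring.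
by rewrite (le_trans (ler_normB _ _))// lerD// (le_trans (ler_normD _ _))// lerD.
Qed.

Lemma vder_limit d (y g : R -> 'cV[R]_d) (w : R -> R)
    (yn gn : nat -> R -> 'cV[R]_d) (t : R) :
  (forall n s, vder (yn n) s (gn n s)) ->
  {for t, continuous g} -> {for t, continuous w} ->
  (forall n s, `|y s - yn n s| <= w s / 2 ^+ n) ->
  (forall n s, `|g s - gn n s| <= w s / 2 ^+ n) ->
  vder y t (g t).
Proof.
move=> ynd gc wc yyn ggn i.
apply: (@is_derive_limit _ (fun s => g s i 0) w (fun n s => yn n s i 0)
  (fun n s => gn n s i 0)) => //.
- by move=> n s; exact: ynd.
- by move/continuous_mxP : gc; exact.
- move=> n s; rewrite (le_trans _ (yyn n s))//.
  by have := coord_le_norm (y s - yn n s) i 0; rewrite !mxE.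
- move=> n s; rewrite (le_trans _ (ggn n s))//.
  by have := coord_le_norm (g s - gn n s) i 0; rewrite !mxE.
Qed.

Lemma continuous_limit d (y : R -> 'cV[R]_d) (w : R -> R)
    (yn : nat -> R -> 'cV[R]_d) :
  (forall n, continuous (yn n)) -> continuous w ->
  (forall n s, `|y s - yn n s| <= w s / 2 ^+ n) -> continuous y.
Proof.
move=> ync wc yyn t; apply/cvgrPdist_le => e e0.
have [n ne] : exists n : nat, (w t + 1) / 2 ^+ n <= e / 3.
  apply: contrapT => /forallNP H.
  have : e / 3 <= 0.
    apply: (@le_add_geometric _ _ (w t + 1)) => n; rewrite add0r.
    by have /negP := H n; rewrite -ltNge => /ltW.
  by rewrite leNgt divr_gt0.
have n2 : 0 < 2 ^+ n :> R by rewrite exprn_gt0.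
have : \forall s \near t, w s <= w t + 1.
  move/cvgrPdist_le : (wc t) => /(_ 1 ltr01); apply: filterS => s.
  by rewrite ler_norml; lra.
have e3 : 0 < e / 3 by rewrite divr_gt0.
move/cvgrPdist_le : (ync n t) => /(_ _ e3); apply: filterS2 => s yns ws.
have k1 : `|y s - yn n s| <= e / 3.
  by rewrite (le_trans (yyn n s))// (le_trans _ ne)// ler_pM2r ?invr_gt0.
have k2 : `|y t - yn n t| <= e / 3.
  by rewrite (le_trans (yyn n t))// (le_trans _ ne)// ler_pM2r ?invr_gt0// lerDl.
have -> : y t - y s = (y t - yn n t) + (yn n t - yn n s) - (y s - yn n s).
  by rewrite addrA subrK opprB addrA subrK.
rewrite (le_trans (ler_normB _ _))//.
have := ler_normD (y t - yn n t) (yn n t - yn n s); lra.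
Qed.

End limits.

(** * Newton-type iteration in weighted sup norms *)

Section iteration.
Context {R : realType} {d : nat}.

(** One notion serves two purposes. With [w = 1] and [pin = 0] it is bounded solvability on the
    line, without condition at [0]; with an exponential weight and [pin = 1] the last clause reads
    [y 0 = 0], as for an initial value problem. *)
Definition wsolvable (A : R -> 'M[R]_d) (w : R -> R) (pin K : R) :=
  forall (h : R -> 'cV[R]_d) m, continuous h -> (forall t, `|h t| <= m * w t) ->
  exists y, [/\ forall t, vder y t (A t *m y t + h t),
    forall t, `|y t| <= K * m * w t & pin *: y 0 = 0].

(* Newton-type iteration as in Graves' theorem: [y_(n+1) - y_n] is a bounded
   solution for the forcing [N y_n - N y_(n-1)]; neither linearity nor
   uniqueness of the bounded solutions is needed. *)
Lemma perturbed_solution (A : R -> 'M[R]_d) (w : R -> R) (pin K rho th m0 : R)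
    (N : (R -> 'cV[R]_d) -> R -> 'cV[R]_d) :
  continuous A -> continuous w -> (forall t, 0 < w t) -> 0 <= K -> 0 <= th ->
  wsolvable A w pin K ->
  (forall y : R -> 'cV[R]_d, continuous y -> (forall t, `|y t| <= rho * w t) -> continuous (N y)) ->
  (forall (y z : R -> 'cV[R]_d) c, continuous y -> continuous z ->
    (forall t, `|y t| <= rho * w t) -> (forall t, `|z t| <= rho * w t) ->
    (forall t, `|y t - z t| <= c * w t) ->
    forall t, `|N y t - N z t| <= th * c * w t) ->
  (forall t, `|N (fun=> 0) t| <= m0 * w t) ->
  K * th <= 2^-1 -> 2 * K * m0 <= rho ->
  exists y, [/\ continuous y, forall t, vder y t (A t *m y t + N y t),
    forall t, `|y t| <= 2 * K * m0 * w t & pin *: y 0 = 0].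
Proof.
move=> Ac wc w0 K0 th0 As Nc NL N0 Kth Km.
have m00 : 0 <= m0 by have := le_trans (normr_ge0 _) (N0 0); rewrite pmulr_lge0.
have Km0 : 0 <= K * m0 by rewrite mulr_ge0.
(* The solution operator is made total, with value [0] on inadmissible forcings, so that the
   iteration can be defined before its invariants are known. *)
have /choice[G GP] : forall hm : (R -> 'cV[R]_d) * R, exists y, continuous hm.1 ->
    (forall t, `|hm.1 t| <= hm.2 * w t) ->
    [/\ forall t, vder y t (A t *m y t + hm.1 t),
    forall t, `|y t| <= K * hm.2 * w t & pin *: y 0 = 0].
  move=> [h m]; have [[hc hm]|H] := pselect (continuous h /\
      (forall t, `|h t| <= m * w t)).
    by have [y yP] := As h m hc hm; exists y.
  by exists (fun=> 0) => /= hc hm; exfalso; apply: H.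
pose z0 : R -> 'cV[R]_d := fun=> 0.
(* The recursion carries two consecutive iterates, since the next correction is forced by the
   difference of their images under [N]. *)
pose s := fix s n := match n with
  | 0 => (z0, G (N z0, m0))
  | n'.+1 => let pq := s n' in
      (pq.2, fun t => pq.2 t + G (fun t => N pq.2 t - N pq.1 t, m0 / 2 ^+ n) t)
  end.
(* Partial sum of [K * m0 / 2 ^+ i] over [i < n]: the total size of the first [n] corrections, which
   keeps every iterate in the ball where the hypotheses on [N] apply. *)
pose r n : R := 2 * K * m0 * (1 - (2 ^+ n)^-1).
have r_le n : r n <= 2 * K * m0.
  have k20 : 0 <= 2 * K * m0 by rewrite -mulrA mulr_ge0.
  by rewrite /r ler_piMr// lerBlDr lerDl invr_ge0 exprn_ge0.
have rle_rho n t : r n * w t <= rho * w t.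
  by rewrite ler_pM2r// (le_trans (r_le _)).
have inv n : [/\ continuous (s n).1, continuous (s n).2,
    forall t, vder (s n).2 t (A t *m (s n).2 t + N (s n).1 t),
    forall t, `|(s n).2 t - (s n).1 t| <= K * (m0 / 2 ^+ n) * w t
  & [/\ forall t, `|(s n).1 t| <= r n * w t, forall t, `|(s n).2 t| <= r n.+1 * w t,
    pin *: (s n).1 0 = 0 & pin *: (s n).2 0 = 0]].
  elim: n => [|n [pc qc qd qp [pb qb pp pq]]].
    have cz : continuous z0 by move=> t; exact: cst_continuous.
    have z0b t : `|z0 t| <= rho * w t.
      rewrite normr0 mulr_ge0 ?(ltW (w0 t))// (le_trans _ Km)// -mulrA.
      by rewrite mulr_ge0.
    have := GP (N z0, m0) (Nc _ cz z0b) N0; set y := G _ => -[/= yd yb yp].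
    split=> //=.
    - by move=> t; exact: vder_cts (yd t).
    - by move=> t; rewrite subr0 expr0 divr1.
    - split=> //=; rewrite ?scaler0//.
        by move=> t; rewrite /r expr0 invr1 subrr mulr0 mul0r normr0.
      move=> t; rewrite (le_trans (yb t))// /r expr1.
      by apply: le_of_eq; field.
  set p := (s n).1 in pc qd qp pb pp *; set q := (s n).2 in qc qd qp qb pq *.
  have n20 : 0 < 2 ^+ n :> R by rewrite exprn_gt0.
  have pb' t : `|p t| <= rho * w t by rewrite (le_trans (pb t)).
  have qb' t : `|q t| <= rho * w t by rewrite (le_trans (qb t)).
  have hc : continuous (fun t => N q t - N p t).
    by move=> t; apply: continuousB; [exact: Nc|exact: Nc].
  have hb t : `|N q t - N p t| <= m0 / 2 ^+ n.+1 * w t.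
    rewrite (le_trans (NL q p _ qc pc qb' pb' qp t))//.
    rewrite ler_pM2r// mulrA [th * K]mulrC exprS.
    rewrite (@le_trans _ _ (2^-1 * (m0 / 2 ^+ n)))//.
      by rewrite ler_wpM2r// divr_ge0// ltW.
    by apply: le_of_eq; field; rewrite gt_eqF.
  have := GP (fun t => N q t - N p t, m0 / 2 ^+ n.+1) hc hb.
  rewrite -/p -/q [s n.+1]/= -/p -/q; set y := G _ => -[/= yd yb yp].
  have dd t : vder (fun t => q t + y t) t (A t *m (q t + y t) + N q t).
    apply: vder_eq; first exact: vderD (qd t) (yd t).
    by rewrite mulmxDr addrACA [N p t + _]addrC subrK.
  split=> //=.
  - by move=> t; exact: vder_cts (dd t).
  - by move=> t; rewrite addrC addKr.
  - split=> //=; last by rewrite scalerDr pq yp addr0.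
    move=> t; rewrite (le_trans (ler_normD _ _))// (le_trans (lerD (qb t) (yb t)))//.
    rewrite -mulrDl ler_pM2r// /r !exprS.
    by apply: le_of_eq; field; rewrite gt_eqF.
pose yn n := (s n).1.
have ynS n t : `|yn n.+1 t - yn n t| <= (K * m0 * w t) / 2 ^+ n.
  have [_ _ _ H _] := inv n; rewrite (le_trans (H t))//.
  by apply: le_of_eq; field; rewrite expf_neq0.
have /choice[y yP] : forall t, exists l, forall n, `|l - yn n t| <= 2 * (K * m0 * w t) / 2 ^+ n.
  by move=> t; exact: geometric_limit_col.
have ync n : continuous (yn n) by have [] := inv n.
have yc : continuous y.
  apply: (@continuous_limit _ _ y (fun t => 2 * (K * m0 * w t)) yn) => //.
  by apply: continuous_scale; exact: continuous_scale.
have ynb n t : `|yn n t| <= 2 * K * m0 * w t.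
  have [_ _ _ _ [H _ _ _]] := inv n; rewrite (le_trans (H t))//.
  by rewrite ler_pM2r.
have yb t : `|y t| <= 2 * K * m0 * w t.
  apply: (@le_add_geometric _ _ _ (2 * (K * m0 * w t))) => n.
  have := yP t n; have := ynb n t; have := ler_normD (yn n t) (y t - yn n t).
  by rewrite addrC subrK; lra.
have rhob (v : R -> 'cV[R]_d) : (forall t, `|v t| <= 2 * K * m0 * w t) ->
    forall t, `|v t| <= rho * w t.
  by move=> vb t; rewrite (le_trans (vb t))// ler_pM2r.
(* A common weight for the errors of the iterates and of their derivatives: the term in [A] and [th]
   controls the right-hand sides, and [1] the iterates themselves. *)
pose W t := (d%:R * `|A t| + th + 1) * (2 * (K * m0 * w t)).
have Wc : continuous W.
  have wc2 : continuous (fun t => 2 * (K * m0 * w t)).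
    by apply: continuous_scale; exact: continuous_scale.
  have Anc : continuous (fun t => `|A t|).
    by move=> x; apply: (@continuous_comp _ _ _ A (fun B => `|B|)); [exact: Ac|exact: norm_continuous].
  have dAc := continuous_scale (c := d%:R) Anc.
  move=> t; apply: cvgM; last exact: wc2.
  apply: cvgD; last exact: cvg_cst.
  apply: cvgD; last exact: cvg_cst.
  exact: dAc.
have kw0 t : 0 <= 2 * (K * m0 * w t).
  by rewrite mulr_ge0// mulr_ge0// ltW.
exists y; split=> //.
- move=> t; apply: (@vder_limit _ _ y (fun t => A t *m y t + N y t) W
    (fun n => yn n.+1) (fun n t => A t *m yn n.+1 t + N (yn n) t)) => //.
  + by move=> n x; have [_ _ H _ _] := inv n; exact: H.
  + have Nyc : continuous (N y) by apply: Nc => //; exact: rhob.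
    apply: continuousD; last exact: Nyc.
    by apply: continuous_mulmx; [exact: Ac|exact: yc].
  + exact: Wc.
  + move=> n x; rewrite (le_trans (yP x n.+1))// exprS.
    rewrite (@le_trans _ _ (2 * (K * m0 * w x) / 2 ^+ n))//.
      rewrite ler_wpM2l// invfM ler_piMl ?invr_ge0 ?exprn_ge0//.
      by rewrite invf_le1// ler1n.
    rewrite ler_wpM2r ?invr_ge0 ?exprn_ge0// /W ler_peMl//.
    by rewrite lerDr addr_ge0// mulr_ge0.
  + move=> n x; rewrite opprD addrACA -mulmxBr (le_trans (ler_normD _ _))//.
    have n20 : 0 < 2 ^+ n :> R by rewrite exprn_gt0.
    have a1 : `|A x *m (y x - yn n.+1 x)| <= d%:R * `|A x| * (2 * (K * m0 * w x)) / 2 ^+ n.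
      rewrite (le_trans (norm_mulmx_le _ _))// -[leRHS]mulrA ler_wpM2l ?mulr_ge0//.
      rewrite (le_trans (yP x n.+1))// ler_wpM2l// exprS invfM.
      by rewrite ler_piMl ?invr_ge0 ?exprn_ge0// invf_le1// ler1n.
    have a2 : `|N y x - N (yn n) x| <= th * (2 * (K * m0 * w x)) / 2 ^+ n.
      have -> : th * (2 * (K * m0 * w x)) / 2 ^+ n = th * (2 * K * m0 / 2 ^+ n) * w x.
        by field; rewrite gt_eqF.
      apply: NL => //; [exact: rhob|exact: rhob|].
      move=> u; rewrite (le_trans (yP u n))//.
      by apply: le_of_eq; field; rewrite gt_eqF.
    rewrite (le_trans (lerD a1 a2))// -mulrDl -mulrDl ler_pM2r ?invr_gt0//.
    by rewrite /W ler_wpM2r// lerDl.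
- have ppn n : pin *: yn n 0 = 0 by have [_ _ _ _ []] := inv n.
  apply/eqP; rewrite -normr_eq0 eq_le normr_ge0 andbT.
  apply: (@le_add_geometric _ _ _ (`|pin| * (2 * (K * m0 * w 0)))) => n.
  have -> : pin *: y 0 = pin *: (y 0 - yn n 0) by rewrite scalerBr ppn subr0.
  rewrite normrZ add0r -[leRHS]mulrA; apply: ler_wpM2l => //; exact: yP.
Qed.

End iteration.

(** Exponential rate of [dot (y t) (y t)] when [y'] is at most [a * |y| + b] in sup norm: the
    factors [d] come from [dot_le], the middle term absorbs the product of [|y|] and [b], and [1]
    keeps the rate positive in every dimension. *)
Definition growth (R : realType) (d : nat) (a : R) : R :=
  2 * d%:R * a + d%:R + 1.

Section gronwall_vector.
Context {R : realType} {d : nat}.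
Implicit Types (y g : R -> 'cV[R]_d) (A : R -> 'M[R]_d).

Lemma gronwall_vector y g (a b t : R) : 0 <= a -> 0 <= t ->
  (forall s : R, 0 <= s <= t -> vder y s (g s)) ->
  (forall s : R, 0 <= s <= t -> `|g s| <= a * `|y s| + b) ->
  dot (y t) (y t) <= expR (growth d a * t) * (dot (y 0) (y 0) + b ^+ 2).
Proof.
move=> a0 t0 yd gb.
have da0 : 0 <= 2 * d%:R * a by rewrite !mulr_ge0.
have k0 : 0 < growth d a by rewrite ltr_pwDr// addr_ge0.
have H : dot (y t) (y t) + d%:R * b ^+ 2 / growth d a <=
    expR (growth d a * t) * (dot (y 0) (y 0) + d%:R * b ^+ 2 / growth d a).
  apply: (gronwall k0 t0 (fun s st => is_derive_dot (yd s st) (yd s st))).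
  move=> s st; rewrite (dotC (g s)) -mulr2n -mulr_natl.
  have h1 : dot (y s) (g s) <= d%:R * (`|y s| * (a * `|y s| + b)).
    rewrite (le_trans (ler_norm _))// (le_trans (dot_le _ _))//.
    by rewrite ler_wpM2l// ler_wpM2l// gb.
  have h2 : 2 * (`|y s| * b) <= `|y s| ^+ 2 + b ^+ 2.
    by have := sqr_ge0 (`|y s| - b); rewrite sqrrB; lra.
  have h3 := norm2_le_dot (y s).
  have h4 : d%:R * (2 * (`|y s| * b)) <= d%:R * (dot (y s) (y s) + b ^+ 2).
    by rewrite ler_wpM2l//; lra.
  have h5 : 2 * d%:R * a * `|y s| ^+ 2 <= 2 * d%:R * a * dot (y s) (y s).
    by rewrite ler_wpM2l.
  have h6 := dot_ge0 (y s).
  move: h1 h4 h5; rewrite /growth; move: (dot (y s) (g s)) (dot (y s) (y s)) h6 => p q q0.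
  move: (`|y s|) => n; lra.
apply: (@le_trans _ _ (dot (y t) (y t) + d%:R * b ^+ 2 / growth d a)).
  by rewrite lerDl divr_ge0 ?(ltW k0)// mulr_ge0// sqr_ge0.
rewrite (le_trans H)// ler_wpM2l ?expR_ge0// lerD2l ler_pdivrMr// mulrC ler_wpM2l ?sqr_ge0//.
by rewrite /growth addrAC lerDr addr_ge0.
Qed.

Lemma linear_unique A (a : R) y : (forall t, `|A t| <= a) ->
  (forall t, vder y t (A t *m y t)) -> y 0 = 0 -> forall t, y t = 0.
Proof.
move=> Aa yd y0.
have a0 : 0 <= a by exact: le_trans (Aa 0).
have fwd (B : R -> 'M[R]_d) z : (forall t, `|B t| <= a) ->
    (forall t, vder z t (B t *m z t)) -> z 0 = 0 -> forall t, 0 <= t -> z t = 0.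
  move=> Ba zd z0 t t0; apply: dot_eq0; apply/eqP; rewrite eq_le dot_ge0 andbT.
  have := @gronwall_vector z (fun s => B s *m z s) (d%:R * a) 0 t.
  rewrite z0 dot0l expr0n/= addr0 mulr0; apply=> // [|s _].
    by rewrite mulr_ge0.
  by rewrite addr0 (le_trans (norm_mulmx_le _ _))// ler_wpM2r// ler_wpM2l.
move=> t; have [t0|t0] := leP 0 t; first exact: fwd yd y0 t t0.
rewrite -[t]opprK.
apply: (fwd (fun s => - A (- s)) (fun s => y (- s))) => //.
- by move=> s; rewrite normrN.
- by move=> s; rewrite mulNmx; apply: vder_opp; exact: yd.
- by rewrite oppr0.
- by rewrite oppr_ge0 ltW.
Qed.

End gronwall_vector.

(** * Initial value problems, and persistence of bounded solvability *)

Section linear_equations.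
Context {R : realType} {d : nat}.
Implicit Types (y h : R -> 'cV[R]_d) (A : R -> 'M[R]_d).

(** Bielecki weight: in the norm that it defines, integration from [0] has norm at most [mu^-1], so
    a large [mu] makes Picard iteration contract on the whole line at once. *)
Let w mu (t : R) : R := expR (mu * `|t|).

Lemma primitive_weighted (mu m : R) (h : R -> R) : 0 < mu -> continuous h ->
  (forall t, `|h t| <= m * w mu t) ->
  exists y : R -> R, [/\ forall t : R, is_derive t 1 y (h t),
    forall t, `|y t| <= mu^-1 * m * w mu t & y 0 = 0].
Proof.
move=> mu0 hc hm; have [y [y0 yd]] := primitive hc.
exists y; split=> // t.
have m0 : 0 <= m by have := le_trans (normr_ge0 _) (hm 0); rewrite pmulr_lge0// expR_gt0.
have fwd (z g : R -> R) : (forall s : R, is_derive s 1 z (g s)) -> z 0 = 0 ->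
    (forall s, `|g s| <= m * w mu s) -> forall s, 0 <= s ->
    z s <= mu^-1 * m * expR (mu * s).
  move=> zd z0 gm s s0.
  pose e (x : R) := expR (mu * x + 0).
  have ed (x : R) : is_derive x 1 e (mu * e x).
    exact: (is_derive_reparam (f := expR)).
  have qd (x : R) : is_derive x 1 (fun x => z x - mu^-1 * m * e x)
      (g x - mu^-1 * m * (mu * e x)).
    by apply: is_deriveB; exact: is_deriveZ_R.
  have : z s - mu^-1 * m * e s <= z 0 - mu^-1 * m * e 0.
    apply: (le_of_derive_le0 s0 (fun x _ => qd x)) => x /andP[x0 _].
    have -> : mu^-1 * m * (mu * e x) = m * e x by field; rewrite gt_eqF.
    rewrite subr_le0 (le_trans (ler_norm _))// (le_trans (gm x))//.
    by rewrite /w /e addr0 ger0_norm.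
  rewrite z0 /e !addr0 => H; have : 0 <= mu^-1 * m * expR (mu * 0).
    by rewrite !mulr_ge0 ?expR_ge0// invr_ge0 ltW.
  lra.
have wN s : w mu (- s) = w mu s by rewrite /w normrN.
have ydN (s : R) : is_derive s 1 (fun s => - y s) (- h s) by exact: is_deriveN.
have yr (s : R) : is_derive s 1 (fun s => y (-1 * s + 0)) (-1 * h (-1 * s + 0)).
  exact: is_derive_reparam.
have yrN (s : R) : is_derive s 1 (fun s => - y (-1 * s + 0)) (- (-1 * h (-1 * s + 0))).
  exact: is_deriveN.
have ytE : y t = y (-1 * (- t) + 0) by rewrite addr0 mulN1r opprK.
have hr s : `|-1 * h (-1 * s + 0)| <= m * w mu s.
  by rewrite addr0 !mulN1r normrN -(wN s).
rewrite ler_norml lerNl; have [t0|t0] := leP 0 t.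
- rewrite /w ger0_norm//; apply/andP; split.
    apply: (fwd _ _ ydN) => //; first by rewrite y0 oppr0.
    by move=> s; rewrite normrN.
  exact: (fwd _ _ yd).
- rewrite /w ltr0_norm// ytE; apply/andP; split.
    apply: (fwd _ _ yrN); rewrite ?mulr0 ?addr0 ?y0 ?oppr0// ?oppr_ge0 ?ltW// => s.
    by rewrite normrN.
  by apply: (fwd _ _ yr); rewrite ?mulr0 ?addr0 ?y0// ?oppr_ge0 ?ltW.
Qed.

Lemma weight_continuous mu : continuous (w mu).
Proof.
move=> t; apply: (@continuous_comp _ _ _ (fun s : R => mu * `|s|) expR).
  by apply: (@continuous_scale _ _ mu (fun s : R => `|s|)); exact: norm_continuous.
exact: continuous_expR.
Qed.

(** Picard iteration for the solution minus [v]: the linear part is [0], the whole right-hand side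
    is the nonlinearity [N], and [pin = 1] imposes the initial value. The choice [mu = 2 * th + 1]
    puts the contraction factor [th / mu] below one half. Other initial times follow by
    translation. *)
Lemma linear_ivp A h (a m : R) (t0 : R) (v : 'cV[R]_d) :
  continuous A -> (forall t, `|A t| <= a) ->
  continuous h -> (forall t, `|h t| <= m) ->
  exists y, (forall t, vder y t (A t *m y t + h t)) /\ y t0 = v.
Proof.
wlog -> : A h t0 / t0 = 0.
  move=> H Ac Aa hc hm.
  have shc (T : topologicalType) (f : R -> T) : continuous f ->
      continuous (fun t => f (t + t0)).
    move=> fc t; apply: (@continuous_comp _ _ _ (fun s => s + t0) f).
      by apply: continuousD; [exact: cvg_id|exact: cst_continuous].
    exact: fc.
  have [|||||y [yd y0]] := H (fun t => A (t + t0)) (fun t => h (t + t0)) 0.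
  - by [].
  - exact: shc.
  - by move=> t.
  - exact: shc.
  - by move=> t.
  exists (fun t => y (t - t0)); split=> [t|]; last by rewrite subrr.
  apply: vder_shift; have := yd (t - t0); rewrite subrK.
  exact.
move=> Ac Aa hc hm.
have a0 : 0 <= a by exact: le_trans (Aa 0).
have m0 : 0 <= m by exact: le_trans (hm 0).
pose th := d%:R * a; have th0 : 0 <= th by rewrite mulr_ge0.
pose mu := 2 * th + 1; have mu0 : 0 < mu by rewrite ltr_pwDr// mulr_ge0.
have w1 t : 1 <= w mu t by rewrite -expR0 ler_expR mulr_ge0// ltW.
pose N (y : R -> 'cV[R]_d) (t : R) := A t *m (y t + v) + h t.
pose M0 := th * `|v| + m.
have [|||||||||||y [_ yd _ y0]] := @perturbed_solution R d (fun=> 0) (w mu) 1 mu^-1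
    (2 * mu^-1 * M0) th M0 N.
- by exact: continuous_cst.
- exact: weight_continuous.
- by move=> t; rewrite expR_gt0.
- by rewrite invr_ge0 ltW.
- by [].
- move=> g b gc gb.
  have /choice[y yP] : forall i, exists y : R -> R,
      [/\ forall t : R, is_derive t 1 y (g t i 0),
      forall t, `|y t| <= mu^-1 * b * w mu t & y 0 = 0].
    move=> i; apply: primitive_weighted => // [t|t].
      by have /continuous_mxP := gc t; exact.
    by rewrite (le_trans (coord_le_norm _ _ _)).
  exists (fun t => \col_i y i t); split=> [t i|t|].
  + rewrite mul0mx add0r; under eq_fun do rewrite mxE.
    by have [] := yP i.
  + have b0 : 0 <= b * w mu t by exact: le_trans (gb t).
    apply: norm_le_col => [|i]; last by rewrite mxE; have [] := yP i.
    by rewrite -mulrA mulr_ge0// invr_ge0 ltW.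
  + by apply/matrixP => i j; rewrite !mxE; have [_ _ ->] := yP i; rewrite mulr0.
- move=> y yc _; apply: continuous_add => //; apply: continuous_product => //.
  by apply: continuous_add => //; exact: continuous_cst.
- move=> y z c yc zc _ _ yz t.
  have -> : N y t - N z t = A t *m (y t - z t).
    by rewrite /N opprD addrACA subrr addr0 -mulmxBr opprD addrACA subrr addr0.
  rewrite (le_trans (norm_mulmx_le _ _))// -[leRHS]mulrA ler_pM ?mulr_ge0//.
  by rewrite /th ler_wpM2l.
- move=> t; rewrite /N add0r (@le_trans _ _ M0)//.
    rewrite (le_trans (ler_normD _ _))// lerD// (le_trans (norm_mulmx_le _ _))//.
    by rewrite ler_wpM2r// /th ler_wpM2l.
  by rewrite ler_peMr// addr_ge0// mulr_ge0.
- by rewrite mulrC ler_pdivrMr// /mu; lra.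
- by [].
exists (fun t => y t + v); split=> [t|].
  rewrite -[_ + h t]addr0; apply: vderD; last exact: vder_cst.
  by have := yd t; rewrite mul0mx add0r.
by move: y0; rewrite scale1r => ->; rewrite add0r.
Qed.

Lemma bounded_perturbation A (K rho th m0 : R)
    (N : (R -> 'cV[R]_d) -> R -> 'cV[R]_d) :
  continuous A -> 0 <= K -> 0 <= th -> bsolvable A K ->
  (forall y, continuous y -> (forall t, `|y t| <= rho) -> continuous (N y)) ->
  (forall y z c, continuous y -> continuous z ->
    (forall t, `|y t| <= rho) -> (forall t, `|z t| <= rho) ->
    (forall t, `|y t - z t| <= c) -> forall t, `|N y t - N z t| <= th * c) ->
  (forall t, `|N (fun=> 0) t| <= m0) ->
  K * th <= 2^-1 -> 2 * K * m0 <= rho ->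
  exists y, [/\ continuous y, forall t, vder y t (A t *m y t + N y t)
    & forall t, `|y t| <= 2 * K * m0].
Proof.
move=> Ac K0 th0 As Nc NL N0 Kth Km.
have [|||||||||||y [yc yd yb _]] := @perturbed_solution R d A (fun=> 1) 0 K rho th m0 N => //.
- by exact: continuous_cst.
- move=> h m hc hm; have [|y [yd yb]] := As h m hc.
    by move=> t; rewrite -[m]mulr1.
  by exists y; split=> // [t|]; rewrite ?mulr1// scale0r.
- move=> y yc yb; apply: Nc => // t; by rewrite -[rho]mulr1.
- move=> y z c yc zc yb zb yz t; rewrite mulr1.
  apply: NL => // s; by [rewrite -[rho]mulr1|rewrite -[c]mulr1].
- by move=> t; rewrite mulr1.
by exists y; split=> // t; rewrite -[leRHS]mulr1.
Qed.

(** Roughness: [(A t - H) *m y] is treated as a perturbation with small Lipschitz constant, at the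
    price of doubling [K]. *)
Lemma bsolvable_near A (H : 'M[R]_d) (K eta : R) : 0 <= K -> continuous A ->
  bsolvable (fun=> H) K -> (forall t, `|A t - H| <= eta) ->
  K * (d%:R * eta) <= 2^-1 -> bsolvable A (2 * K).
Proof.
move=> K0 Ac Hs AH Keta h m hc hm.
have eta0 : 0 <= eta by exact: le_trans (AH 0).
have [|||||||||y [_ yd yb]] := @bounded_perturbation (fun=> H) K (2 * K * m)
    (d%:R * eta) m (fun y t => (A t - H) *m y t + h t) => //.
- by exact: continuous_cst.
- by rewrite mulr_ge0.
- move=> y yc _; apply: continuous_add => //; apply: continuous_product => //.
  by apply: continuous_sub => //; exact: continuous_cst.
- move=> y z c _ _ _ _ yz t; rewrite opprD addrACA subrr addr0 -mulmxBr.
  by rewrite (le_trans (norm_mulmx_le _ _))// ler_pM ?mulr_ge0// ler_wpM2l.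
- by move=> t; rewrite mulmx0 add0r.
exists y; split=> // t; have := yd t.
by rewrite addrA -mulmxDl addrC [H + _]addrC subrK addrC.
Qed.

End linear_equations.

(** * Gluing bounded solutions, and decay *)

Section gluing.
Context {R : realType} {d : nat}.
Implicit Types (y h : R -> 'cV[R]_d) (A : R -> 'M[R]_d).

Lemma norm_le_of_dot (u : 'cV[R]_d) (x m : R) : 0 <= x -> 0 <= m ->
  dot u u <= x * m ^+ 2 -> `|u| <= (x + 1) * m.
Proof.
move=> x0 m0 ux; have xm0 : 0 <= (x + 1) * m by rewrite mulr_ge0// addr_ge0.
rewrite -(ler_pXn2r (n := 2))// ?nnegrE// (le_trans (norm2_le_dot u))//.
rewrite (le_trans ux)// exprMn ler_wpM2r ?sqr_ge0// sqrrD1.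
by have := sqr_ge0 x; lra.
Qed.

Lemma half_line_bounded A (a K T : R) : 0 <= K -> 0 <= T -> continuous A ->
  (forall t, `|A t| <= a) -> bsolvable (fun t => A (Num.max t T)) K ->
  exists2 C, 0 <= C & forall h m, continuous h -> (forall t, `|h t| <= m) ->
  exists y, (forall t, vder y t (A t *m y t + h t)) /\
    forall t, 0 <= t -> `|y t| <= C * m.
Proof.
move=> K0 T0 Ac Aa As.
have a0 : 0 <= a by exact: le_trans (Aa 0).
pose X := expR (growth d (d%:R * a) * T) * (d%:R * K ^+ 2 + 1).
have X0 : 0 <= X by rewrite mulr_ge0 ?expR_ge0// addr_ge0// mulr_ge0// sqr_ge0.
exists (X + 1 + K) => [|h m hc hm]; first by rewrite !addr_ge0.
have m0 : 0 <= m by exact: le_trans (hm 0).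
have [y [yd yb]] := As h m hc hm.
have [u [ud uT]] := linear_ivp T (y T) Ac Aa hc hm.
exists u; split=> // t t0; have [tT|Tt] := leP t T.
- have H : dot (u t) (u t) <= X * m ^+ 2.
    have := @gronwall_vector _ _ (fun s => u (T - s))
      (fun s => - (A (T - s) *m u (T - s) + h (T - s))) (d%:R * a) m (T - t).
    rewrite subr0 uT subKr => /(_ _ _ _ _)/wrap[||s _|s _|H].
    + by rewrite mulr_ge0.
    + by rewrite subr_ge0.
    + have -> : (fun s => u (T - s)) = (fun s => u (-1 * s + T)).
        by apply/funext => x; rewrite mulN1r addrC.
      have := @vder_reparam _ _ u (-1) T s _ (ud (-1 * s + T)).
      by rewrite scaleN1r mulN1r [- s + T]addrC.
    + rewrite normrN (le_trans (ler_normD _ _))// lerD//.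
      by rewrite (le_trans (norm_mulmx_le _ _))// ler_wpM2r// ler_wpM2l.
    rewrite (le_trans H)// /X -mulrA ler_pM ?expR_ge0 ?addr_ge0 ?dot_ge0 ?sqr_ge0//.
      rewrite ler_expR ler_wpM2l ?lerBlDr ?lerDl//.
      by rewrite /growth !addr_ge0 ?mulr_ge0.
    rewrite mulrDl mul1r lerD2r (le_trans (dot_le_norm2 _))// -mulrA ler_wpM2l//.
    by rewrite -exprMn lerXn2r ?nnegrE ?mulr_ge0.
  by rewrite (le_trans (norm_le_of_dot X0 m0 H))// ler_wpM2r// lerDl.
- have -> : u t = y t; last first.
    by rewrite (le_trans (yb t))// ler_wpM2r// lerDr addr_ge0.
  have Mb s : `|A (Num.max (s + T) T)| <= a by [].
  pose z s := u (s + T) - y (s + T).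
  have zd s : 0 <= s -> vder z s (A (s + T) *m z s).
    move=> s0; have -> : A (s + T) *m z s = (A (s + T) *m u (s + T) + h (s + T)) -
        (A (Num.max (s + T) T) *m y (s + T) + h (s + T)).
      rewrite max_l ?lerDr// opprD addrACA subrr addr0 -mulmxBr.
      by [].
    by apply: vderB; apply: vder_shift.
  have tT0 : 0 <= t - T by rewrite subr_ge0 ltW.
  have := @gronwall_vector _ _ z (fun s => A (s + T) *m z s) (d%:R * a) 0 _ _ tT0.
  rewrite /z add0r uT subrr dot0l expr0n addr0 mulr0 subrK => /(_ _ _ _)/wrap[||s|H].
  + by rewrite mulr_ge0.
  + by move=> s /andP[s0 _]; exact: zd.
  + move=> _; rewrite addr0 (le_trans (norm_mulmx_le _ _))// ler_wpM2r// ler_wpM2l//.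
  apply/eqP; rewrite -subr_eq0; apply/eqP/dot_eq0/eqP.
  by rewrite eq_le dot_ge0 andbT.
Qed.

Lemma col_sum_delta (v : 'cV[R]_d) : v = \sum_k v k 0 *: delta_mx k 0.
Proof.
apply/matrixP => i j; rewrite ord1 summxE (bigD1 i)//= big1 ?addr0.
  by rewrite !mxE !eqxx mulr1.
by move=> k ki; rewrite !mxE eq_sym (negbTE ki) mulr0.
Qed.

(** The splitting hypothesis gives a bound depending on [v] in an uncontrolled way. Using it for the
    basis vectors only, and expanding the mismatch [dl] at time [0] in that basis, makes the
    correction linear in [dl] and the final bound linear in [m]. The two corrected solutions agree
    at [0], hence everywhere. *)
Lemma bsolvable_glue A (a Kp Km T : R) : 0 <= Kp -> 0 <= Km -> 0 <= T ->
  continuous A -> (forall t, `|A t| <= a) ->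
  bsolvable (fun t => A (Num.max t T)) Kp ->
  bsolvable (fun t => - A (- Num.max t T)) Km ->
  (forall v : 'cV[R]_d, exists z w, exists b,
    [/\ forall t, vder z t (A t *m z t), forall t, vder w t (A t *m w t),
        forall t, 0 <= t -> `|z t| <= b, forall t, t <= 0 -> `|w t| <= b
      & v = z 0 + w 0]) ->
  exists2 K, 0 < K & bsolvable A K.
Proof.
move=> Kp0 Km0 T0 Ac Aa Ap Am split_v.
have ANc : continuous (fun t => - A (- t)).
  move=> t; apply: cvgN; apply: (@continuous_comp _ _ _ -%R A).
    exact: opp_continuous.
  exact: Ac.
have [Cp Cp0 Hp] := half_line_bounded Kp0 T0 Ac Aa Ap.
have [|Cm Cm0 Hm] := @half_line_bounded (fun t => - A (- t)) a Km T Km0 T0 ANc _ Am.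
  by move=> t; rewrite normrN.
have /choice[z] := fun k => split_v (delta_mx k 0); move=> /choice[w] /choice[b] zwP.
have b0 k : 0 <= b k.
  by have [_ _ H _ _] := zwP k; exact: le_trans (normr_ge0 _) (H 0 (lexx 0)).
pose c := \sum_k b k; have c0 : 0 <= c by apply: sumr_ge0.
pose K := (Cp + Cm) * (c + 1) + 1.
have Cc : 0 <= (Cp + Cm) * (c + 1) by rewrite mulr_ge0// addr_ge0.
exists K => [|h m hc hm]; first by rewrite ltr_pwDr.
have m0 : 0 <= m by exact: le_trans (hm 0).
have [p [pd pb]] := Hp h m hc hm.
have hNc : continuous (fun t => - h (- t)).
  move=> t; apply: cvgN; apply: (@continuous_comp _ _ _ -%R h).
    exact: opp_continuous.
  exact: hc.
have [|q [qd qb]] := Hm _ m hNc; first by move=> t; rewrite normrN.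
pose u t := q (- t).
have ud t : vder u t (A t *m u t + h t).
  have := vder_opp (qd (- t)).
  by rewrite mulNmx opprK -opprD opprK.
pose dl := p 0 - u 0.
pose y t := p t - \sum_k dl k 0 *: z k t.
pose y2 t := u t + \sum_k dl k 0 *: w k t.
have sum_mul (f : 'I_d -> 'cV[R]_d) t :
    A t *m (\sum_k dl k 0 *: f k) = \sum_k dl k 0 *: (A t *m f k).
  by rewrite mulmx_sumr; apply: eq_bigr => k _; rewrite scalemxAr.
have yd t : vder y t (A t *m y t + h t).
  have -> : A t *m y t + h t =
      (A t *m p t + h t) - \sum_k dl k 0 *: (A t *m z k t).
    by rewrite mulmxBr sum_mul addrAC.
  apply: vderB; first exact: pd.
  by apply: vder_sum => k; apply: vderZ; have [] := zwP k.
have y2d t : vder y2 t (A t *m y2 t + h t).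
  have -> : A t *m y2 t + h t =
      (A t *m u t + h t) + \sum_k dl k 0 *: (A t *m w k t).
    by rewrite mulmxDr sum_mul addrAC.
  apply: vderD; first exact: ud.
  by apply: vder_sum => k; apply: vderZ; have [] := zwP k.
have yy2 t : y t = y2 t.
  apply/eqP; rewrite -subr_eq0; apply/eqP; move: t.
  apply: (@linear_unique _ _ A a (fun t => y t - y2 t)) => // [t|].
    apply: vder_eq; first exact: vderB (yd t) (y2d t).
    by rewrite opprD addrACA subrr addr0 -mulmxBr.
  rewrite /y /y2 opprD addrACA -opprD -big_split/= -/dl.
  rewrite [X in _ - X](_ : _ = dl) ?subrr// [RHS]col_sum_delta.
  by apply: eq_bigr => k _; have [_ _ _ _ ->] := zwP k; rewrite scalerDr.
have dlb : `|dl| <= (Cp + Cm) * m.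
  rewrite (le_trans (ler_normB _ _))// mulrDl lerD// ?pb// /u oppr0 qb//.
have sumb (f : 'I_d -> 'cV[R]_d) : (forall k, `|f k| <= b k) ->
    `|\sum_k dl k 0 *: f k| <= (Cp + Cm) * m * c.
  move=> fb; rewrite (le_trans (ler_norm_sum _ _ _))// /c mulr_sumr.
  apply: ler_sum => k _; rewrite normrZ ler_pM//.
  by rewrite (le_trans (coord_le_norm _ _ _)).
have fin x : x <= (Cp + Cm) * m -> x + (Cp + Cm) * m * c <= K * m.
  by move=> xb; rewrite /K; have : 0 <= m by []; lra.
exists y; split=> // t; have [t0|t0] := leP 0 t.
- rewrite (le_trans (ler_normB _ _))// (@le_trans _ _ (`|p t| + (Cp + Cm) * m * c))//.
    by rewrite lerD2l sumb// => k; have [_ _ + _ _] := zwP k; exact.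
  by apply: fin; rewrite (le_trans (pb t t0))// ler_wpM2r// lerDl.
- rewrite yy2 (le_trans (ler_normD _ _))// (@le_trans _ _ (`|u t| + (Cp + Cm) * m * c))//.
    by rewrite lerD2l sumb// => k; have [_ _ _ + _] := zwP k; apply; exact: ltW.
  apply: fin; rewrite (@le_trans _ _ (Cm * m))//; last by rewrite ler_wpM2r// lerDr.
  by apply: qb; rewrite oppr_ge0 ltW.
Qed.

End gluing.

(** * Decay of bounded solutions near a saddle *)

Section lyapunov.
Context {R : realType} {d : nat}.

(* With [n = (w, w)] and [V = (H w, w)], the derivative of [V] dominates [n];
   hence [V <= 0] along a bounded solution, and [n - (2 a / p) V] is a Lyapunov
   function comparable to [n]. *)
Lemma saddle_bounded_decay (H : 'M[R]_d) : saddle H ->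
  exists kap C b : R, [/\ 0 < kap, 0 < C, 0 < b &
  forall (w r : R -> 'cV[R]_d) B, (forall t : R, 0 <= t -> vder w t (H *m w t + r t)) ->
  (forall t : R, 0 <= t -> dot (r t) (r t) <= kap * dot (w t) (w t)) ->
  (forall t : R, 0 <= t -> `|w t| <= B) ->
  forall t : R, 0 <= t -> dot (w t) (w t) <= C * expR (- b * t) * dot (w 0) (w 0)].
Proof.
move=> Hs; have [Hsym _] := Hs; have [c c0 Hc] := saddle_coercive Hs.
pose q := d%:R * (d%:R * `|H|) ^+ 2.
have q0 : 0 <= q by rewrite mulr_ge0// sqr_ge0.
have Hq u : dot (H *m u) (H *m u) <= q * dot u u.
  rewrite (le_trans (dot_le_norm2 _))// /q -mulrA ler_wpM2l//.
  rewrite (@le_trans _ _ ((d%:R * `|H|) ^+ 2 * `|u| ^+ 2))//.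
    by rewrite -exprMn lerXn2r ?nnegrE ?mulr_ge0 ?norm_mulmx_le.
  by rewrite ler_wpM2l ?sqr_ge0// norm2_le_dot.
(* The constants are those of [V' >= p n], [n' <= a n] and [|V| <= l n]. With [W = n - (2 a / p) V]
   this gives [n <= W <= s n] and [W' <= - a n <= - (a / s) W]. *)
pose p := c / 2; have p0 : 0 < p by rewrite divr_gt0.
pose a := 1 + 2 * q + c; have a0 : 0 < a by rewrite /a addr_gt0// ltr_pwDl// mulr_ge0.
pose l := 1 + q; have l0 : 0 < l by rewrite ltr_pwDl.
pose s := 1 + 2 * a / p * l.
have ap0 : 0 < 2 * a / p by rewrite divr_gt0// mulr_gt0.
have s0 : 0 < s by rewrite ltr_pwDl// mulr_ge0// ltW.
exists p, s, (a / s); split=> //; first by rewrite divr_gt0.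
move=> w r B wd rb wB.
pose n t := dot (w t) (w t).
pose V t := dot (H *m w t) (w t).
have n0 t : 0 <= n t by exact: dot_ge0.
pose g t := H *m w t + r t.
have nd (t : R) : 0 <= t -> is_derive t 1 n (2 * dot (w t) (g t)).
  move=> t0; apply: is_derive_eq (is_derive_dot (wd t t0) (wd t t0)) _.
  by rewrite dotC; ring.
have Vd (t : R) : 0 <= t -> is_derive t 1 V (2 * dot (H *m w t) (g t)).
  move=> t0; apply: is_derive_eq (is_derive_dot (vder_mulmx H (wd t t0)) (wd t t0)) _.
  by rewrite dot_trmx Hsym dotC; ring.
have V'n (t : R) : 0 <= t -> p * n t <= 2 * dot (H *m w t) (g t).
  move=> t0; rewrite /g dotDr.
  have h1 := dot2_le (- (H *m w t)) (r t); rewrite !dotNl dotNr in h1.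
  have := Hc (w t); have := rb t t0; rewrite -/(n t) /p; lra.
have n'n (t : R) : 0 <= t -> 2 * dot (w t) (g t) <= a * n t.
  move=> t0; have h1 := dot2_le (w t) (g t).
  have h2 := dot2_le (H *m w t) (r t); have h3 := Hq (w t); have h4 := rb t t0.
  move: h1; rewrite {2 3}/g !dotDl !dotDr (dotC (r t) (H *m w t)) -/(n t) /a.
  by move: h3 h4; rewrite -/(n t) /p; lra.
have Vl t : `|V t| <= l * n t.
  have h1 := dot2_le (H *m w t) (w t); have h2 := Hq (w t).
  have h3 := dot2_le (- (H *m w t)) (w t); rewrite !dotNl dotNr in h3.
  have h4 : 0 <= q * n t by rewrite mulr_ge0.
  rewrite ler_norml /V /l; move: h1 h2 h3; rewrite -/(n t) => h1 h2 h3.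
  by have h5 := n0 t; apply/andP; split; lra.
(* A positive value of [V] would persist and force [V] to grow at least at the linear rate [be],
   against the bound [D] coming from [B]. *)
have V_le0 (t : R) : 0 <= t -> V t <= 0.
  move=> t0; rewrite leNgt; apply/negP => Vt.
  have Vmono (x : R) : t <= x -> V t <= V x.
    move=> tx; apply: (ge_of_derive_ge0 tx (df := fun x => 2 * dot (H *m w x) (g x))).
      by move=> y /andP[ty _]; apply: Vd; exact: le_trans ty.
    move=> y /andP[ty _]; rewrite (le_trans _ (V'n y (le_trans t0 ty)))//.
    by rewrite mulr_ge0// ltW.
  pose be := p * (V t / l).
  have be0 : 0 < be by rewrite mulr_gt0// divr_gt0.
  have Vgrow (x : R) : t <= x -> V t - be * t <= V x - be * x.
    move=> tx.
    apply: (ge_of_derive_ge0 tx (f := fun x => V x - be * x)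
      (df := fun x => 2 * dot (H *m w x) (g x) - be * 1)).
      move=> y /andP[ty _]; apply: is_deriveB.
      by apply: Vd; exact: le_trans ty.
    move=> y /andP[ty _]; rewrite mulr1 subr_ge0.
    rewrite (le_trans _ (V'n y (le_trans t0 ty)))// /be ler_pM2l// ler_pdivrMr//.
    by rewrite mulrC (le_trans (Vmono _ ty))// (le_trans (ler_norm _)).
  have B0 : 0 <= B by exact: le_trans (wB 0 (lexx 0)).
  pose D := l * (d%:R * B ^+ 2).
  have VD (x : R) : 0 <= x -> V x <= D.
    move=> x0; rewrite (le_trans (ler_norm _))// (le_trans (Vl x))// ler_pM2l//.
    rewrite (le_trans (dot_le_norm2 _))// ler_wpM2l// lerXn2r ?nnegrE//.
    exact: wB.
  have D0 : 0 <= D by rewrite mulr_ge0 ?(ltW l0)// mulr_ge0// sqr_ge0.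
  have tx : t <= t + D / be by rewrite lerDl divr_ge0// ltW.
  have := Vgrow _ tx; have := VD _ (le_trans t0 tx).
  have -> : be * (t + D / be) = be * t + D by field; rewrite gt_eqF.
  lra.
move=> t t0.
have Wd (x : R) : 0 <= x <= t -> is_derive x 1 (fun x => n x - 2 * a / p * V x)
    (2 * dot (w x) (g x) - 2 * a / p * (2 * dot (H *m w x) (g x))).
  move=> /andP[x0 _]; apply: is_deriveB; first exact: nd.
  by apply: is_deriveZ_R; exact: Vd.
have nW (x : R) : 0 <= x -> n x <= n x - 2 * a / p * V x.
  by move=> x0; rewrite lerBrDr gerDl mulr_ge0_le0 ?V_le0// ltW.
have Ws x : n x - 2 * a / p * V x <= s * n x.
  have -> : s * n x = n x + 2 * a / p * (l * n x) by rewrite /s; ring.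
  rewrite lerD2l -mulrN ler_pM2l//.
  by rewrite (le_trans (ler_norm _))// normrN.
have := gronwall_homogeneous (k := - (a / s)) t0 Wd.
move=> /(_ _)/wrap[x /andP[x0 _]|H1].
  rewrite mulNr lerNr.
  have e1 : 2 * a / p * (p * n x) <= 2 * a / p * (2 * dot (H *m w x) (g x)).
    by rewrite ler_pM2l// V'n.
  have e2 : a / s * (n x - 2 * a / p * V x) <= a / s * (s * n x).
    by rewrite ler_pM2l ?divr_gt0.
  have e3 : 2 * a / p * (p * n x) = 2 * (a * n x) by field; rewrite gt_eqF.
  have e4 : a / s * (s * n x) = a * n x by field; rewrite gt_eqF.
  have := n'n x x0; rewrite e3 in e1; rewrite e4 in e2; lra.
rewrite -/(n t) (le_trans (nW t t0))// (le_trans H1)//.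
rewrite -[leRHS]mulrA mulrCA ler_pM2l ?expR_gt0//; exact: Ws.
Qed.

End lyapunov.

(** * Gradient fields of class C^3 *)

Section multivariable.
Context {R : realType} {d : nat}.
Implicit Types (x y z v : 'cV[R]_d) (g F : 'cV[R]_d -> R).

Local Notation e_ i := (delta_mx i 0 : 'cV[R]_d).

(** Transposition carries Heine-Borel over from row vectors. *)
Lemma closed_ball_compact z (r : R) : compact [set x : 'cV[R]_d | `|x - z| <= r].
Proof.
have trc (n p : nat) : continuous (@trmx R n p).
  move=> M; apply/continuous_mxP => i j.
  have -> : (fun M : 'M[R]_(n, p) => (M^T) i j) = (fun M => M j i).
    by apply/funext => N; rewrite mxE.
  exact: coord_continuous.
have nT (n p : nat) (M : 'M[R]_(n, p)) : `|M^T| <= `|M|.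
  by apply: norm_le_coord => // i j; rewrite mxE coord_le_norm.
have -> : [set x : 'cV[R]_d | `|x - z| <= r] =
    trmx @` [set u : 'rV[R]_d | `|u - z^T| <= r].
  apply/seteqP; split=> [x /= xr|_ [u /= ur <-]].
    by exists x^T; rewrite ?trmxK//= -linearB (le_trans (nT _ _ _)).
  by rewrite -[z]trmxK -linearB (le_trans (nT _ _ _)).
apply: continuous_compact; first exact/continuous_subspaceT/trc.
apply: bounded_closed_compact.
  exists (r + `|z^T|); split; first exact: num_real.
  move=> M rM u /= ur; rewrite (le_trans _ (ltW rM))// -[u](subrK z^T).
  by rewrite (le_trans (ler_normD _ _))// lerD2r.
have -> : [set u : 'rV[R]_d | `|u - z^T| <= r] = closed_ball_ (@Num.norm _ _) z^T r.
  by apply/seteqP; split=> u /=; rewrite /closed_ball_/= distrC.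
exact: closed_closed_ball_.
Qed.

Lemma continuous_bounded_ball g (r : R) : continuous g ->
  exists2 b, 0 <= b & forall x, `|x| <= r -> `|g x| <= b.
Proof.
move=> gc; have [r0|r0] := leP 0 r; last first.
  by exists 0 => // x xr; have := lt_le_trans r0 (normr_ge0 x); rewrite ltNge xr.
have [|||c _ cmax] := @compact_EVT_max 'cV[R]_d R (fun x : 'cV[R]_d => `|g x|)
    [set x : 'cV[R]_d | `|x - 0| <= r].
- by exists 0; rewrite /= subrr normr0.
- exact: closed_ball_compact.
- exact: continuous_subspaceT (continuous_norm gc).
exists `|g c| => // x xr; apply: cmax; by rewrite inE/= subr0.
Qed.

Lemma is_derive_line g i x (a s : R) :
  (forall x, derivable g x (e_ i)) ->
  is_derive s 1 (fun s => g (x + (a * s) *: e_ i)) (a * partial i g (x + (a * s) *: e_ i)).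
Proof.
move=> gd.
have base (u : R) : is_derive u 1 (fun s => g (x + s *: e_ i)) (partial i g (x + u *: e_ i)).
  have E : (fun h : R => h^-1 *: (g (x + (h *: 1 + u) *: e_ i) - g (x + u *: e_ i))) =
      (fun h : R => h^-1 *: (g (h *: e_ i + (x + u *: e_ i)) - g (x + u *: e_ i))).
    apply/funext => h; congr (_ *: (g _ - _)).
    by rewrite [h *: 1]mulr1 scalerDl addrCA.
  by apply: DeriveDef; rewrite /derivable /partial /derive E//; exact: gd.
have := @is_derive_reparam _ (fun s => g (x + s *: e_ i)) a 0 s _ (base _).
by rewrite addr0; under eq_fun do rewrite addr0.
Qed.

(* The points [xi i] lie in the box spanned by [x] and [y], hence in every
   sup-norm ball containing both. *)
Lemma mean_value_coord g x y : (forall i x, derivable g x (e_ i)) ->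
  exists xi : 'I_d -> 'cV[R]_d,
  (forall i z c, `|x - z| <= c -> `|y - z| <= c -> `|xi i - z| <= c) /\
  g y - g x = \sum_i partial i g (xi i) * (y i 0 - x i 0).
Proof.
move=> gd.
(* A path from [x] to [y] changing one coordinate at a time; the increments of [g] telescope, and
   each one is a one-dimensional mean value. *)
pose mix k : 'cV[R]_d := \col_j if (j < k)%N then y j 0 else x j 0.
have /choice[xi xiP] : forall i : 'I_d, exists p : 'cV[R]_d,
    (forall z c, `|x - z| <= c -> `|y - z| <= c -> `|p - z| <= c) /\
    g (mix i.+1) - g (mix i) = partial i g p * (y i 0 - x i 0).
  move=> i; pose a := y i 0 - x i 0.
  have ld (s : R) := @is_derive_line g i (mix i) a s (gd i).
  have [|s sin E] := @MVT_segment _ (fun s => g (mix i + (a * s) *: e_ i)) 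
    (fun s => a * partial i g (mix i + (a * s) *: e_ i)) 0 1 ler01.
  - by apply: is_derive_within => s _; exact: ld.
  exists (mix i + (a * s) *: e_ i); split.
    move=> z c xz yz; have c0 : 0 <= c by exact: le_trans xz.
    apply: norm_le_col => // j; rewrite !mxE.
    have xj : `|x j 0 - z j 0| <= c.
      by rewrite (le_trans _ xz)//; have := coord_le_norm (x - z) j 0; rewrite !mxE.
    have yj : `|y j 0 - z j 0| <= c.
      by rewrite (le_trans _ yz)//; have := coord_le_norm (y - z) j 0; rewrite !mxE.
    have [ji|ji] := eqVneq j i; last by rewrite mulr0 addr0; case: ifP.
    rewrite ji in xj yj *; rewrite ltnn mulr1 /a; move: sin; rewrite in_itv/= => /andP[s0 s1].
    have -> : x i 0 + (y i 0 - x i 0) * s - z i 0 =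
      (1 - s) * (x i 0 - z i 0) + s * (y i 0 - z i 0) by ring.
    rewrite (le_trans (ler_normD _ _))// !normrM (ger0_norm s0) ger0_norm ?subr_ge0//.
    have := ler_wpM2l s0 yj; have s1' : 0 <= 1 - s by rewrite subr_ge0.
    by have := ler_wpM2l s1' xj; lra.
  have mixS : mix i + (a * 1) *: e_ i = mix i.+1.
    apply/matrixP => j k; rewrite !mxE ord1 eqxx andbT mulr1 ltnS.
    have [->|ji] := eqVneq j i; first by rewrite ltnn leqnn mulr1 /a addrC subrK.
    by rewrite mulr0 addr0 [in RHS]leq_eqVlt (inj_eq val_inj) (negbTE ji).
  rewrite -[in RHS]/a mulrC -mixS; move: E => /=; rewrite mulr0 scale0r addr0 subr0.
  by rewrite [X in _ = X -> _]mulr1.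
exists xi; split=> [i z c xz yz|]; first by have [H _] := xiP i; exact: H.
have -> : g y - g x = g (mix d) - g (mix 0%N).
  by congr (g _ - g _); apply/matrixP => i j; rewrite !mxE ord1 ?ltn_ord ?ltn0.
have tele (n : nat) : g (mix n) - g (mix 0%N) = \sum_(i < n) (g (mix i.+1) - g (mix i)).
  elim: n => [|n IH]; first by rewrite big_ord0 subrr.
  by rewrite big_ord_recr/= -IH addrC subrKA.
by rewrite tele; apply: eq_bigr => i _; have [_ ->] := xiP i.
Qed.

(** Two mean values: first in direction [i] for the increment of [g] in direction [j], then in
    direction [j] for [partial i g]. *)
Lemma mixed_difference g i j x (h : R) : 0 < h ->
  (forall i x, derivable g x (e_ i)) ->
  (forall i j x, derivable (partial i g) x (e_ j)) ->
  exists2 p, `|p - x| <= h + h &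
  g (x + h *: e_ i + h *: e_ j) - g (x + h *: e_ i) - g (x + h *: e_ j) + g x =
  h * h * partial j (partial i g) p.
Proof.
move=> h0 gd g2d.
pose u s := g (x + h *: e_ j + (1 * s) *: e_ i) - g (x + (1 * s) *: e_ i).
have ud (s : R) : is_derive s 1 u (1 * partial i g (x + h *: e_ j + (1 * s) *: e_ i) -
    1 * partial i g (x + (1 * s) *: e_ i)).
  by apply: is_deriveB; apply: is_derive_line; exact: gd.
have [|s sin E] := @MVT_segment _ u _ 0 h (ltW h0) (fun s _ => ud s).
  by apply: is_derive_within => s _; exact: ud.
have ld (t : R) := @is_derive_line (partial i g) j (x + s *: e_ i) 1 t (g2d i j).
have [|t tin E2] := @MVT_segment _ _ _ 0 h (ltW h0) (fun t _ => ld t).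
  by apply: is_derive_within => t _; exact: ld.
exists (x + s *: e_ i + (1 * t) *: e_ j).
  rewrite [X in `|X|]addrC !addrA addNr add0r.
  rewrite (le_trans (ler_normD _ _))// mul1r !normrZ.
  move: sin tin; rewrite !in_itv/= => /andP[s0 sh] /andP[t0 th].
  have dl1 k : `|e_ k| <= 1.
    by apply: norm_le_coord => // p q; rewrite mxE; case: (_ && _); rewrite ?normr1 ?normr0.
  by apply: lerD; rewrite ger0_norm// -[h]mulr1 ler_pM.
move: E2 => /=; rewrite !mul1r scale0r addr0 subr0 => E2.
move: E; rewrite /u !mul1r !scale0r !addr0 subr0.
rewrite [x + h *: _ + s *: _]addrAC E2 [x + h *: e_ j + h *: _]addrAC => E1.
set gg := g _ in E1 *.
transitivity (gg - g (x + h *: e_ i) - (g (x + h *: e_ j) - g x)); first by ring.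
by rewrite E1; ring.
Qed.

(** The second mixed difference is symmetric in [i] and [j], so each mixed partial takes, somewhere
    near [x], the same value as the other one does; continuity concludes. *)
Lemma schwarz g i j x : (forall i x, derivable g x (e_ i)) ->
  (forall i j x, derivable (partial i g) x (e_ j)) ->
  (forall i j, continuous (partial j (partial i g))) ->
  partial j (partial i g) x = partial i (partial j g) x.
Proof.
move=> gd g2d gc.
apply/eqP; rewrite -subr_eq0 -normr_eq0 eq_le normr_ge0 andbT.
apply/ler_addgt0Pl => e e0; rewrite addr0.
have e2 : 0 < e / 2 by rewrite divr_gt0.
have : \forall p \near x, `|partial j (partial i g) x - partial j (partial i g) p| <= e / 2 /\
   `|partial i (partial j g) x - partial i (partial j g) p| <= e / 2.
  by apply: filterI; [have /continuous_epsP := gc i j x|have /continuous_epsP := gc j i x]; exact.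
move=> /nbhs_ballP[r /= r0 B]; pose h := r / 4; have h0 : 0 < h by rewrite divr_gt0.
have hr : h + h < r by rewrite /h; lra.
have Bp p : `|p - x| <= h + h -> ball x r p.
  by move=> px; rewrite -ball_normE/= distrC (le_lt_trans px).
have [p /Bp/B[pe _] E1] := mixed_difference i j x h0 gd g2d.
have [q /Bp/B[_ qe] E2] := mixed_difference j i x h0 gd g2d.
have pq : partial j (partial i g) p = partial i (partial j g) q.
  apply: (@mulfI _ (h * h)); first by rewrite mulf_neq0// gt_eqF.
  apply: etrans (esym E1) _; apply: etrans _ E2.
  rewrite (addrAC x (h *: e_ j) (h *: e_ i)).
  by congr (_ + _); exact: addrAC.
have -> : partial j (partial i g) x - partial i (partial j g) x =
  (partial j (partial i g) x - partial j (partial i g) p) -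
  (partial i (partial j g) x - partial i (partial j g) q).
  by rewrite pq opprB addrA subrK.
apply: (le_trans (ler_normB _ _)); apply: (le_trans (lerD pe qe)).
by apply: le_of_eq; exact/esym/splitr.
Qed.

End multivariable.

Section gradient_fields.
Context {R : realType} {d : nat}.
Implicit Types (x y z v : 'cV[R]_d) (F g : 'cV[R]_d -> R).

Local Notation e_ i := (delta_mx i 0 : 'cV[R]_d).

(* Stable under [Phi -> - Phi], i.e. under time reversal. *)
Definition gradient_data (r L : R) (Phi : 'cV[R]_d -> R)
    (phi : 'cV[R]_d -> 'cV[R]_d) (J : 'cV[R]_d -> 'M[R]_d) : Prop :=
  [/\ 0 < L,
    forall (x : R -> 'cV[R]_d) (t : R) v, vder x t v ->
      is_derive t 1 (fun s => Phi (x s)) (dot (phi (x t)) v),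
    forall x y, `|x| <= r -> `|y| <= r ->
      `|phi x - phi y| <= L * `|x - y| /\ `|J x - J y| <= L * `|x - y|,
    forall x, `|x| <= r -> `|J x| <= L
  & forall x y z c, `|x| <= r -> `|y| <= r -> `|z| <= r ->
      `|x - z| <= c -> `|y - z| <= c ->
      `|phi y - phi x - J z *m (y - x)| <= L * c * `|y - x|].

Lemma gradient_dataN r L Phi phi J : gradient_data r L Phi phi J ->
  gradient_data r L (fun x => - Phi x) (fun x => - phi x) (fun x => - J x).
Proof.
move=> [L0 H1 H2 H3 H4]; split=> //.
- move=> x t v xv; rewrite dotNl; apply: is_deriveN; exact: H1.
- move=> x y xr yr; have [h1 h2] := H2 x y xr yr.
  by split; rewrite -opprD normrN.
- by move=> x xr; rewrite normrN H3.
- move=> x y z c xr yr zr xz yz; have := H4 x y z c xr yr zr xz yz.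
  by rewrite mulNmx -opprD -opprD normrN.
Qed.

Lemma lipschitz_of_partial g (r b : R) : 0 <= b ->
  (forall i x, derivable g x (e_ i)) ->
  (forall i x, `|x| <= r -> `|partial i g x| <= b) ->
  forall x y, `|x| <= r -> `|y| <= r -> `|g y - g x| <= d%:R * b * `|y - x|.
Proof.
move=> b0 gd gb x y xr yr; have [xi [xiP ->]] := mean_value_coord x y gd.
rewrite (le_trans (ler_norm_sum _ _ _))//.
rewrite (@le_trans _ _ (\sum_(i < d) b * `|y - x|))//; last first.
  by rewrite sumr_const card_ord -mulrA mulr_natl.
apply: ler_sum => i _; rewrite normrM ler_pM//.
  by apply: gb; rewrite -[xi i]subr0; apply: xiP; rewrite subr0.
by have := coord_le_norm (y - x) i 0; rewrite !mxE.
Qed.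

Lemma is_derive_O2 (f : R -> R) (t C dl : R) : 0 < dl -> 0 <= C ->
  (forall h, `|h| < dl -> `|f (h + t) - f t| <= C * `|h| ^+ 2) ->
  is_derive t 1 f 0.
Proof.
move=> dl0 C0 H; apply/is_derive_eps => e e0.
have C1 : 0 < C + 1 by rewrite ltr_pwDr.
exists (Num.min dl (e / (C + 1))) => [|h]; first by rewrite lt_min dl0 divr_gt0.
rewrite lt_min => /andP[hdl]; rewrite ltr_pdivlMr// => he.
rewrite mulr0 subr0 (le_trans (H h hdl))// expr2 mulrA ler_wpM2r//.
by rewrite mulrC (le_trans _ (ltW he))// ler_wpM2l// lerDl.
Qed.

Lemma vder_O1 (x : R -> 'cV[R]_d) (t : R) v : vder x t v ->
  exists2 dl, 0 < dl & forall h, `|h| < dl -> `|x (h + t) - x t| <= (`|v| + 1) * `|h|.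
Proof.
move=> xv.
have : \forall h \near (0 : R), forall i, `|x (h + t) i 0 - x t i 0| <= (`|v| + 1) * `|h|.
  apply: (@filter_forall _ _ _ (nbhs (0 : R))) => i.
  have [dl dl0 H] := (is_derive_eps _ _ _).1 (xv i) 1 ltr01.
  apply/nbhs_ballP; exists dl => // h; rewrite -ball_normE/= sub0r normrN => hdl.
  have := H h hdl; set p := x (h + t) i 0; set q := x t i 0; rewrite mul1r => H1.
  have -> : p - q = (p - q - h * v i 0) + h * v i 0 by ring.
  rewrite (le_trans (ler_normD _ _))// mulrDl mul1r addrC lerD// normrM mulrC.
  by rewrite ler_wpM2r// coord_le_norm.
move=> /nbhs_ballP[dl /= dl0 H]; exists dl => // h hdl.
have {}H := H h; rewrite -ball_normE/= sub0r normrN in H.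
apply: norm_le_col => [|i]; first by rewrite mulr_ge0// addr_ge0.
by rewrite !mxE; exact: H.
Qed.

Section C3.
Variable F : 'cV[R]_d -> R.
Hypothesis hF : Ck 3 F.

Lemma C3_derivable i x : derivable F x (e_ i).
Proof. by have [_ H] := hF; have [] := H i. Qed.

Lemma C3_derivable2 i j x : derivable (partial i F) x (e_ j).
Proof. by have [_ H] := hF; have [_ [_ H2]] := H i; have [] := H2 j. Qed.

Lemma C3_derivable3 i j k x : derivable (partial j (partial i F)) x (e_ k).
Proof.
by have [_ H] := hF; have [_ [_ H2]] := H i; have [_ [_ H3]] := H2 j; have [] := H3 k.
Qed.

Lemma C3_continuous1 i : continuous (partial i F).
Proof. by have [_ H] := hF; have [_ []] := H i. Qed.

Lemma C3_continuous2 i j : continuous (partial j (partial i F)).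
Proof. by have [_ H] := hF; have [_ [_ H2]] := H i; have [_ []] := H2 j. Qed.

Lemma C3_continuous3 i j k : continuous (partial k (partial j (partial i F))).
Proof.
by have [_ H] := hF; have [_ [_ H2]] := H i; have [_ [_ H3]] := H2 j; have [_ []] := H3 k.
Qed.

Lemma grad_continuous : continuous (grad F).
Proof.
move=> x; apply/continuous_mxP => i j.
have -> : (fun s => grad F s i j) = partial i F by apply/funext => s; rewrite mxE.
exact: C3_continuous1.
Qed.

Lemma jacE x i j : jac (grad F) x i j = partial j (partial i F) x.
Proof.
rewrite mxE /partial derive_mx; last first.
  apply/derivable_mxP => k l; under eq_fun do rewrite mxE; exact: C3_derivable2.
by rewrite mxE; under [in LHS]eq_fun do rewrite mxE.
Qed.

Lemma jac_continuous : continuous (jac (grad F)).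
Proof.
move=> x; apply/continuous_mxP => i j.
have -> : (fun s => jac (grad F) s i j) = partial j (partial i F).
  by apply/funext => s; exact: jacE.
exact: C3_continuous2.
Qed.

Lemma jac_sym x : (jac (grad F) x)^T = jac (grad F) x.
Proof.
apply/matrixP => i j; rewrite mxE !jacE; apply: schwarz.
- exact: C3_derivable.
- exact: C3_derivable2.
- exact: C3_continuous2.
Qed.

Lemma C3_partial_bounds (r : R) : exists2 b, 0 <= b &
  (forall i j x, `|x| <= r -> `|partial j (partial i F) x| <= b) /\
  (forall i j k x, `|x| <= r -> `|partial k (partial j (partial i F)) x| <= b).
Proof.
have /choice[b2 b2P] : forall ij : 'I_d * 'I_d, exists b, 0 <= b /\
    forall x, `|x| <= r -> `|partial ij.2 (partial ij.1 F) x| <= b.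
  move=> [i j]; have [b b0 H] := continuous_bounded_ball r (@C3_continuous2 i j).
  by exists b.
have /choice[b3 b3P] : forall ijk : 'I_d * 'I_d * 'I_d, exists b, 0 <= b /\
    forall x, `|x| <= r -> `|partial ijk.2 (partial ijk.1.2 (partial ijk.1.1 F)) x| <= b.
  move=> [[i j] k]; have [b b0 H] := continuous_bounded_ball r (@C3_continuous3 i j k).
  by exists b.
have s2 : 0 <= \sum_ij b2 ij by apply: sumr_ge0 => ij _; have [] := b2P ij.
have s3 : 0 <= \sum_ijk b3 ijk by apply: sumr_ge0 => ijk _; have [] := b3P ijk.
exists (\sum_ij b2 ij + \sum_ijk b3 ijk); first exact: addr_ge0.
split=> [i j x xr|i j k x xr].
- have [_ H] := b2P (i, j); rewrite (le_trans (H x xr))// (bigD1 (i, j))//=.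
  rewrite -addrA lerDl addr_ge0//.
  by apply: sumr_ge0 => ij _; have [] := b2P ij.
- have [_ H] := b3P (i, j, k); rewrite (le_trans (H x xr))// addrC (bigD1 (i, j, k))//=.
  rewrite -addrA lerDl addr_ge0//.
  by apply: sumr_ge0 => ijk _; have [] := b3P ijk.
Qed.

(** After subtracting the linear part of [F] at [x t], the increments are quadratic in the time
    step: first partials are Lipschitz on a ball, and [x] moves at most linearly by [vder_O1]. *)
Lemma grad_chain_rule (x : R -> 'cV[R]_d) (t : R) v : vder x t v ->
  is_derive t 1 (fun s => F (x s)) (dot (grad F (x t)) v).
Proof.
move=> xv; pose r := `|x t| + 1.
have [b b0 [b2 _]] := C3_partial_bounds r.
have [dl dl0 xO] := vder_O1 xv.
pose V := `|v| + 1; have V0 : 0 < V by rewrite ltr_pwDr.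
have key : is_derive t 1 (fun s => F (x s) - dot (grad F (x t)) (x s)) 0.
  apply: (@is_derive_O2 _ t (d%:R * (d%:R * b) * V ^+ 2) (Num.min dl V^-1)).
  - by rewrite lt_min dl0 invr_gt0.
  - by rewrite !mulr_ge0// ltW.
  move=> h; rewrite lt_min => /andP[hdl hV].
  have xh := xO h hdl.
  have x1 : `|x (h + t) - x t| <= 1.
    rewrite (le_trans xh)// -/V mulrC -ler_pdivlMr// mul1r ltW//.
  have xr : `|x t| <= r by rewrite lerDl.
  have xhr : `|x (h + t)| <= r.
    by rewrite -[x (h + t)](subrK (x t)) (le_trans (ler_normD _ _))// addrC lerD2l.
  set p := x (h + t) in xh x1 xhr *; set q := x t in xr xh x1 *.
  have [xi [xiP E]] := mean_value_coord q p (@C3_derivable).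
  have -> : F p - dot (grad F q) p - (F q - dot (grad F q) q) =
      (F p - F q) - dot (grad F q) (p - q) by rewrite dotDr dotNr; ring.
  have -> : F p - F q - dot (grad F q) (p - q) =
      \sum_i (partial i F (xi i) - partial i F q) * (p i 0 - q i 0).
    rewrite E -sumrB; apply: eq_bigr => i _; rewrite !mxE; ring.
  rewrite (@le_trans _ _ (d%:R * (d%:R * b) * `|p - q| ^+ 2))//; last first.
    rewrite -[leRHS]mulrA ler_wpM2l ?mulr_ge0// -exprMn lerXn2r ?nnegrE ?mulr_ge0//.
    exact: ltW.
  rewrite (le_trans (ler_norm_sum _ _ _))//.
  rewrite (@le_trans _ _ (\sum_(i < d) d%:R * b * `|p - q| ^+ 2))//; last first.
    by rewrite sumr_const card_ord -[leLHS]mulr_natl !mulrA.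
  apply: ler_sum => i _; rewrite normrM expr2 mulrA ler_pM//.
    have xiq : `|xi i - q| <= `|p - q| by apply: xiP; rewrite ?subrr ?normr0.
    rewrite (le_trans (lipschitz_of_partial (r := r) b0 (@C3_derivable2 i) (b2 i) xr _))//.
      by rewrite -[xi i]subr0; apply: xiP; rewrite subr0.
    by rewrite ler_wpM2l ?mulr_ge0.
  by have := coord_le_norm (p - q) i 0; rewrite !mxE.
have key2 : is_derive t 1 (fun s => dot (grad F (x t)) (x s)) (dot (grad F (x t)) v).
  have := is_derive_dot (vder_cst (grad F (x t)) t) xv.
  by rewrite dot0l add0r.
have := is_deriveD key key2; rewrite add0r; congr is_derive.
by apply/funext => s; rewrite !fctE subrK.
Qed.

(** Third derivatives, bounded on the ball, make the Jacobian Lipschitz; [L] adds up the bounds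
    asked for by the various clauses. *)
Lemma C3_gradient_data (r : R) : exists L, gradient_data r L F (grad F) (jac (grad F)).
Proof.
have [b b0 [b2 b3]] := C3_partial_bounds r.
have db0 : 0 <= d%:R * b by rewrite mulr_ge0.
have ddb0 : 0 <= d%:R * (d%:R * b) by rewrite mulr_ge0.
pose L := b + d%:R * b + d%:R * (d%:R * b) + 1.
have L0 : 0 < L by rewrite ltr_pwDr// !addr_ge0.
have bL : b <= L by rewrite /L; lra.
have dbL : d%:R * b <= L by rewrite /L; lra.
have ddbL : d%:R * (d%:R * b) <= L by rewrite /L; lra.
exists L; split=> //.
- exact: grad_chain_rule.
- move=> x y xr yr; split.
    apply: norm_le_col => [|i]; first by rewrite mulr_ge0// ltW.
    rewrite !mxE (le_trans (lipschitz_of_partial b0 (@C3_derivable2 i) (b2 i) yr xr))//.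
    by rewrite ler_wpM2r.
  apply: norm_le_coord => [|i j]; first by rewrite mulr_ge0// ltW.
  have -> : (jac (grad F) x - jac (grad F) y) i j =
      partial j (partial i F) x - partial j (partial i F) y.
    have subE (B C : 'M[R]_d) : (B - C) i j = B i j - C i j by rewrite !mxE.
    by apply: (etrans (subE _ _)); congr (_ - _); exact: jacE.
  rewrite (le_trans (lipschitz_of_partial b0 (@C3_derivable3 i j) (b3 i j) yr xr))//.
  by rewrite ler_wpM2r.
- move=> x xr; apply: norm_le_coord => [|i j]; first exact: ltW.
  by rewrite jacE (le_trans (b2 i j x xr)).
- move=> x y z c xr yr zr xz yz; have c0 : 0 <= c by exact: le_trans xz.
  apply: norm_le_col => [|i]; first by rewrite mulr_ge0// mulr_ge0// ltW.
  have [xi [xiP E]] := mean_value_coord x y (@C3_derivable2 i).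
  have -> : (grad F y - grad F x - jac (grad F) z *m (y - x)) i 0 =
      \sum_j (partial j (partial i F) (xi j) - partial j (partial i F) z) * (y j 0 - x j 0).
    have subE (B : 'M[R]_d) : (grad F y - grad F x - B *m (y - x)) i 0 =
      partial i F y - partial i F x - \sum_j B i j * (y - x) j 0 by rewrite !mxE.
    rewrite subE E -sumrB; apply: eq_bigr => j _; rewrite jacE !mxE mulrBl.
    by [].
  rewrite (le_trans (ler_norm_sum _ _ _))//.
  rewrite (@le_trans _ _ (\sum_(j < d) d%:R * b * c * `|y - x|))//; last first.
    rewrite sumr_const card_ord -[leLHS]mulr_natl !mulrA ler_wpM2r// ler_wpM2r//.
    by rewrite -mulrA.
  apply: ler_sum => j _; rewrite normrM ler_pM//; last first.
    by have := coord_le_norm (y - x) j 0; rewrite !mxE.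
  have xir : `|xi j| <= r by rewrite -[xi j]subr0; apply: xiP; rewrite subr0.
  apply: (le_trans (lipschitz_of_partial b0 (@C3_derivable3 i j) (b3 i j) zr xir)).
  by rewrite ler_wpM2l//; apply: xiP.
Qed.

End C3.
End gradient_fields.

(** * One-sided derivatives at the end of the half-line *)

Section halfline.
Context {R : realType} {d : nat}.
Implicit Types (x : R -> 'cV[R]_d) (y : R).

Lemma halfline_epsP (V : normedModType R) (g : R -> V) (t : R) (l : V) :
  is_derive_halfline g t l <->
  forall e : R, 0 < e -> exists2 dl : R, 0 < dl & forall y, 0 <= y -> `|y - t| < dl ->
    `|g y - g t - (y - t) *: l| <= e * `|y - t|.
Proof.
have E y : y != t -> g y - g t - (y - t) *: l =
    - ((y - t) *: (l - (y - t)^-1 *: (g y - g t))).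
  move=> yt; rewrite scalerBr scalerA mulfV ?subr_eq0// scale1r.
  by rewrite opprB.
split.
  move=> /cvgrPdist_le H e e0; have := H e e0.
  rewrite near_withinE near_withinE => /nbhs_ballP[dl /= dl0 B].
  exists dl => // y y0 ydl; have [->|yt] := eqVneq y t.
    by rewrite !subrr scale0r subr0 !normr0 mulr0.
  rewrite E// normrN normrZ mulrC ler_wpM2r//; apply: B => //=.
    by rewrite -ball_normE/= distrC.
  by rewrite /halfline/= in_itv/= y0.
move=> H; apply/cvgrPdist_le => e e0.
rewrite near_withinE near_withinE; apply/nbhs_ballP.
have [dl dl0 B] := H e e0; exists dl => // y /=.
rewrite -ball_normE/= distrC => ydl yt; rewrite /halfline/= in_itv/= andbT => y0.
have yt0 : 0 < `|y - t| by rewrite normr_gt0 subr_eq0.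
have := B y y0 ydl; rewrite E// normrN normrZ mulrC.
by rewrite ler_pM2r.
Qed.

Lemma vder_epsP x (t : R) v : vder x t v <->
  forall e : R, 0 < e -> exists2 dl : R, 0 < dl & forall y, `|y - t| < dl ->
    `|x y - x t - (y - t) *: v| <= e * `|y - t|.
Proof.
split=> [xv e e0|H i].
  have : \forall h \near (0 : R), forall i,
      `|x (h + t) i 0 - x t i 0 - h * v i 0| <= e * `|h|.
    apply: (@filter_forall _ _ _ (nbhs (0 : R))) => i.
    have [dl dl0 H] := (is_derive_eps _ _ _).1 (xv i) e e0.
    apply/nbhs_ballP; exists dl => // h; rewrite -ball_normE/= sub0r normrN.
    exact: H.
  move=> /nbhs_ballP[dl /= dl0 H]; exists dl => // y ydl.
  have {}H := H (y - t); rewrite -ball_normE/= sub0r normrN subrK in H.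
  apply: norm_le_col => [|i]; first by rewrite mulr_ge0// ltW.
  by rewrite !mxE; exact: H.
apply/is_derive_eps => e e0; have [dl dl0 B] := H e e0; exists dl => // h hdl.
have := B (h + t); rewrite addrK => /(_ hdl); apply: le_trans.
by have := coord_le_norm (x (h + t) - x t - h *: v) i 0; rewrite !mxE.
Qed.

(** Continuing by the tangent line at [0] makes the derivative there two-sided, so the calculus of
    [vder] applies on all of [[0, +oo[]. *)
Lemma halfline_extension x (dx : R -> 'cV[R]_d) :
  (forall t : R, 0 <= t -> is_derive_halfline x t (dx t)) ->
  exists X : R -> 'cV[R]_d, (forall t, 0 <= t -> X t = x t) /\
    forall t : R, 0 <= t -> vder X t (dx t).
Proof.
move=> xd; pose X t := if 0 <= t then x t else x 0 + t *: dx 0.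
have XE t : 0 <= t -> X t = x t by rewrite /X => ->.
exists X; split=> // t t0; apply/vder_epsP => e e0.
have [dl dl0 B] := (halfline_epsP _ _ _).1 (xd t t0) e e0.
have [tp|tn|tE] := ltgtP t 0; first by rewrite leNgt tp in t0.
- exists (Num.min dl t) => [|y]; first by rewrite lt_min dl0.
  rewrite lt_min => /andP[ydl yt].
  have y0 : 0 <= y by move: yt; rewrite ltr_norml => /andP[]; lra.
  by rewrite !XE//; exact: B.
- subst t; exists dl => // y ydl; have [y0|y0] := leP 0 y.
    by rewrite !XE//; exact: B.
  have yF : (0 <= y) = false by rewrite leNgt y0.
  rewrite (XE 0 (lexx 0)) /X yF subr0 [x 0 + _]addrC addrK subrr normr0.
  by rewrite mulr_ge0// ltW.
Qed.

Lemma vder_halfline x (t : R) v : vder x t v -> is_derive_halfline x t v.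
Proof.
move=> /vder_epsP H; apply/halfline_epsP => e e0.
by have [dl dl0 B] := H e e0; exists dl => // y _; exact: B.
Qed.

End halfline.

(** * Stable sets and their tangent vectors *)

Section real_induction.
Context {R : realType}.
Implicit Types q : R -> R.

(** Were [P] to fail somewhere, the supremum of the times before which it holds would be finite, and
    the step would push past it. *)
Lemma real_induction (P : R -> Prop) :
  (forall t : R, 0 <= t -> (forall s : R, 0 <= s < t -> P s) ->
    exists2 dl : R, 0 < dl & forall s, t <= s < t + dl -> P s) ->
  forall t : R, 0 <= t -> P t.
Proof.
move=> step t1 t10; apply: contrapT => Pt1.
pose S := [set t : R | 0 <= t /\ forall s, 0 <= s < t -> P s].
have St1 t : S t -> t <= t1.
  by move=> [t0 H]; rewrite leNgt; apply/negP => tt1; apply: Pt1; apply: H; rewrite t10.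
have S0 : S 0 by split=> // s /andP[s0 /(le_lt_trans s0)]; rewrite ltxx.
have Sub : has_ubound S by exists t1 => t; exact: St1.
pose T := sup S.
have T0 : 0 <= T by exact: ub_le_sup.
have TP s : 0 <= s < T -> P s.
  move=> /andP[s0 sT]; have [t [_ H] st] : exists2 t, S t & s < t.
    have hs : has_sup S by split=> //; exists 0.
    have sT0 : 0 < T - s by rewrite subr_gt0.
    have [t St] := sup_adherent sT0 hs.
    by rewrite -/T opprB addrC subrK; exists t.
  by apply: H; rewrite s0.
have [dl dl0 H] := step T T0 TP.
have : S (T + dl).
  split=> [|s /andP[s0 sT]]; first by rewrite addr_ge0// ltW.
  by have [sT'|Ts] := ltP s T; [apply: TP; rewrite s0|apply: H; rewrite Ts].
move=> /(ub_le_sup Sub); rewrite -/T leNgt => /negP; apply.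
by rewrite ltrDl.
Qed.

Lemma le_of_left_limit q (t c : R) : 0 < t -> {for t, continuous q} ->
  (forall s, 0 <= s < t -> q s <= c) -> q t <= c.
Proof.
move=> t0 /continuous_epsP qc qs; apply/ler_addgt0Pr => e e0.
have /nbhs_ballP[dl /= dl0 B] := qc e e0.
pose s := Num.max 0 (t - dl / 2).
have st : 0 <= s < t.
  by rewrite le_max lexx/= gt_max t0 gtrBl divr_gt0.
have := B s; rewrite -ball_normE/= => /(_ _)/wrap[|].
  have /andP[_ st'] := st; rewrite ger0_norm; last by rewrite subr_ge0 ltW.
  rewrite ltrBlDr -ltrBlDl lt_max; apply/orP; right.
  by rewrite ltrD2l ltrN2; lra.
by have := qs s st; rewrite ler_norml; lra.
Qed.

(** Bootstrap: the gap between [r1] and [r2] lets continuity supply the weak bound a little further,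
    and the last hypothesis improves it to the strong one. *)
Lemma first_exit q (r1 r2 : R) : r1 < r2 ->
  (forall t : R, 0 <= t -> {for t, continuous q}) -> q 0 <= r1 ->
  (forall t : R, 0 <= t -> (forall s, 0 <= s <= t -> q s <= r2) -> q t <= r1) ->
  forall t : R, 0 <= t -> q t <= r1.
Proof.
move=> r12 qc q0 H; apply: real_induction => t t0 IH.
have qt : q t <= r1.
  have [->//|tn0] := eqVneq t 0.
  by apply: le_of_left_limit (qc t t0) IH; rewrite lt_neqAle eq_sym tn0.
have e0 : 0 < r2 - r1 by rewrite subr_gt0.
have /continuous_epsP/(_ _ e0)/nbhs_ballP[dl /= dl0 B] := qc t t0.
exists dl => // s /andP[ts sdl]; apply: H => [|u /andP[u0 us]].
  exact: le_trans ts.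
have [ut|tu] := ltP u t; first by rewrite (le_trans (IH u _)) ?u0// ltW.
have := B u; rewrite -ball_normE/= => /(_ _)/wrap[|].
  by rewrite distrC ger0_norm ?subr_ge0// ltrBlDl (le_lt_trans us).
by rewrite ler_norml; lra.
Qed.

(** On reaching the level [B] the function is strictly decreasing, so it cannot cross. *)
Lemma barrier q (dq : R -> R) (B tau : R) :
  (forall t : R, 0 <= t <= tau -> is_derive t 1 q (dq t)) ->
  (forall t : R, 0 <= t <= tau -> q t = B -> dq t < 0) -> q 0 <= B ->
  forall t : R, 0 <= t <= tau -> q t <= B.
Proof.
move=> qd qB q0 t /andP[t0]; move: t t0; apply: real_induction => t t0 IH.
have [ttau|taut] := leP t tau; last first.
  by exists 1 => // s /andP[ts _] /(le_trans ts)/(lt_le_trans taut); rewrite ltxx.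
have ti : 0 <= t <= tau by rewrite t0.
have qc := is_derive_cts (qd t ti).
have qt : q t <= B.
  have [->//|tn0] := eqVneq t 0.
  apply: le_of_left_limit qc _; first by rewrite lt_neqAle eq_sym tn0.
  by move=> s /andP[s0 st]; apply: IH; rewrite ?s0// ltW// (lt_le_trans st).
have [qtB|qtB|qtB] := ltgtP (q t) B; last 1 first.
- have dq0 : 0 < - dq t by rewrite oppr_gt0 qB.
  have [dl dl0 H] := (is_derive_eps _ _ _).1 (qd t ti) _ dq0.
  exists dl => // s /andP[ts sdl] _.
  have := H (s - t); rewrite ger0_norm ?subr_ge0// ltrBlDl subrK => /(_ sdl).
  by rewrite ler_norml -qtB => /andP[_]; lra.
- have e0 : 0 < B - q t by rewrite subr_gt0.
  have /continuous_epsP/(_ _ e0)/nbhs_ballP[dl /= dl0 H] := qc.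
  exists dl => // s /andP[ts sdl] _.
  have := H s; rewrite -ball_normE/= distrC ger0_norm ?subr_ge0// ltrBlDl.
  by move=> /(_ sdl); rewrite ler_norml; lra.
- by move: qt; rewrite leNgt qtB.
Qed.

Lemma small_square (a b : R) : 0 <= a -> 0 < b ->
  exists2 dl : R, 0 < dl & forall s, `|s| < dl -> a * s ^+ 2 <= b.
Proof.
move=> a0 b0; have a1 : 0 < a + 1 by rewrite ltr_pwDr.
exists (Num.min 1 (b / (a + 1))) => [|s]; first by rewrite lt_min ltr01 divr_gt0.
rewrite lt_min => /andP[s1]; rewrite ltr_pdivlMr// => sb.
have s2 : s ^+ 2 <= `|s|.
  by rewrite -real_normK ?num_real// expr2 ler_piMl// ltW.
rewrite (le_trans (ler_wpM2l a0 s2))//.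
by have := normr_ge0 s; move: sb; rewrite mulrDr; lra.
Qed.

End real_induction.

(** * Orbits converging to an equilibrium of a gradient field *)

Section tangent.
Context {R : realType} {d : nat}.
Implicit Types (x z w : R -> 'cV[R]_d) (e v y : 'cV[R]_d).

Definition tends_to x e := forall eps : R, 0 < eps ->
  exists2 T : R, 0 <= T & forall t, T <= t -> `|x t - e| <= eps.

Lemma tends_to_cvg x e : x t @[t --> +oo] --> e <-> tends_to x e.
Proof.
split=> [/cvgrPdist_le H eps eps0|H].
  have [T [_ TH]] := H eps eps0; exists (`|T| + 1); first by rewrite addr_ge0.
  move=> t Tt; rewrite distrC; apply: TH; rewrite (lt_le_trans _ Tt)//.
  by rewrite (le_lt_trans (ler_norm T))// ltrDl.
apply/cvgrPdist_le => eps eps0; have [T T0 TH] := H eps eps0.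
by exists T; split=> [|t /ltW Tt]; [exact: num_real|rewrite distrC; exact: TH].
Qed.

Variables (r L : R) (Phi : 'cV[R]_d -> R) (phi : 'cV[R]_d -> 'cV[R]_d)
  (J : 'cV[R]_d -> 'M[R]_d) (e : 'cV[R]_d).
Hypothesis hdata : gradient_data r L Phi phi J.
Hypothesis er : `|e| <= r.
Hypothesis phie : phi e = 0.
Hypothesis Je : saddle (J e).

(** Confinement to the ball of radius [r] is included because the constants of [gradient_data] hold
    only there. *)
Definition orbit_to x := [/\ forall t : R, 0 <= t -> vder x t (phi (x t)),
  forall t : R, 0 <= t -> `|x t| <= r & tends_to x e].

Let L0 : 0 < L. Proof. by have [] := hdata. Qed.

Lemma linearization_error y : `|y| <= r -> `|phi y - J e *m (y - e)| <= L * `|y - e| ^+ 2.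
Proof.
move=> yr; have [_ _ _ _ H] := hdata.
have := H e y e `|y - e| er yr er; rewrite subrr normr0 phie subr0 expr2 mulrA.
exact.
Qed.

(** Along the segment from [e] to [y] the gradient [phi] is at most [L * |y - e|], because it
    vanishes at [e]. *)
Lemma potential_quadratic y : `|y| <= r -> `|Phi y - Phi e| <= d%:R * L * `|y - e| ^+ 2.
Proof.
move=> yr; have [_ Hd Hl _ _] := hdata.
pose p (s : R) := e + s *: (y - e).
have pd (s : R) : vder p s (y - e).
  have -> : y - e = 0 + 1 *: (y - e) by rewrite add0r scale1r.
  apply: vderD; first exact: vder_cst.
  move=> i; rewrite mxE.
  have -> : (fun s => (s *: (y - e)) i 0) = (fun s => (y - e) i 0 * s).
    by apply/funext => u; rewrite mxE mulrC.
  rewrite mul1r -[X in is_derive _ _ _ X]mulr1.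
  exact: (is_deriveZ_R (f := id)).
have pr (s : R) : 0 <= s <= 1 -> `|p s| <= r.
  move=> /andP[s0 s1]; have -> : p s = (1 - s) *: e + s *: y.
    by rewrite /p scalerBr scalerBl scale1r addrA addrAC.
  rewrite (le_trans (ler_normD _ _))// !normrZ (ger0_norm s0) ger0_norm ?subr_ge0//.
  have s1' : 0 <= 1 - s by rewrite subr_ge0.
  by have := ler_wpM2l s0 yr; have := ler_wpM2l s1' er; lra.
have := lipschitz_of_derive (c := d%:R * L * `|y - e| ^+ 2) ler01
  (fun s _ => Hd p s _ (pd s)).
have p1 : p 1 = y by rewrite /p scale1r addrC subrK.
have p0 : p 0 = e by rewrite /p scale0r addr0.
rewrite p1 p0 subr0 mulr1; apply.
move=> s s01; rewrite (le_trans (dot_le _ _))// -[leRHS]mulrA ler_wpM2l// expr2 mulrA.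
rewrite ler_wpM2r//; have [+ _] := Hl (p s) e (pr s s01) er.
rewrite phie subr0 => /le_trans; apply; rewrite ler_wpM2l ?(ltW L0)//.
rewrite /p addrC addKr normrZ; case/andP: s01 => s0 s1.
by rewrite ger0_norm// ler_piMl.
Qed.

(** The potential increases along the gradient flow, and its limit is [Phi e]. *)
Lemma potential_le x : orbit_to x -> forall t : R, 0 <= t -> Phi (x t) <= Phi e.
Proof.
move=> [xd xr xe] t t0; have [_ Hd _ _ _] := hdata.
have dL0 : 0 <= d%:R * L by rewrite mulr_ge0// ltW.
apply/ler_addgt0Pr => eps eps0.
have [dl dl0 sm] := small_square dL0 eps0.
have [|T T0 TH] := xe (dl / 2); first by rewrite divr_gt0.
pose s := Num.max t T.
have ts : t <= s by rewrite le_max lexx.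
have : Phi (x t) <= Phi (x s).
  apply: (ge_of_derive_ge0 ts (f := fun u => Phi (x u))
    (df := fun u => dot (phi (x u)) (phi (x u)))).
    by move=> u /andP[tu _]; apply: Hd; apply: xd; exact: le_trans tu.
  by move=> u _; exact: dot_ge0.
have s0 : 0 <= s := le_trans t0 ts.
have := potential_quadratic (xr s s0).
have sdl : Num.norm `|x s - e| < dl.
  rewrite normr_id (le_lt_trans (TH s _))//; first by rewrite le_max lexx orbT.
  by rewrite ltr_pdivrMr// ltr_pMr// ltr1n.
by have := sm _ sdl; rewrite ler_norml; lra.
Qed.

(* While [x] is near [e], [n = |x - e|^2] satisfies [n' <= K |phi x|^2], so
   [n - K Phi(x)] is nonincreasing; and [Phi (x t) <= Phi e] because [x] tends
   to [e].  Thus an orbit converging to [e] cannot make a large excursion. *)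
Lemma no_excursion (rho : R) : 0 < rho -> exists2 sig : R, 0 < sig &
  forall x, orbit_to x -> dot (x 0 - e) (x 0 - e) <= sig ->
  forall t : R, 0 <= t -> dot (x t - e) (x t - e) <= rho.
Proof.
move=> rho0; have [c c0 Hc] := saddle_coercive Je; have [_ Hd _ _ _] := hdata.
pose q := d%:R * L ^+ 2; have q0 : 0 <= q by rewrite mulr_ge0// sqr_ge0.
(* Within [n <= rho1] the squared linearization error is at most [(c / 4) n], so that coercivity of
   [J e] passes to the field: [n] is at most [4 / c] times [|phi x|^2]. *)
pose rho1 := Num.min rho (c / (4 * (q + 1))).
have q1 : 0 < 4 * (q + 1) by rewrite mulr_gt0// ltr_pwDr.
have rho10 : 0 < rho1 by rewrite lt_min rho0 divr_gt0.
have rho1c : q * rho1 <= c / 4.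
  rewrite (@le_trans _ _ (q * (c / (4 * (q + 1)))))//.
    by rewrite ler_wpM2l// ge_min lexx orbT.
  rewrite mulrA ler_pdivrMr// mulrA [c / 4 * 4]divfK// mulrC ler_wpM2l ?(ltW c0)//.
  by rewrite lerDl.
(* The two terms of [K] come from [n' <= n + |phi x|^2]. Then [n t] is at most
   [n 0 + K (Phi e - Phi (x 0))], and the quadratic bound on the potential gives the factor [D]. *)
pose K := 4 / c + 1; have K0 : 0 < K by rewrite ltr_pwDr// ltW// divr_gt0.
pose D := 1 + K * (d%:R * L).
have D0 : 0 < D by rewrite ltr_pwDl// mulr_ge0 ?(ltW K0)// mulr_ge0// ltW.
exists (rho1 / 2 / D) => [|x xo x0]; first by rewrite !divr_gt0.
have [xd xr xe] := xo.
pose n t := dot (x t - e) (x t - e).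
have n0 t : 0 <= n t by exact: dot_ge0.
have ud (t : R) : 0 <= t -> vder (fun t => x t - e) t (phi (x t)).
  move=> t0; rewrite -[phi _]subr0; apply: vderB; [exact: xd|exact: vder_cst].
have nd (t : R) : 0 <= t -> is_derive t 1 n (2 * dot (x t - e) (phi (x t))).
  move=> t0; apply: is_derive_eq (is_derive_dot (ud t t0) (ud t t0)) _.
  by rewrite (dotC (phi _)); ring.
have phi_ge (t : R) : 0 <= t -> n t <= rho1 ->
    n t <= 4 / c * dot (phi (x t)) (phi (x t)).
  move=> t0 nt; pose err := phi (x t) - J e *m (x t - e).
  have err2 : dot err err <= c / 4 * n t.
    rewrite (le_trans (dot_le_norm2 _))//.
    have h1 := linearization_error (xr t t0).
    have h2 : `|err| ^+ 2 <= (L * `|x t - e| ^+ 2) ^+ 2.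
      by rewrite lerXn2r ?nnegrE ?mulr_ge0 ?sqr_ge0// ltW.
    have h3 : `|x t - e| ^+ 2 <= n t by exact: norm2_le_dot.
    have h4 : (`|x t - e| ^+ 2) ^+ 2 <= n t * n t.
      by rewrite expr2 ler_pM// sqr_ge0.
    have h5 : `|err| ^+ 2 <= L ^+ 2 * (n t * n t).
      by rewrite (le_trans h2)// exprMn ler_wpM2l// sqr_ge0.
    apply: le_trans (ler_wpM2l (ler0n _ d) h5) _.
    have -> : d%:R * (L ^+ 2 * (n t * n t)) = q * n t * n t by rewrite /q; ring.
    by rewrite ler_wpM2r// (le_trans _ rho1c)// ler_wpM2l.
  have h5 := Hc (x t - e); rewrite -/(n t) in h5.
  have E : J e *m (x t - e) = phi (x t) - err by rewrite /err opprB [RHS]addrC subrK.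
  have h7 : dot (J e *m (x t - e)) (J e *m (x t - e)) <=
      2 * dot (phi (x t)) (phi (x t)) + 2 * dot err err.
    by rewrite E dotB_le.
  set pp := dot (phi (x t)) (phi (x t)) in h7 *.
  rewrite -(ler_pM2l c0); have -> : c * (4 / c * pp) = 4 * pp by field; rewrite gt_eqF.
  by move: h5 h7 err2; move: (dot err err) (dot _ _) => p1 p2; lra.
have small (t : R) : 0 <= t -> (forall s, 0 <= s <= t -> n s <= rho1) -> n t <= D * n 0.
  move=> t0 H.
  have mono : n t - K * Phi (x t) <= n 0 - K * Phi (x 0).
    apply: (le_of_derive_le0 t0 (f := fun t => n t - K * Phi (x t))
      (df := fun t => 2 * dot (x t - e) (phi (x t)) - K * dot (phi (x t)) (phi (x t)))).
      move=> s /andP[s0 _]; apply: is_deriveB; first exact: nd.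
      by apply: is_deriveZ_R; apply: Hd; exact: xd.
    move=> s /[dup] st /andP[s0 _]; have := phi_ge s s0 (H s st).
    have := dot2_le (x s - e) (phi (x s)); rewrite -/(n s) /K; lra.
  have h1 := potential_le xo t0.
  have h2 := potential_quadratic (xr 0 (lexx 0)).
  have h3 : d%:R * L * `|x 0 - e| ^+ 2 <= d%:R * L * n 0.
    by rewrite ler_wpM2l ?norm2_le_dot// mulr_ge0// ltW.
  have h4 : K * (Phi (x t) - Phi (x 0)) <= K * (d%:R * L * n 0).
    by rewrite ler_wpM2l ?(ltW K0)//; move: h2; rewrite ler_norml; lra.
  rewrite /D; lra.
have Dn0 : D * n 0 <= rho1 / 2.
  by rewrite mulrC -ler_pdivlMr.
have main : forall t : R, 0 <= t -> n t <= rho1 / 2.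
  apply: (@first_exit _ n (rho1 / 2) rho1) => //.
  - by rewrite ltr_pdivrMr// ltr_pMr// ltr1n.
  - by move=> t t0; exact: is_derive_cts (nd t t0).
  - rewrite (le_trans _ Dn0)// ler_peMl// lerDl mulr_ge0 ?(ltW K0)//.
    by rewrite mulr_ge0// ltW.
  - by move=> t t0 H; rewrite (le_trans (small t t0 H)).
move=> t t0; rewrite (le_trans (main t t0))//.
have : rho1 <= rho by rewrite ge_min lexx.
by have := rho10; lra.
Qed.

End tangent.

Section tangent_vectors.
Context {R : realType} {d : nat}.
Variables (r L : R) (Phi : 'cV[R]_d -> R) (phi : 'cV[R]_d -> 'cV[R]_d)
  (J : 'cV[R]_d -> 'M[R]_d) (e : 'cV[R]_d).
Hypothesis hdata : gradient_data r L Phi phi J.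
Hypothesis er : `|e| <= r.
Hypothesis phie : phi e = 0.
Hypothesis Je : saddle (J e).

(* The difference of two orbits staying near [e] is a bounded solution of a
   small perturbation of [w' = J e w], hence controlled by its initial value. *)
Lemma orbits_distance (x0 : R -> 'cV[R]_d) : orbit_to r phi e x0 ->
  exists dl D : R, [/\ 0 < dl, 0 <= D & forall X, orbit_to r phi e X ->
  dot (X 0 - x0 0) (X 0 - x0 0) <= dl -> forall t : R, 0 <= t ->
  dot (X t - x0 t) (X t - x0 t) <= D * dot (X 0 - x0 0) (X 0 - x0 0)].
Proof.
move=> x0o; have [x0d x0r x0e] := x0o.
have [L0 _ Hl HJ Hlin] := hdata.
have [kap [C [b [kap0 C0 b0 decay]]]] := saddle_bounded_decay Je.
have dL0 : 0 <= d%:R * L ^+ 2 by rewrite mulr_ge0// sqr_ge0.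
have [eta0 eta00 etaP] := small_square dL0 kap0.
pose eta := eta0 / 2; have eta_gt0 : 0 < eta by rewrite divr_gt0.
have {}etaP : d%:R * L ^+ 2 * eta ^+ 2 <= kap.
  by apply: etaP; rewrite gtr0_norm// /eta; lra.
have eta2 : 0 < eta ^+ 2 by rewrite exprn_gt0.
(* Within distance [eta] of [e] the remainder is below the tolerance [kap]; starting with square at
   most [sig] keeps an orbit there. From [T] on the reference orbit uses a quarter of [sig] and
   [w T] another quarter, as the square of a sum is at most twice the sum of squares. Dividing by
   the Gronwall factor [E] moves the condition on [w] from time [T] to time [0]. *)
have [sig sig0 exc] := no_excursion hdata er phie Je eta2.
have sig4 : 0 < sig / 4 by rewrite divr_gt0.
have [ep ep0 epP] := small_square (ler0n R d) sig4.
have [T T0 TP] := x0e _ (divr_gt0 ep0 (ltr0n R 2)).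
have x0T : dot (x0 T - e) (x0 T - e) <= sig / 4.
  rewrite (le_trans (dot_le_norm2 _))//; apply: epP; rewrite normr_id.
  by rewrite (le_lt_trans (TP T (lexx T)))//; lra.
pose E := expR (growth d L * T).
have E0 : 0 < E by exact: expR_gt0.
have growL : 0 <= growth d L by rewrite /growth !addr_ge0// !mulr_ge0// ltW.
exists (sig / 4 / E), (E + C * E); split.
- by rewrite divr_gt0.
- by rewrite addr_ge0 ?mulr_ge0// ltW.
move=> X Xo X0 t t0; have [Xd Xr Xe] := Xo.
pose w s := X s - x0 s.
have wd (s : R) : 0 <= s -> vder w s (phi (X s) - phi (x0 s)).
  by move=> s0; apply: vderB; [exact: Xd|exact: x0d].
have w_early (s : R) : 0 <= s -> s <= T -> dot (w s) (w s) <= E * dot (w 0) (w 0).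
  move=> s0 sT.
  have := @gronwall_vector _ _ w (fun s => phi (X s) - phi (x0 s)) L 0 s (ltW L0) s0.
  rewrite expr0n addr0 => /(_ _ _)/wrap[u /andP[u0 _]|u /andP[u0 _]|H].
  - exact: wd.
  - by rewrite addr0; have [] := Hl (X u) (x0 u) (Xr u u0) (x0r u u0).
  - rewrite (le_trans H)// ler_wpM2r ?dot_ge0// ler_expR ler_wpM2l//.
have n0 := dot_ge0 (w 0).
have [tT|Tt] := leP t T.
  rewrite (le_trans (w_early t t0 tT))// ler_wpM2r// lerDl mulr_ge0// ltW//.
have wT : dot (w T) (w T) <= sig / 4.
  rewrite (le_trans (w_early T T0 (lexx T)))// mulrC -ler_pdivlMr//.
have shift x : orbit_to r phi e x -> orbit_to r phi e (fun s => x (s + T)).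
  move=> [xd xr xe]; split=> [s s0|s s0|ep1 ep10].
  - by apply: vder_shift; apply: xd; rewrite addr_ge0.
  - by apply: xr; rewrite addr_ge0.
  - have [T1 T10 H] := xe ep1 ep10; exists T1 => // s T1s; apply: H.
    by rewrite (le_trans T1s)// lerDl.
have near_e x : orbit_to r phi e x -> dot (x T - e) (x T - e) <= sig ->
    forall s : R, 0 <= s -> `|x (s + T) - e| <= eta.
  move=> xo xT s s0; have := exc _ (shift x xo).
  rewrite /= add0r => /(_ xT s s0) H.
  by rewrite -(ler_pXn2r (n := 2))// ?nnegrE ?(ltW eta_gt0)// (le_trans (norm2_le_dot _)).
have XT : dot (X T - e) (X T - e) <= sig.
  have -> : X T - e = w T + (x0 T - e) by rewrite /w addrA subrK.
  apply: (le_trans (dotD_le _ _)); lra.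
have x0T' : dot (x0 T - e) (x0 T - e) <= sig by apply: (le_trans x0T); lra.
pose rr s := phi (X (s + T)) - phi (x0 (s + T)) - J e *m w (s + T).
have T0s (s : R) : 0 <= s -> 0 <= s + T by move=> s0; rewrite addr_ge0.
have late := decay (fun s => w (s + T)) rr (r + r).
have {}late : dot (w t) (w t) <= C * expR (- b * (t - T)) * dot (w T) (w T).
  have := late _ _ _ (t - T); rewrite subrK add0r; apply.
  - move=> s s0; rewrite /rr addrC subrK; apply: vder_shift; apply: wd; exact: T0s.
  - move=> s s0; have := Hlin (x0 (s + T)) (X (s + T)) e eta (x0r _ (T0s s s0))
      (Xr _ (T0s s s0)) er (near_e x0 x0o x0T' s s0) (near_e X Xo XT s s0).
    rewrite -/(w (s + T)) -/(rr s) => rb.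
    rewrite (le_trans (dot_le_norm2 _))//.
    rewrite (@le_trans _ _ (d%:R * (L * eta * `|w (s + T)|) ^+ 2))//.
      by rewrite ler_wpM2l// lerXn2r ?nnegrE// !mulr_ge0// ltW.
    have -> : d%:R * (L * eta * `|w (s + T)|) ^+ 2 =
      d%:R * L ^+ 2 * eta ^+ 2 * `|w (s + T)| ^+ 2 by ring.
    rewrite ler_pM ?sqr_ge0//; last exact: norm2_le_dot.
    by rewrite mulr_ge0// ltW.
  - move=> s s0; rewrite (le_trans (ler_normB _ _))// lerD//.
      by apply: Xr; exact: T0s.
    by apply: x0r; exact: T0s.
  - by rewrite subr_ge0 ltW.
rewrite (le_trans late)// (@le_trans _ _ (C * dot (w T) (w T)))//.
  rewrite ler_wpM2r ?dot_ge0// -[leRHS]mulr1 ler_wpM2l ?(ltW C0)//.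
  by rewrite -expR0 ler_expR mulNr oppr_le0 mulr_ge0 ?(ltW b0)// subr_ge0 ltW.
rewrite (@le_trans _ _ (C * (E * dot (w 0) (w 0))))//.
  by rewrite ler_wpM2l ?(ltW C0)// w_early.
by rewrite mulrA ler_wpM2r// lerDr ltW.
Qed.

(** The quotient of [X - x0] by [tau], where [X] starts at [c tau], is bounded uniformly in time and
    in small [tau] by [orbits_distance]. It solves the linearized equation up to an error of order
    [tau], so at each fixed [t] it is within [1] of [z t] for [tau] small enough. How small depends
    on [t], but the resulting bound does not. *)
Lemma tangent_bounded (x0 c z : R -> 'cV[R]_d) (v : 'cV[R]_d) (delta : R) :
  orbit_to r phi e x0 -> c 0 = x0 0 -> vder c 0 v -> 0 < delta ->
  (forall tau : R, `|tau| < delta -> exists2 X, X 0 = c tau & orbit_to r phi e X) ->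
  (forall t : R, 0 <= t -> vder z t (J (x0 t) *m z t)) -> z 0 = v ->
  exists b, forall t : R, 0 <= t -> `|z t| <= b.
Proof.
move=> x0o c0 cd delta0 cX zd z0; have [x0d x0r x0e] := x0o.
have [L0 _ Hl HJ Hlin] := hdata.
have [dl [D [dl0 D0 dist]]] := orbits_distance x0o.
have [d1 d10 cO] := vder_O1 cd.
pose V := `|v| + 1; have V0 : 0 < V by rewrite ltr_pwDr.
pose Q := D * (d%:R * V ^+ 2).
have dV0 : 0 <= d%:R * V ^+ 2 by rewrite mulr_ge0// sqr_ge0.
have Q0 : 0 <= Q by rewrite mulr_ge0.
exists (Q + 1 + 1) => t t0.
pose k := growth d (d%:R * L); pose E := expR (k * t).
have E0 : 0 < E by exact: expR_gt0.
have d20 : 0 <= E * d%:R by rewrite mulr_ge0// ltW.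
have half0 : 0 < 2^-1 :> R by rewrite invr_gt0.
have [ep ep0 epP] := small_square d20 half0.
have [d2 d20' cE] := (vder_epsP _ _ _).1 cd (ep / 2) (divr_gt0 ep0 (ltr0n R 2)).
have [d3 d30 s3] := small_square dV0 dl0.
have LQ0 : 0 <= E * (L * Q) ^+ 2 by rewrite mulr_ge0 ?sqr_ge0// ltW.
have [d4 d40 s4] := small_square LQ0 half0.
(* [delta] makes [X] available, [d1] bounds the speed of [c], [d2] makes the initial error of the
   quotient small, [d3] brings [X 0] into the range of [orbits_distance], and [d4] makes the
   remainder small even after amplification by [E]. *)
pose m := Num.min delta (Num.min d1 (Num.min d2 (Num.min d3 d4))).
have m0 : 0 < m by rewrite !lt_min delta0 d10 d20' d30 d40.
pose tau := m / 2; have tau0 : 0 < tau by rewrite divr_gt0.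
have : `|tau| < m by rewrite gtr0_norm// /tau; lra.
rewrite !lt_min => /and5P[tde t1 t2 t3 t4].
have [X X0 Xo] := cX tau tde; have [Xd Xr Xe] := Xo.
pose w s := X s - x0 s.
have w0E : w 0 = c (tau + 0) - c 0 by rewrite /w X0 c0 addr0.
have w0 : `|w 0| <= V * tau.
  by rewrite w0E (le_trans (cO tau t1))// gtr0_norm.
have w02 : dot (w 0) (w 0) <= d%:R * V ^+ 2 * tau ^+ 2.
  rewrite (le_trans (dot_le_norm2 _))// -mulrA ler_wpM2l// -exprMn.
  by rewrite lerXn2r ?nnegrE// mulr_ge0// ltW.
have wQ (s : R) : 0 <= s -> dot (w s) (w s) <= Q * tau ^+ 2.
  move=> s0; have h : dot (w 0) (w 0) <= dl by rewrite (le_trans w02)// s3.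
  by rewrite (le_trans (dist X Xo h s s0))// /Q -mulrA ler_wpM2l.
pose q s := tau^-1 *: w s - z s.
pose rho s := phi (X s) - phi (x0 s) - J (x0 s) *m w s.
have rhoE (s : R) : 0 <= s -> `|rho s| <= L * Q * tau ^+ 2.
  move=> s0; have := Hlin (x0 s) (X s) (x0 s) `|w s| (x0r s s0) (Xr s s0) (x0r s s0).
  rewrite subrr normr0 -/(w s) -/(rho s) => /(_ (normr_ge0 _) (lexx _)) /le_trans; apply.
  rewrite -mulrA -expr2 -[leRHS]mulrA ler_wpM2l ?(ltW L0)//.
  by rewrite (le_trans (norm2_le_dot _))// wQ.
have qd (s : R) : 0 <= s -> vder q s (J (x0 s) *m q s + tau^-1 *: rho s).
  move=> s0; apply: vder_eq.
    apply: vderB; last exact: zd.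
    by apply: vderZ; apply: vderB; [exact: Xd|exact: x0d].
  rewrite /q /rho mulmxBr -scalemxAr [X in _ = _ + X]scalerBr.
  by rewrite [RHS]addrC addrA subrK.
have q0 : `|q 0| <= ep / 2.
  rewrite /q z0 w0E addr0 -[X in `|X|]addr0 -(subrr (tau^-1 *: (tau *: v))).
  have -> : tau^-1 *: (c tau - c 0) - v + (tau^-1 *: (tau *: v) - tau^-1 *: (tau *: v)) =
      tau^-1 *: (c tau - c 0 - (tau - 0) *: v).
    rewrite subr0 [RHS]scalerBr subrr addr0 scalerA mulVf ?gt_eqF// scale1r//.
  rewrite normrZ normfV gtr0_norm// mulrC ler_pdivrMr//.
  by have := cE tau; rewrite subr0 (gtr0_norm tau0); apply; rewrite gtr0_norm in t2.
have q1 : dot (q t) (q t) <= 1.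
  have := @gronwall_vector _ _ q (fun s => J (x0 s) *m q s + tau^-1 *: rho s)
    (d%:R * L) (L * Q * tau) t _ t0.
  move=> /(_ _ _ _)/wrap[||s /andP[s0 _]|H].
  - by rewrite mulr_ge0// ltW.
  - by move=> s /andP[s0 _]; exact: qd.
  - rewrite (le_trans (ler_normD _ _))// lerD//.
      rewrite (le_trans (norm_mulmx_le _ _))// ler_wpM2r// ler_wpM2l//.
      by apply: HJ; exact: x0r.
    rewrite normrZ normfV gtr0_norm// mulrC ler_pdivrMr//.
    by rewrite -[leRHS]mulrA -expr2; exact: rhoE.
  - rewrite (le_trans H)// -/k -/E.
    have h1 : E * dot (q 0) (q 0) <= 2^-1.
      rewrite (le_trans (ler_wpM2l (ltW E0) (dot_le_norm2 _)))// mulrA.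
      by apply: epP; rewrite normr_id (le_lt_trans q0)//; lra.
    have h2 : E * (L * Q * tau) ^+ 2 <= 2^-1 by rewrite exprMn mulrA; exact: s4.
    by rewrite mulrDr; lra.
have -> : z t = tau^-1 *: w t - q t by rewrite /q opprB addrC subrK.
rewrite (le_trans (ler_normB _ _))// lerD//.
- rewrite normrZ normfV gtr0_norm// mulrC ler_pdivrMr//.
  by apply: norm_le_of_dot => //; [exact: ltW|exact: wQ].
- rewrite -(ler_pXn2r (n := 2))// ?nnegrE// expr1n (le_trans (norm2_le_dot _))//.
Qed.

End tangent_vectors.

(** * Bounded linearized solutions from tangent vectors of stable sets *)

Section transversality.
Context {R : realType} {d : nat}.
Implicit Types (x z : R -> 'cV[R]_d) (p e u v : 'cV[R]_d).

Lemma dot_near p (B : R) : dot p p < B ->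
  exists2 ep : R, 0 < ep & forall u, `|u - p| <= ep -> dot u u <= B.
Proof.
move=> pB; pose k := 2 * d%:R * `|p| + d%:R.
have k0 : 0 <= k by rewrite addr_ge0// !mulr_ge0.
have k1 : 0 < k + 1 by rewrite ltr_pwDr.
have B0 : 0 < B - dot p p by rewrite subr_gt0.
exists (Num.min 1 ((B - dot p p) / (k + 1))) => [|u].
  by rewrite lt_min ltr01 divr_gt0.
rewrite le_min ler_pdivlMr// => /andP[u1 uk].
have -> : u = p + (u - p) by rewrite addrC subrK.
move: (u - p) u1 uk => w u1 uk.
rewrite dotDl !dotDr (dotC w p).
have h1 := le_trans (ler_norm _) (dot_le p w).
have h2 : dot w w <= d%:R * `|w|.
  rewrite (le_trans (dot_le_norm2 w))// ler_wpM2l// expr2 ler_piMl//.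
have h3 := normr_ge0 w.
by move: uk; rewrite /k mulrDr mulrDr; lra.
Qed.

Lemma norm_le_of_dot_le (B : R) u : 0 <= B -> dot u u <= B -> `|u| <= B + 1.
Proof.
by move=> B0 uB; have := @norm_le_of_dot R d u B 1 B0 ler01; rewrite expr1n !mulr1; exact.
Qed.

Lemma stable_setP (phi : 'cV[R]_d -> 'cV[R]_d) e p : stable_set phi e p ->
  exists X, [/\ X 0 = p, forall t : R, 0 <= t -> vder X t (phi (X t)) & tends_to X e].
Proof.
move=> [x [x0 xd xe]]; have [X [XE Xd]] := halfline_extension xd.
exists X; split=> [|t t0|]; first by rewrite XE.
  by rewrite XE//; exact: Xd.
move=> ep ep0; have [T T0 H] := (tends_to_cvg _ _).1 xe ep ep0.
by exists T => // t Tt; rewrite XE ?H// (le_trans T0).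
Qed.

(** The strict inequality at [x 0] leaves room for the nearby points [c tau]: they still satisfy the
    bound [B], so their orbits stay in the ball as [orbit_to] demands. *)
Lemma tangent_stable_bounded (r L B : R) Phi phi J e x z v :
  gradient_data r L Phi phi J -> `|e| <= r -> phi e = 0 -> saddle (J e) ->
  orbit_to r phi e x -> dot (x 0) (x 0) < B ->
  (forall X, (forall t : R, 0 <= t -> vder X t (phi (X t))) -> tends_to X e ->
    dot (X 0) (X 0) <= B -> forall t : R, 0 <= t -> `|X t| <= r) ->
  tangent_space (stable_set phi e) (x 0) v ->
  (forall t : R, 0 <= t -> vder z t (J (x t) *m z t)) -> z 0 = v ->
  exists b, forall t : R, 0 <= t -> `|z t| <= b.
Proof.
move=> hdata er phie Je xo xB ball_r [c [dl dl0 [c0 cv cW]]] zd z0.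
have cd : vder c 0 v.
  apply/vderP; have [|_ cder _] := cW 0; first by rewrite normr0.
  by rewrite -cv derive1E; exact: derivableP.
have [ep ep0 epP] := dot_near xB.
have [d1 d10 cO] := vder_O1 cd.
have V0 : 0 < `|v| + 1 by rewrite ltr_pwDr.
apply: (@tangent_bounded _ _ r L Phi phi J e hdata er phie Je x c z v
  (Num.min dl (Num.min d1 (ep / (`|v| + 1))))) => //.
  by rewrite !lt_min dl0 d10 divr_gt0.
move=> tau; rewrite !lt_min => /and3P[tdl td1 tep].
have [/stable_setP[X [X0 Xd Xe]] _ _] := cW tau tdl.
exists X => //; split=> //; apply: ball_r => //.
rewrite X0; apply: epP; rewrite -c0; have := cO tau td1; rewrite addr0.
move=> /le_trans; apply; rewrite mulrC -ler_pdivlMr//; exact: ltW.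
Qed.

End transversality.

(** * Dissipativity, and bounded solvability along a connection *)

Section dissipative.
Context {R : realType} {d : nat}.
Variables (F : 'cV[R]_d -> R) (R0 C_F : R).
Hypothesis hF : Ck 3 F.
Hypothesis hR0 : 0 < R0.
Hypothesis hC_F : 0 < C_F.
Hypothesis hdiss : forall x : 'cV[R]_d, R0 <= enorm x ->
  C_F * enorm x ^+ 2 <= - dot (grad F x) x.
Implicit Types (x : R -> 'cV[R]_d) (e : 'cV[R]_d).

Lemma dissipative_dot (u : 'cV[R]_d) : R0 ^+ 2 <= dot u u ->
  C_F * dot u u <= - dot (grad F u) u.
Proof.
move=> uR; rewrite -enorm_sqr; apply: hdiss.
by rewrite -(ler_pXn2r (n := 2))// ?nnegrE ?sqrtr_ge0 ?(ltW hR0)// enorm_sqr.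
Qed.

Lemma equilibrium_small e : equilibrium (grad F) e -> dot e e < R0 ^+ 2.
Proof.
move=> fe; rewrite ltNge; apply/negP => /[dup] eR /dissipative_dot.
rewrite fe dot0l oppr0; apply/negP; rewrite -ltNge mulr_gt0//.
by rewrite (lt_le_trans _ eR)// exprn_gt0.
Qed.

Lemma forward_invariant x (B tau : R) : R0 ^+ 2 <= B ->
  (forall t : R, 0 <= t <= tau -> vder x t (grad F (x t))) ->
  dot (x 0) (x 0) <= B -> forall t : R, 0 <= t <= tau -> dot (x t) (x t) <= B.
Proof.
move=> RB xd x0; have B0 : 0 < B by rewrite (lt_le_trans _ RB)// exprn_gt0.
apply: (@barrier _ (fun t => dot (x t) (x t)) (fun t => 2 * dot (grad F (x t)) (x t))) => //.
  move=> t ti; apply: is_derive_eq (is_derive_dot (xd t ti) (xd t ti)) _.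
  by rewrite (dotC (x t)); ring.
move=> t ti xB; have := dissipative_dot (u := x t); rewrite xB => /(_ RB).
by have := mulr_gt0 hC_F B0; lra.
Qed.

(** Late on the reversed orbit the point is close to [e], inside the absorbing ball; read forwards
    in time from there, the orbit cannot leave that ball. *)
Lemma backward_bounded x e : equilibrium (grad F) e ->
  (forall t : R, 0 <= t -> vder x t (- grad F (x t))) -> tends_to x e ->
  forall t : R, 0 <= t -> dot (x t) (x t) <= R0 ^+ 2.
Proof.
move=> fe xd xe t t0.
have [ep ep0 epP] := dot_near (equilibrium_small fe).
have [T T0 TP] := xe ep ep0.
pose s := Num.max t T; have ts : t <= s by rewrite le_max lexx.
have sR : dot (x s) (x s) <= R0 ^+ 2 by apply/epP/TP; rewrite le_max lexx orbT.
have := @forward_invariant (fun u => x (s - u)) (R0 ^+ 2) s (lexx _) _ _ (s - t).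
rewrite subr0 subKr => /(_ _ sR)/wrap[u /andP[u0 us]|]; last first.
  by apply; rewrite subr_ge0 ts/= gerDl oppr_le0.
have -> : (fun u => x (s - u)) = (fun u => x (-1 * u + s)).
  by apply/funext => y; rewrite mulN1r addrC.
have su : 0 <= -1 * u + s by rewrite mulN1r addrC subr_ge0.
by have := vder_reparam (xd _ su); rewrite scaleN1r opprK mulN1r [- u + s]addrC.
Qed.

Definition connecting_orbit x (ei ej : 'cV[R]_d) :=
  [/\ forall t : R, vder x t (grad F (x t)), tends_to (fun t => x (- t)) ei
    & tends_to x ej].

Lemma continuous_maxr (c : R) : continuous (fun t : R => Num.max t c).
Proof.
by move=> t; apply: (@continuous_max _ _ id (cst c)); [exact: cvg_id|exact: cvg_cst].
Qed.

(** Freezing before [T'] keeps the coefficient within [ep] of [H] on the whole line, with [ep] small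
    enough for [bsolvable_near]. Every later [T'] is allowed because both ends must be cut at the
    same time. *)
Lemma bsolvable_near_end (A : R -> 'M[R]_d) (H : 'M[R]_d) : continuous A ->
  saddle H -> (forall ep : R, 0 < ep -> exists2 T : R, 0 <= T &
    forall t : R, T <= t -> `|A t - H| <= ep) ->
  exists2 T : R, 0 <= T & forall T' : R, T <= T' ->
    exists2 K : R, 0 <= K & bsolvable (fun t => A (Num.max t T')) K.
Proof.
move=> Ac Hs AH; have [K K0 HK] := saddle_bsolvable Hs.
pose ep := (2 * (K * d%:R + 1))^-1.
have Kd : 0 <= K * d%:R by rewrite mulr_ge0// ltW.
have k0 : 0 < 2 * (K * d%:R + 1) by rewrite mulr_gt0// ltr_pwDr.
have [T T0 TP] := AH ep (eq_ind_r _ k0 (invr_gt0 _)).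
exists T => // T' TT'; exists (2 * K); first by rewrite mulr_ge0// ltW.
apply: (@bsolvable_near R d (fun t => A (Num.max t T')) H K ep).
- exact: ltW.
- move=> t; apply: (@continuous_comp _ _ _ (fun t => Num.max t T') A); last exact: Ac.
  exact: continuous_maxr.
- exact: HK.
- by move=> t; apply: TP; rewrite (le_trans TT')// le_max lexx orbT.
- rewrite mulrA /ep invfM mulrCA ler_piMr ?invr_ge0//.
  by rewrite ler_pdivrMr ?ltr_pwDr// mul1r lerDl.
Qed.

Lemma transversal_bsolvable x ei ej :
  connecting_orbit x ei ej ->
  equilibrium (grad F) ei -> equilibrium (grad F) ej ->
  saddle (jac (grad F) ei) -> saddle (jac (grad F) ej) ->
  transversal_sets (unstable_set (grad F) ei) (stable_set (grad F) ej) ->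
  exists2 K, 0 < K & bsolvable (fun t => jac (grad F) (x t)) K.
Proof.
move=> [xd xi xj] fi fj Ji Jj trans.
(* Above [R0 ^+ 2], so that the corresponding ball is forward invariant, and strictly above
   [dot (x 0) (x 0)], so that it contains the starting points near [x 0]. *)
pose B := dot (x 0) (x 0) + R0 ^+ 2 + 1.
have RB : R0 ^+ 2 <= B by rewrite /B; have := dot_ge0 (x 0); lra.
have B0 : 0 <= B by rewrite (le_trans _ RB)// sqr_ge0.
have xB : dot (x 0) (x 0) < B by rewrite /B; have := sqr_ge0 R0; lra.
pose r := B + 1.
have small_r e : equilibrium (grad F) e -> `|e| <= r.
  move=> /equilibrium_small eR; apply: norm_le_of_dot_le => //.
  exact: le_trans (ltW eR) RB.
have [L hdata] := C3_gradient_data hF r.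
have hdataN := gradient_dataN hdata.
have ball_s X : (forall t : R, 0 <= t -> vder X t (grad F (X t))) ->
    dot (X 0) (X 0) <= B -> forall t : R, 0 <= t -> `|X t| <= r.
  move=> Xd X0 t t0; apply: norm_le_of_dot_le => //.
  by apply: (@forward_invariant _ _ t RB _ X0); rewrite ?t0//= => s /andP[s0 _]; exact: Xd.
have ball_u X : (forall t : R, 0 <= t -> vder X t (- grad F (X t))) ->
    tends_to X ei -> forall t : R, 0 <= t -> `|X t| <= r.
  move=> Xd Xe t t0; apply: norm_le_of_dot_le => //.
  exact: le_trans (backward_bounded fi Xd Xe t0) RB.
have xo : orbit_to r (grad F) ej x.
  by split=> //; apply: ball_s => //; exact: ltW.
pose y t := x (- t).
have yd (t : R) : 0 <= t -> vder y t (- grad F (y t)).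
  by move=> _; apply: vder_opp; exact: xd.
have yo : orbit_to r (fun u => - grad F u) ei y.
  by split=> //; exact: ball_u.
have xr t : `|x t| <= r.
  have [t0|t0] := leP 0 t; first by have [_ H _] := xo; exact: H.
  by have [_ H _] := yo; rewrite -[t]opprK; apply: H; rewrite oppr_ge0 ltW.
have [L0 _ Hl HJ _] := hdata.
pose A t := jac (grad F) (x t).
have xc : continuous x by move=> t; exact: vder_cts (xd t).
have Ac : continuous A.
  move=> t; apply: (@continuous_comp _ _ _ x (jac (grad F))); first exact: xc.
  exact: jac_continuous.
have Ab t : `|A t| <= L by exact: HJ.
have hc0 : continuous (fun _ : R => 0 : 'cV[R]_d) by exact: continuous_cst.
have ANc : continuous (fun t => - A (- t)).
  move=> t; apply: cvgN; apply: (@continuous_comp _ _ _ -%R A).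
    exact: opp_continuous.
  exact: Ac.
have ends x1 e (s : R) : tends_to x1 e -> (forall t : R, `|x1 t| <= r) -> `|e| <= r ->
    forall ep : R, 0 < ep -> exists2 T : R, 0 <= T & forall t : R, T <= t ->
    `|jac (grad F) (x1 t) - jac (grad F) e| <= ep.
  move=> x1e x1r er ep ep0; have [T T0 TP] := x1e _ (divr_gt0 ep0 L0).
  exists T => // t Tt; have [_ H] := Hl (x1 t) e (x1r t) er.
  rewrite (le_trans H)// mulrC -ler_pdivlMr//; exact: TP.
have [Tp Tp0 HTp] := bsolvable_near_end Ac Jj (ends x ej 1 xj xr (small_r ej fj)).
have [|Tm Tm0 HTm] := bsolvable_near_end ANc (saddleN Ji).
  move=> ep ep0; have [|T T0 TP] := ends y ei 1 xi _ (small_r ei fi) ep ep0.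
    by move=> t; exact: xr.
  by exists T => // t Tt; rewrite -opprD normrN; exact: TP.
pose T := Num.max Tp Tm.
have [|Kp Kp0 HKp] := HTp T; first by rewrite le_max lexx.
have [|Km Km0 HKm] := HTm T; first by rewrite le_max lexx orbT.
apply: (bsolvable_glue Kp0 Km0 _ Ac Ab HKp HKm).
  by rewrite le_max Tp0.
move=> v.
have Wu : unstable_set (grad F) ei (x 0).
  exists y; split; first by rewrite /y oppr0.
    by move=> t t0; apply: vder_halfline; exact: yd.
  exact/tends_to_cvg.
have Ws : stable_set (grad F) ej (x 0).
  exists x; split=> //.
    by move=> t t0; apply: vder_halfline; exact: xd.
  exact/tends_to_cvg.
(* [v2], tangent to the stable set, starts [z], bounded in the future; [v1], tangent to the unstable
   set, starts [w], bounded in the past by the same lemma for the field [- grad F] along [y]. *)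
have [v1 [v2 [tv1 tv2 vE]]] := trans _ Wu Ws v.
have ivp u : exists z : R -> 'cV[R]_d, (forall t, vder z t (A t *m z t)) /\ z 0 = u.
  have [|z [zd z0]] := @linear_ivp _ _ A _ L 0 0 u Ac Ab hc0; first by move=> t; rewrite normr0.
  by exists z; split=> // t; have := zd t; rewrite addr0.
have [z [zd z0]] := ivp v2; have [w [wd w0]] := ivp v1.
have [b1 zb] : exists b, forall t : R, 0 <= t -> `|z t| <= b.
  apply: (@tangent_stable_bounded _ _ r L B F _ _ ej x z v2 hdata) => //.
    exact: small_r.
  by move=> X Xd _; exact: ball_s.
have [b2 wb] : exists b, forall t : R, 0 <= t -> `|w (- t)| <= b.
  apply: (@tangent_stable_bounded _ _ r L B _ _ _ ei y (fun t => w (- t)) v1 hdataN) => //.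
  - exact: small_r.
  - by rewrite fi oppr0.
  - exact: saddleN.
  - by rewrite /y oppr0.
  - by move=> X Xd Xe _; exact: ball_u.
  - by rewrite /y oppr0.
  - by move=> t _; rewrite mulNmx; apply: vder_opp; exact: wd.
  - by rewrite oppr0.
exists z, w, (Num.max b1 b2); split=> //.
- by move=> t t0; rewrite le_max zb.
- by move=> t t0; rewrite le_max -[t]opprK wb ?orbT// oppr_ge0.
- by rewrite z0 w0 addrC.
Qed.

End dissipative.

(** * Exponentially decaying kernels *)

Section exponential_integrals.
Context {R : realType}.
Notation mu := (@lebesgue_measure R).
Implicit Types (h : R -> R) (a b c : R).

Lemma measurable_halfline_set : measurable (halfline R : set (measurableTypeR R)).
Proof. exact: measurable_itv. Qed.

#[local] Hint Extern 0 (measurable (halfline _)) => exact: measurable_halfline_set : core.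

Lemma halflineP (s : R) : halfline R s = (0 <= s) :> Prop.
Proof. by rewrite /halfline/= in_itv/= andbT. Qed.

Lemma integrable_exp b : 0 < b ->
  mu.-integrable (halfline R) (EFin \o (fun s => expR (- b * s))).
Proof.
move=> b0; have H := integrable_exponential_pdf b0.
have {}H : mu.-integrable (halfline R) (EFin \o (fun s => b * expR (- b * s))).
  have := (integrable_restrict mu measurable_halfline_set measurableT
    (EFin \o (fun s => b * expR (- b * s)))).2.
  by rewrite setTI restrict_EFin; exact.
apply: (eq_integrable measurable_halfline_set _ _ _
  (integrableZl measurable_halfline_set b^-1 H)).
by move=> s _ /=; rewrite -EFinM mulrA mulVf ?mul1r// gt_eqF.
Qed.

Lemma Rintegral_exp b : 0 < b ->
  (\int[mu]_(s in halfline R) expR (- b * s))%R = b^-1.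
Proof.
move=> b0.
have E : (\int[mu]_(s in halfline R) (EFin \o (fun s : R => (b * expR (- b * s))%R)) s = 1)%E.
  by rewrite integral_mkcond restrict_EFin; exact: integral_exponential_pdf.
have : (\int[mu]_(s in halfline R) (b * expR (- b * s)))%R = 1.
  by rewrite /Rintegral E.
rewrite RintegralZl//; last exact: integrable_exp.
by move=> /(canRL (mulKf (lt0r_neq0 b0))); rewrite mulr1.
Qed.

Lemma exp_bounded_integral h c b : 0 < b -> measurable_fun (halfline R) h ->
  (forall s, 0 <= s -> `|h s| <= c * expR (- b * s)) ->
  mu.-integrable (halfline R) (EFin \o h) /\
  `|(\int[mu]_(s in halfline R) h s)%R| <= c / b.
Proof.
move=> b0 mh hc.
have ie := integrable_exp b0.
have ice : mu.-integrable (halfline R) (EFin \o (fun s => c * expR (- b * s))).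
  by have := integrableZl measurable_halfline_set c ie.
have c0 : 0 <= c.
  by have := le_trans (normr_ge0 _) (hc 0 (lexx 0)); rewrite mulr0 expR0 mulr1.
have ih : mu.-integrable (halfline R) (EFin \o h).
  apply: (le_integrable measurable_halfline_set _ _ ice); first exact/measurable_EFinP.
  move=> s; rewrite halflineP => s0 /=; rewrite lee_fin (le_trans (hc s s0))//.
  exact: ler_norm.
split=> //; rewrite (le_trans (le_normr_Rintegral measurable_halfline_set ih))//.
have -> : c / b = (\int[mu]_(s in halfline R) (c * expR (- b * s)))%R.
  by rewrite RintegralZl// Rintegral_exp.
apply: le_Rintegral => //.
- exact: integrable_norm ih.
- by move=> s; rewrite halflineP; exact: hc.
Qed.

(** The decay is shared out: beyond [tau] one half of the rate gives smallness, while the other half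
    ensures integrability. Hence [a / 2] in the result. *)
Lemma tail_integral h c a ep m tau : 0 < a -> 0 <= c -> 0 <= m -> 0 <= ep ->
  measurable_fun (halfline R) h ->
  (forall s, 0 <= s -> `|h s| <= c * expR (- a * s) * m) ->
  (forall s, 0 <= s -> s <= tau -> `|h s| <= c * expR (- a * s) * ep) ->
  `|(\int[mu]_(s in halfline R) h s)%R| <=
    c * (ep + m * expR (- (a / 2) * tau)) / (a / 2).
Proof.
move=> a0 c0 m0 ep0 mh hm hep; have a20 : 0 < a / 2 by rewrite divr_gt0.
suff hb s : 0 <= s ->
    `|h s| <= c * (ep + m * expR (- (a / 2) * tau)) * expR (- (a / 2) * s).
  by have [] := exp_bounded_integral a20 mh hb.
move=> s0.
have e1 : expR (- a * s) <= expR (- (a / 2) * s).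
  rewrite ler_expR !mulNr lerN2 ler_wpM2r// ler_pdivrMr// ler_pMr//.
  by rewrite ler1n.
have [st|ts] := leP s tau.
- rewrite (le_trans (hep s s0 st))// -!mulrA ler_wpM2l// mulrC ler_pM ?expR_ge0//.
  by rewrite lerDl mulr_ge0// expR_ge0.
- rewrite (le_trans (hm s s0))// -!mulrA ler_wpM2l// mulrDl.
  rewrite (@le_trans _ _ (m * expR (- (a / 2) * tau) * expR (- (a / 2) * s)))//.
    rewrite mulrC -mulrA ler_wpM2l// -expRD ler_expR.
    have := ler_wpM2l (ltW a20) (ltW ts); lra.
  by rewrite lerDr mulr_ge0// expR_ge0.
Qed.

(** Intervals have positive measure; almost everywhere properties are thus brought to points close
    to a prescribed one. *)
Lemma ae_exists (P : R -> Prop) a b : a < b ->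
  {ae mu, forall s, P s} -> exists2 s, a < s < b & P s.
Proof.
move=> ab [N [mN N0 PN]]; apply: contrapT => H.
have sub : `]a, b[%classic `<=` N.
  move=> s /=; rewrite in_itv/= => sab; apply: PN => /= Ps; apply: H; by exists s.
have : (mu `]a, b[%classic <= mu N)%E.
  by apply: le_measure; rewrite ?inE//; exact: measurable_itv.
rewrite N0 lebesgue_measure_itv/= lte_fin ab -EFinD lee_fin leNgt subr_gt0.
by rewrite ab.
Qed.

End exponential_integrals.

Section matrix_integrals.
Context {R : realType}.
Notation mu := (@lebesgue_measure R).
#[local] Hint Extern 0 (measurable (halfline _)) => exact: measurable_halfline_set : core.

Definition exp_bounded (m n : nat) (v : R -> 'M[R]_(m, n)) (c b : R) :=
  measurable_halfline v /\ forall s, 0 <= s -> `|v s| <= c * expR (- b * s).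

Lemma exp_bounded_entry (m n : nat) (v : R -> 'M[R]_(m, n)) c b i j : 0 < b ->
  exp_bounded v c b -> mu.-integrable (halfline R) (EFin \o (fun s => v s i j)) /\
  `|(\int[mu]_(s in halfline R) v s i j)%R| <= c / b.
Proof.
move=> b0 [mv vc]; apply: exp_bounded_integral => // s s0.
by rewrite (le_trans (coord_le_norm _ _ _))// vc.
Qed.

Lemma int_halfline_bound (m n : nat) (v : R -> 'M[R]_(m, n)) c b : 0 < b ->
  exp_bounded v c b -> `|int_halfline v| <= c / b.
Proof.
move=> b0 [mv vc].
have c0 : 0 <= c.
  by have := le_trans (normr_ge0 _) (vc 0 (lexx 0)); rewrite mulr0 expR0 mulr1.
apply: norm_le_coord => [|i j]; first by rewrite divr_ge0// ltW.
by rewrite mxE; have [] := exp_bounded_entry i j b0 (conj mv vc).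
Qed.

Lemma int_halflineB (m n : nat) (v w : R -> 'M[R]_(m, n)) c1 b1 c2 b2 :
  0 < b1 -> 0 < b2 -> exp_bounded v c1 b1 -> exp_bounded w c2 b2 ->
  int_halfline (fun s => v s - w s) = int_halfline v - int_halfline w.
Proof.
move=> b10 b20 vb wb; apply/matrixP => i j; rewrite !mxE.
have [iv _] := exp_bounded_entry i j b10 vb.
have [iw _] := exp_bounded_entry i j b20 wb.
rewrite -RintegralB//; apply: eq_Rintegral => s _; by rewrite !mxE.
Qed.

Lemma Rintegral_sum n (h : 'I_n -> R -> R) :
  (forall i, mu.-integrable (halfline R) (EFin \o h i)) ->
  (\int[mu]_(s in halfline R) \sum_i h i s)%R =
  \sum_i (\int[mu]_(s in halfline R) h i s)%R.
Proof.
move=> ih; rewrite /Rintegral.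
have -> : (\int[mu]_(s in halfline R) (\sum_i h i s)%:E =
    \int[mu]_(s in halfline R) \sum_i (h i s)%:E)%E.
  by apply: eq_integral => s _; rewrite sumEFin.
rewrite integral_sum//.
have E i : (\int[mu]_(s in halfline R) (h i s)%:E =
    (\int[mu]_(s in halfline R) h i s)%R%:E)%E.
  by rewrite /Rintegral fineK//; exact: (integrable_fin_num measurable_halfline_set (ih i)).
by rewrite (eq_bigr _ (fun i _ => E i)) sumEFin.
Qed.

Lemma int_halfline_mulmx (m n : nat) (B : R -> 'M[R]_(m, n)) c b (u : 'cV[R]_n) :
  0 < b -> exp_bounded B c b -> int_halfline (fun s => B s *m u) = int_halfline B *m u.
Proof.
move=> b0 Bb; apply/matrixP => i j; rewrite !mxE.
have iB k := (exp_bounded_entry i k b0 Bb).1.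
transitivity ((\int[mu]_(s in halfline R) \sum_k B s i k * u k j)%R).
  by apply: eq_Rintegral => s _; rewrite mxE.
rewrite Rintegral_sum => [|k]; last first.
  exact: (integrableZr measurable_halfline_set (u k j) (iB k)).
by apply: eq_bigr => k _; rewrite RintegralZr// mxE.
Qed.

Lemma measurable_halfline_mulmx (m n p : nat) (B : R -> 'M[R]_(m, n)) (v : R -> 'M[R]_(n, p)) :
  measurable_halfline B -> measurable_halfline v ->
  measurable_halfline (fun s => B s *m v s).
Proof.
move=> mB mv i j.
rewrite (_ : (fun s => _) = (fun s => \sum_k B s i k * v s k j)); last first.
  by apply/funext => s; rewrite mxE.
apply: measurable_sum => k; apply: measurable_funM; [exact: mB|exact: mv].
Qed.

Lemma measurable_halfline_continuous (m n : nat) (v : R -> 'M[R]_(m, n)) :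
  continuous v -> measurable_halfline v.
Proof.
move=> vc i j; apply: measurable_funTS; apply: continuous_measurable_fun => t.
by have /continuous_mxP := vc t; exact.
Qed.

Lemma measurable_halflineB (m n : nat) (v w : R -> 'M[R]_(m, n)) :
  measurable_halfline v -> measurable_halfline w ->
  measurable_halfline (fun s => v s - w s).
Proof.
move=> mv mw i j.
rewrite (_ : (fun s => _) = (fun s => v s i j) \- (fun s => w s i j)); last first.
  by apply/funext => s; rewrite !mxE.
exact: measurable_funB.
Qed.

Lemma measurable_dot d (v w : R -> 'cV[R]_d) :
  measurable_halfline v -> measurable_halfline w ->
  measurable_fun (halfline R) (fun s => dot (v s) (w s)).
Proof.
move=> mv mw; apply: measurable_sum => i; apply: measurable_funM; [exact: mv|exact: mw].
Qed.

Lemma int_halfline_ae0 (m n : nat) (v : R -> 'M[R]_(m, n)) :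
  measurable_halfline v -> {ae mu, forall s, 0 <= s -> v s = 0} -> int_halfline v = 0.
Proof.
move=> mv v0; apply/matrixP => i j; rewrite !mxE /Rintegral.
rewrite (@ae_eq_integral _ _ _ mu (halfline R) (cst 0%E) (fun s => (v s i j)%:E)).
- by rewrite integral0.
- by [].
- apply/measurable_EFinP; exact: mv.
- exact: measurable_cst.
- apply: (@filterS _ _ (ae_filter_ringOfSetsType mu) _ _ _ v0).
  by move=> s H; rewrite halflineP => s0; rewrite H//= mxE.
Qed.

End matrix_integrals.

(** * The memory operator on bounded functions of the line *)

Section memory_term.
Context {R : realType} {d : nat}.
Notation mu := (@lebesgue_measure R).
#[local] Hint Extern 0 (measurable (halfline _)) => exact: measurable_halfline_set : core.
Variables (M : R -> 'M[R]_d) (C a : R).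
Hypothesis a0 : 0 < a.
Hypothesis MC : exp_bounded M C a.
Implicit Types (x y : R -> 'cV[R]_d).

Definition memory x (t : R) : 'cV[R]_d := int_halfline (fun s => M s *m x (t - s)).

Let C0 : 0 <= C.
Proof.
have [_ H] := MC; have := le_trans (normr_ge0 _) (H 0 (lexx 0)).
by rewrite mulr0 expR0 mulr1.
Qed.

Let dC0 : 0 <= d%:R * C. Proof. by rewrite mulr_ge0. Qed.

(** Bound for the norm of [memory] as an operator in the sup norm. *)
Definition memory_norm : R := d%:R * C / a.

Lemma memory_norm_ge0 : 0 <= memory_norm.
Proof. by rewrite divr_ge0// ltW. Qed.

Lemma measurable_conv_integrand x (t : R) : continuous x ->
  measurable_halfline (fun s => M s *m x (t - s)).
Proof.
move=> xc; apply: measurable_halfline_mulmx; first by have [] := MC.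
apply: measurable_halfline_continuous => s.
apply: (@continuous_comp _ _ _ (fun s => t - s) x); last exact: xc.
by apply: cvgB; [exact: cvg_cst|exact: cvg_id].
Qed.

Lemma memory_integrand_le (v : 'cV[R]_d) (m s : R) : 0 <= s -> `|v| <= m ->
  `|M s *m v| <= d%:R * C * expR (- a * s) * m.
Proof.
move=> s0 vm; have [_ H] := MC.
rewrite (le_trans (norm_mulmx_le _ _))// ler_pM ?mulr_ge0//.
by rewrite -mulrA ler_wpM2l// H.
Qed.

Lemma memory_integrand_bounded x (t m : R) : continuous x -> (forall t, `|x t| <= m) ->
  exp_bounded (fun s => M s *m x (t - s)) (d%:R * C * m) a.
Proof.
move=> xc xm; split; first exact: measurable_conv_integrand.
by move=> s s0; rewrite mulrAC; exact: memory_integrand_le.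
Qed.

Lemma memory_bound x (m t : R) : continuous x -> (forall t, `|x t| <= m) ->
  `|memory x t| <= memory_norm * m.
Proof.
move=> xc xm; have := int_halfline_bound a0 (memory_integrand_bounded t xc xm).
by rewrite /memory_norm mulrAC.
Qed.

Lemma memoryB x y (m1 m2 t : R) : continuous x -> continuous y ->
  (forall t, `|x t| <= m1) -> (forall t, `|y t| <= m2) ->
  memory x t - memory y t = memory (fun s => x s - y s) t.
Proof.
move=> xc yc xm ym; rewrite /memory.
rewrite -(int_halflineB a0 a0 (memory_integrand_bounded t xc xm) (memory_integrand_bounded t yc ym)).
by congr int_halfline; apply/funext => s; rewrite mulmxBr.
Qed.

Lemma memory_cst (u : 'cV[R]_d) t : memory (fun=> u) t = int_halfline M *m u.
Proof. exact: int_halfline_mulmx a0 MC. Qed.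

Lemma memory_continuous x (m : R) : continuous x -> (forall t, `|x t| <= m) ->
  continuous (memory x).
Proof.
move=> xc xm t0; apply/continuous_mxP => i j.
have -> : (fun t => memory x t i j) =
    (fun t => (\int[mu]_(s in halfline R) (M s *m x (t - s)) i j)%R).
  by apply/funext => t; rewrite mxE.
have ib := memory_integrand_bounded _ xc xm.
have tI : t0 \in (`]t0 - 1, t0 + 1[%classic : set R).
  by rewrite inE/= in_itv/=; apply/andP; split; lra.
apply: (@continuity_under_integral R _ _ mu (fun t s => (M s *m x (t - s)) i j)
  (halfline R) measurable_halfline_set (t0 - 1) (t0 + 1) _ _
  (fun s => d%:R * C * m * expR (- a * s)) _ _ t0 tI).
- by move=> t _; have [] := exp_bounded_entry i j a0 (ib t).
- apply: aeW => s _ t _.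
  have : continuous (fun t => M s *m x (t - s)).
    apply: continuous_product; first exact: continuous_cst.
    move=> u; apply: (@continuous_comp _ _ _ (fun u => u - s) x); last exact: xc.
    by apply: cvgB; [exact: cvg_id|exact: cvg_cst].
  by move=> /(_ t)/continuous_mxP; exact.
- exact: (integrableZl measurable_halfline_set (d%:R * C * m) (integrable_exp a0)).
- move=> t _; apply: aeW => s; rewrite halflineP => s0.
  rewrite (le_trans (coord_le_norm _ _ _))//; have [_ H] := ib t; exact: H.
Qed.

(** Delays longer than [tau] meet values of [x] that are only bounded, but the kernel damps them.
    The factor 4 comes from the two contributions [ep] and from the halved rate. *)
Lemma memory_tail x (m ep : R) : continuous x -> (forall t, `|x t| <= m) -> 0 < ep ->
  (exists T : R, forall t : R, T <= t -> `|x t| <= ep) ->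
  exists T : R, forall t : R, T <= t -> `|memory x t| <= 4 * memory_norm * ep.
Proof.
move=> xc xm ep0 [T xT]; have m0 : 0 <= m by exact: le_trans (xm 0).
have m1 : 0 < m + 1 by rewrite ltr_pwDr.
(* Chosen so that [expR (- (a / 2) * tau)] equals [ep / (m + 1)]. *)
pose tau := - ln (ep / (m + 1)) / (a / 2).
have a20 : 0 < a / 2 by rewrite divr_gt0.
have tauE : m * expR (- (a / 2) * tau) <= ep.
  have -> : - (a / 2) * tau = ln (ep / (m + 1)) by rewrite /tau; field; rewrite gt_eqF.
  rewrite lnK ?posrE ?divr_gt0// mulrA ler_pdivrMr// mulrC ler_wpM2l ?(ltW ep0)//.
  by rewrite lerDl.
exists (T + tau) => t Tt.
have k0 : 0 <= 4 * memory_norm * ep by rewrite mulr_ge0 ?(ltW ep0)// mulr_ge0// memory_norm_ge0.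
apply: norm_le_coord => // i j; rewrite mxE.
have mh := measurable_conv_integrand t xc i j.
apply: (le_trans (tail_integral a0 dC0 m0 (ltW ep0) (tau := tau) mh _ _)).
- move=> s s0; rewrite (le_trans (coord_le_norm _ _ _))//.
  exact: memory_integrand_le.
- move=> s s0 st; rewrite (le_trans (coord_le_norm _ _ _))//.
  by apply: memory_integrand_le => //; apply: xT; lra.
- have -> : 4 * memory_norm * ep = d%:R * C * (ep + ep) / (a / 2).
    by rewrite /memory_norm; field; rewrite gt_eqF.
  by rewrite ler_wpM2r ?invr_ge0 ?(ltW a20)// ler_wpM2l// lerD2l.
Qed.

(** The memory at [t] looks only at times before [t], so a bound near [-oo] carries over without a
    tail estimate. *)
Lemma memory_past x (m ep : R) : continuous x -> (forall t, `|x t| <= m) ->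
  (exists T : R, forall t : R, t <= T -> `|x t| <= ep) ->
  exists T : R, forall t : R, t <= T -> `|memory x t| <= memory_norm * ep.
Proof.
move=> xc xm [T xT]; exists T => t tT.
have b : exp_bounded (fun s => M s *m x (t - s)) (d%:R * C * ep) a.
  split; first exact: measurable_conv_integrand.
  move=> s s0; rewrite mulrAC; apply: memory_integrand_le => //; apply: xT.
  by rewrite (le_trans _ tT)// gerDl oppr_le0.
by have := int_halfline_bound a0 b; rewrite /memory_norm mulrAC.
Qed.

End memory_term.

(** * Exponential decay of the weight and of the kernel *)

Section weight_decay.
Context {R : realType} {d : nat}.
Notation mu := (@lebesgue_measure R).
Variables (A dA : R -> 'M[R]_d) (C_A : R).
Hypothesis hA : C1_halfline A dA.
Hypothesis hApos : forall s : R, 0 <= s -> sym_posdef (A s).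
Hypothesis hC_A : 0 < C_A.
Hypothesis hAdecay : {ae lebesgue_measure, forall s : R, 0 < s ->
  forall u : 'cV[R]_d, dot (dA s *m u) u <= - C_A * dot (A s *m u) u}.

Lemma quad_le (B : 'M[R]_d) (u : 'cV[R]_d) : `|dot (B *m u) u| <= d%:R ^+ 2 * `|B| * dot u u.
Proof.
rewrite (le_trans (dot_le _ _))//.
rewrite (@le_trans _ _ (d%:R * (d%:R * `|B| * `|u| * `|u|)))//.
  by rewrite ler_wpM2l// ler_wpM2r// norm_mulmx_le.
have -> : d%:R * (d%:R * `|B| * `|u| * `|u|) = d%:R ^+ 2 * `|B| * `|u| ^+ 2 by ring.
by rewrite ler_wpM2l ?norm2_le_dot// mulr_ge0// sqr_ge0.
Qed.

(** Both sides are continuous in [s], and times where the inequality holds accumulate at [s] from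
    the right; this also reaches [s = 0]. *)
Lemma weight_derivative_le (s : R) (u : 'cV[R]_d) : 0 <= s ->
  dot (dA s *m u) u <= - C_A * dot (A s *m u) u.
Proof.
move=> s0; have [Ad dAc] := hA.
pose q := d%:R ^+ 2 * dot u u; have q0 : 0 <= q by rewrite mulr_ge0 ?sqr_ge0 ?dot_ge0.
pose k := q * (1 + C_A * (`|dA s| + 1)).
have k0 : 0 <= k by rewrite mulr_ge0// addr_ge0// mulr_ge0 ?(ltW hC_A)// addr_ge0.
apply/ler_addgt0Pr => ep ep0.
have k1 : 0 < k + 1 by rewrite ltr_pwDr.
pose eta := Num.min 1 (ep / (k + 1)).
have eta0 : 0 < eta by rewrite lt_min ltr01 divr_gt0.
have etak : k * eta <= ep.
  rewrite (@le_trans _ _ (k * (ep / (k + 1))))//.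
    by rewrite ler_wpM2l// ge_min lexx orbT.
  rewrite mulrA ler_pdivrMr// mulrC ler_wpM2l ?(ltW ep0)//.
  by rewrite lerDl.
have eta1 : eta <= 1 by rewrite ge_min lexx.
have sH : halfline R s by rewrite halflineP.
have := (subspace_continuousP _ _).1 dAc s sH.
move=> /cvgrPdist_le/(_ _ eta0); rewrite near_withinE => /nbhs_ballP[d1 /= d10 B1].
have [d2 d20 B2] := (halfline_epsP _ _ _).1 (Ad s s0) 1 ltr01.
pose dl := Num.min eta (Num.min d1 d2).
have dl0 : 0 < dl by rewrite lt_min eta0 lt_min d10 d20.
have [|y /andP[sy ydl] H] := ae_exists (a := s) (b := s + dl) _ hAdecay.
  by rewrite ltrDl.
have y0 : 0 < y := le_lt_trans s0 sy.
have ysE : `|y - s| = y - s by rewrite ger0_norm// subr_ge0 ltW.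
have : `|y - s| < dl by rewrite ysE ltrBlDl.
rewrite lt_min => /andP[yeta]; rewrite lt_min => /andP[yd1 yd2].
have e1 : `|dA s - dA y| <= eta.
  by apply: B1; rewrite ?halflineP ?(ltW y0)// -ball_normE/= distrC.
have e2 : `|A y - A s| <= (`|dA s| + 1) * eta.
  have := B2 y (ltW y0) yd2; rewrite mul1r => h.
  have -> : A y - A s = (A y - A s - (y - s) *: dA s) + (y - s) *: dA s by rewrite subrK.
  rewrite (le_trans (ler_normD _ _))// normrZ.
  have h2 : `|y - s| <= eta by exact: ltW.
  have h3 : `|y - s| * `|dA s| <= eta * `|dA s| by rewrite ler_wpM2r.
  rewrite mulrDl mul1r addrC; apply: lerD; first by rewrite [leRHS]mulrC.
  exact: le_trans h h2.
have f1 : `|dot ((dA s - dA y) *m u) u| <= q * eta.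
  rewrite (le_trans (quad_le _ _))// /q (mulrAC _ (dot u u)).
  by rewrite ler_wpM2r ?dot_ge0// ler_wpM2l ?sqr_ge0.
have f2 : `|dot ((A y - A s) *m u) u| <= q * ((`|dA s| + 1) * eta).
  rewrite (le_trans (quad_le _ _))// /q (mulrAC _ (dot u u)).
  by rewrite ler_wpM2r ?dot_ge0// ler_wpM2l ?sqr_ge0.
have f3 := H y0 u.
move: f1 f2; rewrite !mulmxBl !dotDl !dotNl => f1 f2.
have f4 : C_A * (dot (A s *m u) u - dot (A y *m u) u) <= C_A * (q * ((`|dA s| + 1) * eta)).
  rewrite ler_wpM2l ?(ltW hC_A)//; move: f2; rewrite ler_norml.
  by move: (dot (A s *m u) u) (dot (A y *m u) u) => p1 p2; lra.
have f5 : dot (dA s *m u) u - dot (dA y *m u) u <= q * eta.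
  by rewrite (le_trans (ler_norm _)).
move: etak; rewrite /k => f6; move: f3 f4 f5 f6.
move: (dot (A s *m u) u) (dot (A y *m u) u) (dot (dA s *m u) u) (dot (dA y *m u) u) `|dA s|.
by clear; move=> p1 p2 p3 p4 p5; lra.
Qed.

Lemma weight_decay (s : R) (u : 'cV[R]_d) : 0 <= s ->
  dot (A s *m u) u <= expR (- C_A * s) * dot (A 0 *m u) u.
Proof.
move=> s0; have [Ad _] := hA.
have Aud (t : R) : 0 <= t -> is_derive_halfline (fun s => A s *m u) t (dA t *m u).
  move=> t0; apply/halfline_epsP => ep ep0.
  have k1 : 0 < d%:R * `|u| + 1 by rewrite ltr_pwDr// mulr_ge0.
  have [dl dl0 B] := (halfline_epsP _ _ _).1 (Ad t t0) _ (divr_gt0 ep0 k1).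
  exists dl => // y y0 ydl.
  rewrite scalemxAl -!mulmxBl (le_trans (norm_mulmx_le _ _))//.
  have h := B y y0 ydl.
  rewrite -mulrA mulrCA.
  rewrite (@le_trans _ _ (ep / (d%:R * `|u| + 1) * `|y - t| * (d%:R * `|u|)))//.
    by rewrite ler_wpM2r// mulr_ge0.
  rewrite mulrAC ler_wpM2r// -mulrA ler_piMr ?(ltW ep0)//.
  by rewrite mulrC ler_pdivrMr// mul1r lerDl.
have [X [XE Xd]] := halfline_extension Aud.
have := @gronwall_homogeneous _ (fun t => dot (X t) u) (fun t => dot (dA t *m u) u) (- C_A) s s0.
rewrite !XE//; apply.
- move=> t /andP[t0 _]; have := is_derive_dot (Xd t t0) (vder_cst u t).
  by rewrite (dotC (X t)) dot0l addr0.
- by move=> t /andP[t0 _]; rewrite XE//; exact: weight_derivative_le.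
Qed.

Lemma weight_le : exists2 Q, 0 <= Q & forall (s : R) (u : 'cV[R]_d), 0 <= s ->
  dot (A s *m u) u <= Q * expR (- C_A * s) * dot u u.
Proof.
exists (d%:R ^+ 2 * `|A 0|) => [|s u s0]; first by rewrite mulr_ge0// sqr_ge0.
rewrite (le_trans (weight_decay u s0))// mulrC mulrAC ler_wpM2r ?expR_ge0//.
by rewrite (le_trans (ler_norm _))// quad_le.
Qed.

Lemma lambda_min_le (s q : R) : 0 <= s -> 0 <= q ->
  (forall u : 'cV[R]_d, dot (A s *m u) u <= q * dot u u) -> lambda_min (A s) <= q.
Proof.
move=> s0 q0 Aq; have [Asym Apos] := hApos s0.
have eig l : eigenvalue (A s) l -> exists2 u : 'cV[R]_d, 0 < dot u u &
    dot (A s *m u) u = l * dot u u.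
  move=> /eigenvalueP[v vA v0]; exists v^T.
    rewrite lt_neqAle dot_ge0 andbT eq_sym; apply: contra v0 => /eqP/dot_eq0/eqP.
    by rewrite trmx_eq0.
  have -> : A s *m v^T = l *: v^T by rewrite -{1}Asym -trmx_mul vA linearZ.
  by rewrite dotZl.
have lb : has_lbound [set l : R | eigenvalue (A s) l].
  exists 0 => l /= /eig[u u0 uE].
  have un0 : u != 0 by apply: contraTneq u0 => ->; rewrite dot0l ltxx.
  by have := Apos u un0; rewrite uE pmulr_lgt0// => /ltW.
(* In dimension 0 the spectrum is empty and its infimum is [0] by convention, which [q0] covers. *)
rewrite /lambda_min; have [->|/set0P[l le]] := eqVneq [set l : R | eigenvalue (A s) l] set0.
  by rewrite inf0.
apply: (le_trans (ge_inf lb le)); have [u u0 uE] := eig l le.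
by rewrite -(ler_pM2r u0) -uE.
Qed.

Lemma weight_measurable : measurable_halfline A.
Proof.
move=> i j; have [Ad _] := hA.
have Ac : continuous (fun s : R => A (Num.max s 0)).
  move=> s; apply/continuous_epsP => ep ep0.
  have m0 : 0 <= Num.max s 0 by rewrite le_max lexx orbT.
  have k1 : 0 < `|dA (Num.max s 0)| + 1 by rewrite ltr_pwDr.
  have [dl dl0 B] := (halfline_epsP _ _ _).1 (Ad _ m0) 1 ltr01.
  have dl1 : 0 < Num.min dl (ep / (`|dA (Num.max s 0)| + 1)).
    by rewrite lt_min dl0 divr_gt0.
  have dl2 : 0 < Num.min dl (ep / (`|dA (Num.max s 0)| + 1)) / 2 by rewrite divr_gt0.
  have /continuous_epsP/(_ _ dl2) := @continuous_maxr R 0 s.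
  apply: filterS => y h1.
  have q0 : 0 <= Num.max y 0 by rewrite le_max lexx orbT.
  move: (Num.max s 0) (Num.max y 0) m0 q0 k1 B dl1 dl2 h1 => p q m0 q0 k1 B dl1 dl2 h1.
  have h3 : `|q - p| < Num.min dl (ep / (`|dA p| + 1)).
    by rewrite distrC (le_lt_trans h1)// ltr_pdivrMr// ltr_pMr// ltr1n.
  move: h3; rewrite lt_min (ltr_pdivlMr _ _ k1) => /andP[h3 h4].
  have h5 := B q q0 h3; rewrite mul1r in h5.
  rewrite distrC; have -> : A q - A p = (A q - A p - (q - p) *: dA p) + (q - p) *: dA p.
    by rewrite subrK.
  rewrite (le_trans (ler_normD _ _))// (le_trans _ (ltW h4))// mulrDr mulr1 addrC.
  by rewrite lerD// normrZ.
have H : measurable_fun (halfline R) (fun s : R => A (Num.max s 0) i j).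
  exact: (measurable_halfline_continuous Ac).
apply: eq_measurable_fun H => s; rewrite inE halflineP => s0.
by rewrite max_l.
Qed.

End weight_decay.

Section kernel_decay.
Context {R : realType} {d : nat}.

Lemma entry_le_opnorm (B : 'M[R]_d) i j : `|B i j| <= opnorm B.
Proof.
have e1 : dot (delta_mx j 0 : 'cV[R]_d) (delta_mx j 0) = 1.
  rewrite /dot (bigD1 j)//= big1 ?addr0 => [|k kj].
    by rewrite mxE !eqxx mulr1.
  by rewrite mxE (negbTE kj) mul0r.
have ub : has_ubound [set enorm (B *m u) | u in [set u : 'cV[R]_d | enorm u <= 1]].
  exists (d%:R * (d%:R * `|B|) ^+ 2 + 1) => _ [u /= u1 <-].
  have q0 : 0 <= d%:R * (d%:R * `|B|) ^+ 2 by rewrite mulr_ge0// sqr_ge0.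
  have un : `|u| <= 1 := le_trans (norm_le_enorm u) u1.
  rewrite enorm_le ?addr_ge0// (le_trans (dot_le_norm2 _))//.
  apply: (@le_trans _ _ (d%:R * (d%:R * `|B|) ^+ 2)); last first.
    by rewrite sqrrD1; have := sqr_ge0 (d%:R * (d%:R * `|B|) ^+ 2); lra.
  rewrite ler_wpM2l// lerXn2r ?nnegrE ?mulr_ge0// (le_trans (norm_mulmx_le _ _))//.
  by rewrite ler_piMr// mulr_ge0.
have : `|(B *m (delta_mx j 0 : 'cV[R]_d)) i 0| <= opnorm B.
  rewrite (le_trans (coord_le_norm _ _ _))// (le_trans (norm_le_enorm _))//.
  apply: (ub_le_sup ub); exists (delta_mx j 0) => //=.
  by rewrite enorm_le// e1 expr1n.
by rewrite -colE mxE.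
Qed.

Lemma kernel_exp_bounded (A dA M : R -> 'M[R]_d) (C_A D_M : R) :
  C1_halfline A dA -> (forall s : R, 0 <= s -> sym_posdef (A s)) -> 0 < C_A ->
  {ae lebesgue_measure, forall s : R, 0 < s ->
    forall u : 'cV[R]_d, dot (dA s *m u) u <= - C_A * dot (A s *m u) u} ->
  measurable_halfline M ->
  (forall s : R, 0 <= s -> opnorm (M s) <= D_M ^+ 2 * lambda_min (A s)) ->
  exists C, exp_bounded M C C_A.
Proof.
move=> hA hApos hC_A hAd mM hM.
have [Q Q0 HQ] := weight_le hA hC_A hAd.
exists (D_M ^+ 2 * Q); split=> // s s0.
have Qe0 : 0 <= Q * expR (- C_A * s) by rewrite mulr_ge0// expR_ge0.
apply: norm_le_coord => [|i j].
  by rewrite -mulrA mulr_ge0// sqr_ge0.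
rewrite (le_trans (entry_le_opnorm _ _ _))// (le_trans (hM s s0))// -mulrA.
rewrite ler_wpM2l ?sqr_ge0//; apply: (lambda_min_le hApos s0 Qe0) => u.
exact: HQ.
Qed.

End kernel_decay.

(** * Persistence of bounded solutions and of their limits *)

Section forced_saddle.
Context {R : realType} {d : nat}.
Implicit Types (y g z : R -> 'cV[R]_d).

Definition eventually_le y (m : R) := exists T : R, forall t : R, T <= t -> `|y t| <= m.

Lemma decay_eventually_le (C b m c : R) z : 0 < C -> 0 < b -> 0 < m ->
  (forall t : R, 0 <= t -> dot (z t) (z t) <= C * expR (- b * t) * c) ->
  eventually_le z m.
Proof.
move=> C0 b0 m0 zb; have c0 : 0 <= c.
  have := le_trans (dot_ge0 _) (zb 0 (lexx 0)).
  by rewrite mulr0 expR0 mulr1 pmulr_rge0.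
have m20 : 0 < m ^+ 2 by rewrite exprn_gt0.
pose q := C * c / m ^+ 2; have q0 : 0 <= q by rewrite divr_ge0 ?mulr_ge0// ltW.
exists (q / b) => t tq; have t0 : 0 <= t by rewrite (le_trans _ tq)// divr_ge0// ltW.
have qe : q <= expR (b * t).
  rewrite (le_trans _ (expR_ge1Dx _))//; move: tq; rewrite ler_pdivrMr// mulrC => h.
  by rewrite (le_trans h)// lerDr.
have e0 : 0 < expR (b * t) by exact: expR_gt0.
have : dot (z t) (z t) <= m ^+ 2.
  rewrite (le_trans (zb t t0))// mulNr expRN mulrAC ler_pdivrMr//.
  by move: qe; rewrite /q ler_pdivrMr// [X in _ <= X -> _]mulrC.
move=> /(le_trans (norm2_le_dot _)).
by rewrite ler_pXn2r ?nnegrE ?(ltW m0).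
Qed.

(** The forcing frozen before [T] is small on the whole line and has a solution [u] of size at most
    [m / 4]. After [T] the difference [y - u] is a bounded solution of the homogeneous equation,
    hence decays below [m / 4] as well. *)
Lemma eventually_half (H : 'M[R]_d) K th y g B m : saddle H -> 0 < K ->
  bsolvable (fun=> H) K -> K * th <= 4^-1 -> continuous g -> 0 < m ->
  (forall t : R, vder y t (H *m y t + g t)) -> (forall t, `|y t| <= B) ->
  eventually_le g (th * m) -> eventually_le y (m / 2).
Proof.
move=> Hs K0 HK Kth gc m0 yd yB [T gT].
have [||u [ud ub]] := HK (fun t => g (Num.max t T)) (th * m).
- move=> t; apply: (@continuous_comp _ _ _ (fun t : R => Num.max t T) g); last exact: gc.
  exact: continuous_maxr.
- by move=> t; apply: gT; rewrite le_max lexx orbT.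
have um t : `|u t| <= m / 4.
  by rewrite (le_trans (ub t))// mulrA mulrC ler_wpM2l// ltW.
pose z t := y (t + T) - u (t + T).
have [kap [C [b [kap0 C0 b0 D]]]] := saddle_bounded_decay Hs.
have zd (t : R) : 0 <= t -> vder z t (H *m z t + 0).
  move=> t0; have tT : T <= t + T by rewrite lerDr.
  have := vderB (vder_shift (yd (t + T))) (vder_shift (ud (t + T))).
  by rewrite (max_l tT) opprD addrACA subrr /z mulmxBr.
have [||T1 zT1] := @decay_eventually_le C b (m / 4) (dot (z 0) (z 0)) z C0 b0.
- by rewrite divr_gt0.
- apply: (D z (fun=> 0) (B + m / 4) zd) => t t0.
    by rewrite dot0l mulr_ge0 ?dot_ge0// ltW.
  by rewrite (le_trans (ler_normB _ _))// lerD.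
exists (T1 + T) => t tT.
have -> : y t = z (t - T) + u t by rewrite /z !subrK.
rewrite (le_trans (ler_normD _ _))//.
have h1 : `|z (t - T)| <= m / 4 by apply: zT1; rewrite lerBrDr.
have -> : m / 2 = m / 4 + m / 4 by field.
by rewrite lerD.
Qed.

Lemma forced_saddle_tends_to0 (H : 'M[R]_d) K th y g B : saddle H -> 0 < K ->
  bsolvable (fun=> H) K -> K * th <= 4^-1 -> continuous g ->
  (forall t : R, vder y t (H *m y t + g t)) -> (forall t, `|y t| <= B) ->
  (forall m, 0 < m -> eventually_le y m -> eventually_le g (th * m)) ->
  tends_to y 0.
Proof.
move=> Hs K0 HK Kth gc yd yB yg eps eps0.
have B0 : 0 <= B := le_trans (normr_ge0 _) (yB 0).
have B1 : 0 < B + 1 by rewrite ltr_pwDr.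
have ev n : eventually_le y ((B + 1) / 2 ^+ n).
  elim: n => [|n IH].
    by exists 0 => t _; rewrite expr0 divr1 (le_trans (yB t))// lerDl.
  have m0 : 0 < (B + 1) / 2 ^+ n by rewrite divr_gt0// exprn_gt0.
  have := eventually_half Hs K0 HK Kth gc m0 yd yB (yg _ m0 IH).
  by rewrite exprSr invfM mulrA.
have [n nP] : exists n : nat, (B + 1) / 2 ^+ n <= eps.
  apply: contrapT => /forallNP nP; suff : eps <= 0 by rewrite leNgt eps0.
  by apply: (@le_add_geometric _ _ _ (B + 1)) => n; rewrite add0r ltW// ltNge; apply/negP.
have [T TP] := ev n; exists (Num.max T 0); first by rewrite le_max lexx orbT.
by move=> t; rewrite ge_max => /andP[Tt _]; rewrite subr0 (le_trans (TP t Tt)).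
Qed.

End forced_saddle.

(** * A bounded solution of the perturbed equation near a connection *)

Section nearby_solution.
Context {R : realType} {d : nat}.
Variables (M : R -> 'M[R]_d) (C a : R).
Hypothesis a0 : 0 < a.
Hypothesis MC : exp_bounded M C a.
Variables (r L : R) (Phi : 'cV[R]_d -> R) (phi : 'cV[R]_d -> 'cV[R]_d)
  (J : 'cV[R]_d -> 'M[R]_d).
Hypothesis hdata : gradient_data r L Phi phi J.
Hypothesis phic : forall x : 'cV[R]_d, continuous_at x phi.
Hypothesis Jc : forall x : 'cV[R]_d, continuous_at x J.
Implicit Types (x y z : R -> 'cV[R]_d) (e p : 'cV[R]_d).

Local Notation kM := (@memory_norm R d C a).
Let kM0 : 0 <= kM. Proof. exact: memory_norm_ge0 MC. Qed.
Let L0 : 0 < L. Proof. by have [] := hdata. Qed.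

(** For [y = x - x0], the remainder [N] of the linearization along [x0] has Lipschitz constant
    [L * rho + eps * kM] on the ball of radius [rho], and [N] at [0] is the memory of [x0], of size
    at most [eps * kM * r]. The two numerical hypotheses are those of the iteration. *)
Lemma nearby_solution x0 (K rho eps : R) :
  (forall t : R, vder x0 t (phi (x0 t))) -> (forall t, `|x0 t| <= r - rho) ->
  bsolvable (fun t => J (x0 t)) K -> 0 < K -> 0 < rho -> 0 <= eps ->
  K * (L * rho + eps * kM) <= 2^-1 -> 2 * K * (eps * kM * r) <= rho ->
  exists x, [/\ continuous x, forall t : R, vder x t (phi (x t) + eps *: memory M x t)
    & forall t, `|x t - x0 t| <= rho].
Proof.
move=> xd xr HK K0 rho0 eps0 Kth Km.
have xc : continuous x0 by move=> t; exact: vder_cts (xd t).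
have Ac : continuous (fun t => J (x0 t)).
  by move=> t; apply: (@continuous_comp _ _ _ x0 J); [exact: xc|exact: Jc].
pose N y t := phi (x0 t + y t) - phi (x0 t) - J (x0 t) *m y t
  + eps *: memory M (fun s => x0 s + y s) t.
have addKB (u v w : 'cV[R]_d) : u + v - (u + w) = v - w.
  by rewrite opprD addrACA subrr add0r.
have x0r t : `|x0 t| <= r by rewrite (le_trans (xr t))// gerBl ltW.
have xyr y t : `|y t| <= rho -> `|x0 t + y t| <= r.
  by move=> yt; rewrite (le_trans (ler_normD _ _))// -lerBrDr (le_trans (xr t))// lerD2l lerN2.
have sumc y : continuous y -> continuous (fun t => x0 t + y t).
  by move=> yc; exact: continuous_add.
have th0 : 0 <= L * rho + eps * kM by rewrite addr_ge0// mulr_ge0// ltW.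
have [|||y [yc yd yb]] := @bounded_perturbation _ _ _ K rho _ (eps * kM * r) N
    Ac (ltW K0) th0 HK _ _ _ Kth Km.
- move=> y yc yb; apply: continuous_add.
    apply: continuous_sub; last by apply: continuous_product.
    apply: continuous_sub => t.
      apply: (@continuous_comp _ _ _ (fun t => x0 t + y t) phi); last exact: phic.
      exact: sumc.
    by apply: (@continuous_comp _ _ _ x0 phi); [exact: xc|exact: phic].
  move=> t; apply: (cvgZ (cvg_cst _)); apply: (memory_continuous a0 MC (sumc _ yc)).
  by move=> s; exact: xyr.
- move=> y z c yc zc yb zb yzc t.
  have -> : N y t - N z t =
      (phi (x0 t + y t) - phi (x0 t + z t) - J (x0 t) *m ((x0 t + y t) - (x0 t + z t)))
      + eps *: (memory M (fun s => x0 s + y s) t - memory M (fun s => x0 s + z s) t).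
    rewrite /N addKB scalerBr mulmxBr.
    move: (phi _) (phi _) (phi _) (_ *m _) (_ *m _) (_ *: _) (_ *: _).
    by move=> p1 p2 p3 p4 p5 p6 p7; apply/matrixP => i j; rewrite !mxE; ring.
  rewrite mulrDl (le_trans (ler_normD _ _))// lerD//.
    have [_ _ _ _ H] := hdata.
    have := H (x0 t + z t) (x0 t + y t) (x0 t) rho (xyr _ _ (zb t)) (xyr _ _ (yb t)) (x0r t).
    rewrite ![x0 t + _ - x0 t]addrC !addKr => /(_ (zb t) (yb t)) h.
    by rewrite (le_trans h)// addKB ler_wpM2l// mulr_ge0// ltW.
  rewrite normrZ (ger0_norm eps0) -mulrA ler_wpM2l//.
  rewrite (memoryB a0 MC t (sumc _ yc) (sumc _ zc) (fun s => xyr _ s (yb s)) (fun s => xyr _ s (zb s))).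
  apply: (memory_bound a0 MC) => [|s]; last by rewrite addKB.
  by apply: continuous_sub; exact: sumc.
- move=> t; rewrite /N addr0 subrr mulmx0 subr0 add0r normrZ (ger0_norm eps0) -mulrA.
  rewrite ler_wpM2l//; apply: (memory_bound a0 MC) => [|s]; last by rewrite addr0.
  by apply: sumc => s; exact: continuous_cst.
exists (fun t => x0 t + y t); split=> [|t|t].
- exact: sumc.
- apply: vder_eq (vderD (xd t) (yd t)) _; rewrite /N.
  move: (phi _) (phi _) (_ *m _) (_ *: _).
  by move=> p1 p2 p3 p4; apply/matrixP => i j; rewrite !mxE; ring.
- by rewrite addrC addKr (le_trans (yb t)).
Qed.

End nearby_solution.

(** * Convergence of the perturbed solution to the perturbed equilibria *)

Section convergence.
Context {R : realType} {d : nat}.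
Variables (M : R -> 'M[R]_d) (C a : R).
Hypothesis a0 : 0 < a.
Hypothesis MC : exp_bounded M C a.
Variables (r L : R) (Phi : 'cV[R]_d -> R) (phi : 'cV[R]_d -> 'cV[R]_d)
  (J : 'cV[R]_d -> 'M[R]_d).
Hypothesis hdata : gradient_data r L Phi phi J.
Hypothesis phic : forall x : 'cV[R]_d, continuous_at x phi.
Hypothesis Jc : forall x : 'cV[R]_d, continuous_at x J.

Local Notation kM := (@memory_norm R d C a).
Let kM0 : 0 <= kM. Proof. exact: memory_norm_ge0 MC. Qed.
Let L0 : 0 < L. Proof. by have [] := hdata. Qed.

Section near_rest_point.
Variables (x : R -> 'cV[R]_d) (e p : 'cV[R]_d) (eps c K : R).
Hypothesis xc : continuous x.
Hypothesis xr : forall t : R, `|x t| <= r.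
Hypothesis xd : forall t : R, vder x t (phi (x t) + eps *: memory M x t).
Hypothesis er : `|e| <= r.
Hypothesis pr : `|p| <= r.
Hypothesis pe : `|p - e| <= c.
Hypothesis eps0 : 0 <= eps.
Hypothesis p0 : phi p + eps *: (int_halfline M *m p) = 0.

Let y t := x t - p.
(** The linear part is taken at [e] rather than at [p], so that the saddle and its constants do not
    depend on [eps]; the shift costs only [L * c]. *)
Let g t := phi (x t) - phi p - J e *m y t + eps *: memory M y t.

Let c0 : 0 <= c. Proof. exact: le_trans (normr_ge0 _) pe. Qed.

Let yc : continuous y.
Proof. by apply: continuous_sub => // t; exact: cvg_cst. Qed.

Let yb t : `|y t| <= r + r.
Proof. by rewrite (le_trans (ler_normB _ _))// lerD. Qed.

Let gc : continuous g.
Proof.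
apply: continuous_add.
  apply: continuous_sub; last by apply: continuous_product => // t; exact: cvg_cst.
  apply: continuous_sub => t; last exact: cvg_cst.
  by apply: (@continuous_comp _ _ _ x phi); [exact: xc|exact: phic].
by move=> t; apply: (cvgZ (cvg_cst _)); apply: (memory_continuous a0 MC yc yb).
Qed.

Let yd (t : R) : vder y t (J e *m y t + g t).
Proof.
apply: vder_eq (vderB (xd t) (vder_cst p t)) _.
have -> : memory M x t = memory M y t + int_halfline M *m p.
  have pb (s : R) : `|p| <= r by [].
  rewrite -(memory_cst a0 MC p t) -(memoryB a0 MC t xc _ xr pb) ?subrK//.
  by move=> s; exact: cvg_cst.
rewrite scalerDr /g.
move: p0 (phi (x t)) (J e *m y t) (eps *: memory M y t) => /eqP; rewrite addr_eq0 => /eqP ->.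
move: (eps *: _) => p1 p2 p3 p4.
by apply/matrixP => i j; rewrite !mxE; ring.
Qed.

Let g_le m t : `|x t - e| <= c -> `|y t| <= m -> `|memory M y t| <= 4 * kM * m ->
  `|g t| <= (L * c + eps * (4 * kM)) * m.
Proof.
move=> xe ym mm; rewrite mulrDl (le_trans (ler_normD _ _))// lerD//.
  have [_ _ _ _ H] := hdata; have h := H p (x t) e c pr (xr t) er pe xe.
  by rewrite (le_trans h)// ler_wpM2l// mulr_ge0// ltW.
by rewrite normrZ (ger0_norm eps0) -mulrA ler_wpM2l.
Qed.

Lemma tends_to_forward : saddle (J e) -> 0 < K -> bsolvable (fun=> J e) K ->
  K * (L * c + eps * (4 * kM)) <= 4^-1 ->
  (exists T : R, forall t : R, T <= t -> `|x t - e| <= c) -> tends_to x p.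
Proof.
move=> Js K0 HK Kth [T1 xT1].
suff H : tends_to y 0.
  by move=> ep ep0; have [T T0 TP] := H ep ep0; exists T => // t /TP; rewrite subr0.
apply: (forced_saddle_tends_to0 Js K0 HK Kth gc yd yb) => m m0 yev.
have [T2 mT2] := memory_tail a0 MC yc yb m0 yev; have [T3 yT3] := yev.
exists (Num.max T1 (Num.max T2 T3)) => t; rewrite !ge_max => /and3P[tT1 tT2 tT3].
by apply: g_le; [exact: xT1|exact: yT3|exact: mT2].
Qed.

(** Reversed time changes the saddle to [- J e], while the memory term now looks towards the end
    that is being approached, which is the case of [memory_past]. *)
Lemma tends_to_backward : saddle (J e) -> 0 < K -> bsolvable (fun=> - J e) K ->
  K * (L * c + eps * (4 * kM)) <= 4^-1 ->
  (exists T : R, forall t : R, T <= t -> `|x (- t) - e| <= c) ->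
  tends_to (fun t => x (- t)) p.
Proof.
move=> Js K0 HK Kth [T1 xT1].
suff H : tends_to (fun t => y (- t)) 0.
  by move=> ep ep0; have [T T0 TP] := H ep ep0; exists T => // t /TP; rewrite subr0.
have gNc : continuous (fun t => - g (- t)).
  move=> t; apply: cvgN; apply: (@continuous_comp _ _ _ -%R g); last exact: gc.
  exact: opp_continuous.
have yNd (t : R) : vder (fun t => y (- t)) t (- J e *m y (- t) + - g (- t)).
  by rewrite mulNmx -opprD; apply: vder_opp; exact: yd.
apply: (forced_saddle_tends_to0 (saddleN Js) K0 HK Kth gNc yNd (fun t => yb (- t))) => m m0.
move=> [T3 yT3]; have yev : exists T : R, forall t : R, t <= T -> `|y t| <= m.
  by exists (- T3) => t tT; rewrite -[t]opprK; apply: yT3; rewrite lerNr.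
have [T2 mT2] := memory_past a0 MC yc yb yev.
exists (Num.max T1 (Num.max (- T2) T3)) => t; rewrite !ge_max => /and3P[tT1 tT2 tT3].
rewrite normrN; apply: g_le; [exact: xT1|exact: yT3|].
rewrite (le_trans (mT2 _ _)) 1?lerNl//.
by have := mulr_ge0 kM0 (ltW m0); lra.
Qed.

End near_rest_point.

Lemma perturbed_connection (x0 : R -> 'cV[R]_d) ei ej K :
  (forall t : R, vder x0 t (phi (x0 t))) -> (forall t, `|x0 t| <= r - 1) ->
  tends_to (fun t => x0 (- t)) ei -> tends_to x0 ej ->
  `|ei| <= r - 1 -> `|ej| <= r - 1 -> saddle (J ei) -> saddle (J ej) ->
  0 < K -> bsolvable (fun t => J (x0 t)) K ->
  exists2 rho, 0 < rho & exists2 eps1, 0 < eps1 &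
  forall eps pi pj, 0 <= eps <= eps1 -> `|pi - ei| <= rho -> `|pj - ej| <= rho ->
    phi pi + eps *: (int_halfline M *m pi) = 0 ->
    phi pj + eps *: (int_halfline M *m pj) = 0 ->
  exists x, [/\ continuous x, forall t, `|x t| <= r,
    forall t : R, vder x t (phi (x t) + eps *: memory M x t),
    tends_to (fun t => x (- t)) pi & tends_to x pj].
Proof.
move=> x0d x0r x0i x0j eir ejr Ji Jj K0 HK.
have [Ki Ki0 HKi] := saddle_bsolvable (saddleN Ji).
have [Kj Kj0 HKj] := saddle_bsolvable Jj.
have r1 : 0 <= r - 1 := le_trans (normr_ge0 _) eir.
pose k := K + Ki + Kj; have k0 : 0 < k by rewrite !addr_gt0.
have kL0 : 0 < 32 * k * L by rewrite !mulr_gt0.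
(* [k] serves the whole line and both ends at once. Near an end [x] is within [2 * rho] of the
   equilibrium, and this choice keeps [k * (L * (2 * rho))] below one sixteenth. *)
pose rho := Num.min 1 (32 * k * L)^-1.
have rho0 : 0 < rho by rewrite lt_min ltr01 invr_gt0.
have rho1 : rho <= 1 by rewrite ge_min lexx.
have kLrho : 32 * k * L * rho <= 1.
  rewrite (@le_trans _ _ (32 * k * L * (32 * k * L)^-1))//; last by rewrite divff// gt_eqF.
  by rewrite ler_wpM2l ?(ltW kL0)// ge_min lexx orbT.
(* With [eps <= rho / q], [rho <= 1] and [r >= 1] the memory contributes at most one sixteenth to
   the Lipschitz conditions, and the initial error of the iteration fits in [rho]. *)
pose q := 64 * k * (kM + 1) * r.
have rpos : 1 <= r by rewrite -subr_ge0.
have r0 : 0 < r := lt_le_trans ltr01 rpos.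
have q0 : 0 < q by rewrite !mulr_gt0// ltr_pwDr.
exists rho => //; exists (rho / q) => [|eps pi pj]; first by rewrite divr_gt0.
move=> /andP[eps0 epsq] pie pje pi0 pj0.
have kMeps : 64 * (k * (eps * kM)) * r <= rho.
  move: epsq; rewrite ler_pdivlMr// => /(le_trans _); apply; rewrite /q.
  have : 0 <= eps * k * r by rewrite !mulr_ge0// ltW.
  by move: (rho) => ?; lra.
have s0 : 0 <= k * (eps * kM).
  apply: mulr_ge0; first exact: ltW.
  exact: mulr_ge0.
have sr : k * (eps * kM) <= k * (eps * kM) * r by rewrite ler_peMr.
have le_k u v : 0 < u -> u <= k -> 0 <= v -> u * v <= k * v.
  by move=> u0 uk v0; rewrite ler_wpM2r.
have Kk : K <= k by rewrite /k -addrA lerDl addr_ge0// ltW.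
have Kik : Ki <= k by rewrite /k; lra.
have Kjk : Kj <= k by rewrite /k; lra.
have Lrho0 : 0 <= L * rho by rewrite mulr_ge0// ltW.
have em0 : 0 <= eps * kM by rewrite mulr_ge0.
have th0 : 0 <= L * (2 * rho) + eps * (4 * kM) by lra.
have th_le u : 0 < u -> u <= k -> u * (L * (2 * rho) + eps * (4 * kM)) <= 4^-1.
  move=> u0 uk; apply: (le_trans (le_k _ _ u0 uk th0)).
  by move: kLrho kMeps sr rho1; move: (rho) (k) => ? ?; lra.
have x0r' t : `|x0 t| <= r - rho by rewrite (le_trans (x0r t))// lerB.
have [||x [xc xd xx0]] := @nearby_solution _ _ _ _ _ a0 MC _ _ _ _ _ hdata phic Jc
    x0 K rho eps x0d x0r' HK K0 rho0 eps0.
- have v0 : 0 <= L * rho + eps * kM by lra.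
  apply: (le_trans (le_k _ _ K0 Kk v0)).
  by move: kLrho kMeps sr rho1; move: (rho) (k) => ? ?; lra.
- rewrite -mulrA; have v0 : 0 <= eps * kM * r by rewrite mulr_ge0// ltW.
  have := le_k _ _ K0 Kk v0.
  by move: kMeps rho0 s0 sr; move: (rho) (k) => ? ?; lra.
have xr t : `|x t| <= r.
  rewrite -[x t](subrK (x0 t)) (le_trans (ler_normD _ _))//.
  by have := xx0 t; have := x0r' t; lra.
have pr p e : `|p - e| <= rho -> `|e| <= r - 1 -> `|p| <= r.
  move=> pe er; rewrite -[p](subrK e) (le_trans (ler_normD _ _))//; lra.
have er e : `|e| <= r - 1 -> `|e| <= r by move=> h; lra.
have rho2 u : u <= rho -> u <= 2 * rho by move=> h; lra.
have xnear (s t : R) e : `|x0 t - e| <= rho -> `|x t - e| <= 2 * rho.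
  move=> h; rewrite -[x t](subrK (x0 t)) -addrA (le_trans (ler_normD _ _))//.
  by have := xx0 t; lra.
exists x; split=> //.
- have [T _ TP] := x0i _ rho0.
  apply: (@tends_to_backward x ei pi eps (2 * rho) Ki) => //.
  + exact: er.
  + exact: pr pie eir.
  + exact: rho2.
  + exact: th_le.
  + by exists T => t /TP; exact: xnear.
- have [T _ TP] := x0j _ rho0.
  apply: (@tends_to_forward x ej pj eps (2 * rho) Kj) => //.
  + exact: er.
  + exact: pr pje ejr.
  + exact: rho2.
  + exact: th_le.
  + by exists T => t /TP; exact: xnear.
Qed.

End convergence.

(** * Equilibria of the semiflow *)

Section rest_states.
Context {R : realType} {d : nat}.
Notation mu := (@lebesgue_measure R).
#[local] Hint Extern 0 (measurable (halfline _)) => exact: measurable_halfline_set : core.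
Variables (A M : R -> 'M[R]_d) (phi : 'cV[R]_d -> 'cV[R]_d) (eps : R).
Hypothesis mM : measurable_halfline M.
Implicit Types (p : state R d) (e : 'cV[R]_d).

Lemma rest_state_in_L2A : in_L2A A (fun=> 0 : 'cV[R]_d).
Proof.
split=> [i j|]; first exact: measurable_cst.
rewrite (eq_integral (cst 0%E)) ?integral0// => s _.
by rewrite mulmx0 dot0l.
Qed.

Lemma rest_state_equilibrium e : phi e + eps *: (int_halfline M *m e) = 0 ->
  semiflow_equilibrium A M phi eps (rest_state e).
Proof.
move=> e0; split=> [|t t0]; first exact: rest_state_in_L2A.
have h0 (r s : R) : history (rest_state e).1 (fun=> e) r s = 0.
  by rewrite /history; case: ifP => _; rewrite ?addr0 subrr.
exists (fun=> e), (fun=> 0); split=> //.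
- split=> [r r0|]; last by move=> r; exact: cvg_cst.
  by apply: vder_halfline; exact: vder_cst.
- move=> r r0; rewrite /= e0 add0r.
  rewrite (_ : (fun s => _) = fun=> 0); last by apply/funext => s; rewrite h0 mulmx0.
  have m0 : measurable_halfline (fun=> 0 : 'cV[R]_d) by move=> i j; exact: measurable_cst.
  rewrite (int_halfline_ae0 m0) ?scaler0//; exact: aeW.
- by apply: aeW => s _; rewrite h0.
Qed.

Lemma semiflow_solution (t : R) p q : 0 <= t -> semiflow M phi eps t p q ->
  exists x dx : R -> 'cV[R]_d,
  [/\ forall r : R, 0 <= r -> vder x r (dx r), x 0 = p.2, q.2 = x t,
      dx 0 = phi p.2 + eps *: (int_halfline M *m p.2) +
        eps *: int_halfline (fun s => M s *m history p.1 x 0 s)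
    & {ae mu, forall s : R, 0 <= s <= t -> q.1 s = x (t - s) - x t}].
Proof.
move=> t0 [x [dx [[xd _] x0 dxE qh qt]]]; have [X [XE Xd]] := halfline_extension xd.
exists X, dx; split=> //.
- by rewrite XE.
- by rewrite XE.
- rewrite (dxE 0 (lexx 0)) x0.
  have -> : (fun s => M s *m history p.1 X 0 s) = (fun s => M s *m history p.1 x 0 s).
    apply/funext => s; rewrite /history (XE 0 (lexx 0)); case: ifPn => s0 //.
    by rewrite (XE (0 - s))// sub0r oppr_ge0.
  by [].
- apply: (@filterS _ _ (ae_filter_ringOfSetsType mu) _ _ _ qh) => s H /andP[s0 st].
  by rewrite H// /history st !XE// subr_ge0.
Qed.

(* The solutions starting at an equilibrium [p] and stopped at times [t <= T] are
   both, up to a shift, time reversals of [p.1]; comparing them at [s = t] gives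
   [x_T (T - t) = p.2]. *)
Lemma equilibrium_solution_cst p (T : R) x : 0 <= T ->
  (forall r : R, 0 <= r -> {for r, continuous x}) -> x 0 = p.2 -> x T = p.2 ->
  {ae mu, forall s : R, 0 <= s <= T -> p.1 s = x (T - s) - x T} ->
  (forall t : R, 0 <= t -> semiflow M phi eps t p p) ->
  forall r : R, 0 <= r <= T -> x r = p.2.
Proof.
move=> T0 xc x0 xT px sp r /andP[r0]; rewrite le_eqVlt => /predU1P[->//|rT].
pose t := T - r; have t0 : 0 < t by rewrite subr_gt0.
have [y [dy [yd y0 yt _ py]]] := semiflow_solution (ltW t0) (sp t (ltW t0)).
apply/eqP; rewrite -subr_eq0 -normr_le0; apply/ler_addgt0Pr => ep ep0; rewrite add0r.
have ep20 : 0 < ep / 2 by rewrite divr_gt0.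
have /continuous_epsP/(_ _ ep20)/nbhs_ballP[d1 /= d10 B1] := xc r r0.
have /continuous_epsP/(_ _ ep20)/nbhs_ballP[d2 /= d20 B2] := vder_cts (yd 0 (lexx 0)).
pose dl := Num.min t (Num.min d1 d2).
have dl0 : 0 < dl by rewrite !lt_min t0 d10.
(* Both identities for [p.1] hold only almost everywhere, so they are compared at some [s] slightly
   below [t], and continuity of [x] and [y] absorbs the difference. *)
have [|s /andP[ts st] [H1 H2]] := @ae_exists R _ (t - dl) t _
    (@filterI _ _ (ae_filter_ringOfSetsType mu) _ _ px py); first by rewrite gtrBl.
have : t - s < dl by lra.
rewrite !lt_min => /and3P[st1 st2 st3].
have s0 : 0 <= s by lra.
have sT : s <= T by rewrite /t in st; lra.
have E1 : `|x r - x (T - s)| <= ep / 2.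
  apply: B1; rewrite -ball_normE/= distrC ger0_norm; rewrite /t in st2 st *; lra.
have E2 : `|y 0 - y (t - s)| <= ep / 2.
  by apply: B2; rewrite -ball_normE/= distrC subr0 ger0_norm// subr_ge0 ltW.
have E : x (T - s) = y (t - s).
  move: H1 H2; rewrite s0 sT (ltW st) => /(_ isT) -> /(_ isT).
  by rewrite xT -yt => /addIr.
rewrite (_ : x r - p.2 = (x r - x (T - s)) - (y 0 - y (t - s))); last first.
  by rewrite y0 E opprB addrA subrK.
by rewrite (le_trans (ler_normB _ _))// (splitr ep) lerD.
Qed.

(** Solutions from an equilibrium are constant on every [[0, T]], so the history vanishes on each of
    these intervals. The memory integral at time [0] is then zero, and the vanishing derivative of
    the constant solution is the equation. *)
Lemma semiflow_equilibriumP p : semiflow_equilibrium A M phi eps p ->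
  {ae mu, forall s : R, 0 <= s -> p.1 s = 0} /\
  phi p.2 + eps *: (int_halfline M *m p.2) = 0.
Proof.
move=> [[mp _] sp].
have sol (T : R) : 0 <= T -> exists x dx : R -> 'cV[R]_d,
    [/\ forall r : R, 0 <= r -> vder x r (dx r), forall r, 0 <= r <= T -> x r = p.2,
        dx 0 = phi p.2 + eps *: (int_halfline M *m p.2) +
          eps *: int_halfline (fun s => M s *m history p.1 x 0 s)
      & {ae mu, forall s : R, 0 <= s <= T -> p.1 s = 0}].
  move=> T0; have [x [dx [xd x0 xT dx0 px]]] := semiflow_solution T0 (sp T T0).
  have xp : forall r, 0 <= r <= T -> x r = p.2.
    apply: (equilibrium_solution_cst T0 _ x0 (esym xT) px sp) => r r0.
    exact: vder_cts (xd r r0).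
  exists x, dx; split=> //.
  apply: (@filterS _ _ (ae_filter_ringOfSetsType mu) _ _ _ px) => s H sT.
  have /andP[s0 sT'] := sT; rewrite H// !xp ?subrr ?lexx ?T0//.
  by rewrite subr_ge0 sT' gerBl.
have p10 : {ae mu, forall s : R, 0 <= s -> p.1 s = 0}.
  have /ae_foralln H : forall n : nat, {ae mu, forall s : R, 0 <= s <= n%:R -> p.1 s = 0}.
    by move=> n; have [x [dx [_ _ _]]] := sol n%:R (ler0n _ _).
  apply: (@filterS _ _ (ae_filter_ringOfSetsType mu) _ _ _ H) => s Hs s0.
  apply: (Hs (Num.Def.archi_bound s)); rewrite s0/=.
  by rewrite ltW// archi_boundP.
split=> //; have [x [dx [xd xp dx0 _]]] := sol 1 ler01.
have {}dx0 : dx 0 = phi p.2 + eps *: (int_halfline M *m p.2).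
  have h0 (s : R) : 0 <= s -> history p.1 x 0 s = if s <= 0 then 0 else p.1 s.
    move=> s0; rewrite /history; case: ifPn => sp0.
      by rewrite (_ : s = 0) ?subrr//; apply/eqP; rewrite eq_le sp0.
    by rewrite subr0 addrAC subrr add0r.
  have mh : measurable_halfline (history p.1 x 0).
    move=> i j; have mi : measurable_fun (halfline R) (fun s => if s <= 0 then 0 else p.1 s i j).
      apply: measurable_fun_if => //.
      + by apply: measurable_fun_ler => //; exact: measurable_cst.
      + by apply: measurable_funS (mp i j) => //; exact: subIsetl.
    apply: eq_measurable_fun mi => s; rewrite inE halflineP => s0.
    by rewrite h0//; case: ifP => // _; rewrite mxE.
  have z : {ae mu, forall s : R, 0 <= s -> M s *m history p.1 x 0 s = 0}.
    apply: (@filterS _ _ (ae_filter_ringOfSetsType mu) _ _ _ p10) => s H s0.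
    by rewrite h0// H// if_same mulmx0.
  by rewrite dx0 (int_halfline_ae0 (measurable_halfline_mulmx mM mh) z) scaler0 addr0.
suff : dx 0 = 0 by rewrite dx0.
apply/eqP; rewrite -normr_le0; apply/ler_addgt0Pr => ep ep0; rewrite add0r.
have [dl dl0 B] := (vder_epsP _ _ _).1 (xd 0 (lexx 0)) ep ep0.
pose y := Num.min 1 (dl / 2).
have y0 : 0 < y by rewrite lt_min ltr01 divr_gt0.
have yn : `|y - 0| = y by rewrite subr0 gtr0_norm.
have := B y; rewrite yn subr0 => /(_ _)/wrap[].
  by rewrite gt_min orbC ltr_pdivrMr// ltr_pMr// ltr1n.
rewrite !xp ?lexx ?ler01// ?(ltW y0) ?ge_min ?lexx// subrr sub0r normrN normrZ gtr0_norm//.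
by rewrite mulrC ler_pM2r.
Qed.

End rest_states.

(** * Zeros of the perturbed field near and away from the equilibria *)

Section zeros.
Context {R : realType} {d : nat}.
Implicit Types (e p u v : 'cV[R]_d).

Lemma contraction_fixpoint (T : 'cV[R]_d -> 'cV[R]_d) (rho m : R) : 2 * m <= rho ->
  (forall u v, `|u| <= rho -> `|v| <= rho -> `|T u - T v| <= `|u - v| / 2) ->
  `|T 0| <= m -> exists2 l, `|l| <= 2 * m & T l = l.
Proof.
move=> mrho TL T0; have m0 : 0 <= m := le_trans (normr_ge0 _) T0.
have rho0 : 0 <= rho by rewrite (le_trans _ mrho)// mulr_ge0.
have z : `|0 : 'cV[R]_d| <= rho by rewrite normr0.
have Tm u : `|u| <= 2 * m -> `|T u| <= 2 * m.
  move=> um; rewrite -[T u](subrK (T 0)) (le_trans (ler_normD _ _))//.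
  have := TL u 0 (le_trans um mrho) z; rewrite subr0; lra.
pose w n := iter n T 0.
have wm n : `|w n| <= 2 * m by elim: n => [|n IH]; [rewrite normr0 mulr_ge0|exact: Tm].
have wr n : `|w n| <= rho := le_trans (wm n) mrho.
have wd n : `|w n.+1 - w n| <= m / 2 ^+ n.
  elim: n => [|n IH]; first by rewrite subr0 expr0 divr1.
  rewrite (le_trans (TL _ _ (wr n.+1) (wr n)))// exprSr invfM mulrA.
  by rewrite ler_wpM2r// invr_ge0.
have [l lP] := geometric_limit_col wd.
have lm : `|l| <= 2 * m by have := lP 0%N; rewrite subr0 expr0 divr1.
exists l => //; apply/eqP; rewrite -subr_eq0 -normr_le0.
apply: (@le_add_geometric _ _ _ (2 * m)) => n; rewrite add0r.
rewrite -[T l](subrK (w n.+1)) -addrA (le_trans (ler_normD _ _))//.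
have h1 := TL l (w n) (le_trans lm mrho) (wr n).
have h2 := lP n; have h3 := lP n.+1.
rewrite distrC in h3; rewrite (le_trans (lerD h1 h3))//.
have -> : 2 * m / 2 ^+ n.+1 = 2 * m / 2 ^+ n / 2 by rewrite exprSr invfM mulrA.
by rewrite -mulrDl ler_pdivrMr//; lra.
Qed.

Lemma uniform_small (T : eqType) (s : seq T) (P : T -> R -> Prop) :
  (forall x, x \in s -> exists2 b, 0 < b & forall c, 0 < c <= b -> P x c) ->
  exists2 b, 0 < b & forall x, x \in s -> forall c, 0 < c <= b -> P x c.
Proof.
elim: s => [_|x s IH H]; first by exists 1.
have [|b b0 bP] := IH; first by move=> y ys; apply: H; rewrite inE ys orbT.
have [c c0 cP] := H x (mem_head _ _).
exists (Num.min b c) => [|y]; first by rewrite lt_min b0.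
rewrite inE => /predU1P[->|ys] t /andP[t0]; rewrite le_min => /andP[tb tc].
  by apply: cP; rewrite t0.
by apply: bP => //; rewrite t0.
Qed.

Section continuation.
Variables (r L : R) (Phi : 'cV[R]_d -> R) (phi : 'cV[R]_d -> 'cV[R]_d)
  (J : 'cV[R]_d -> 'M[R]_d) (B : 'M[R]_d).
Hypothesis hdata : gradient_data r L Phi phi J.

(** For [u = p - e] a zero is a fixed point of the simplified Newton map [T], built with the inverse
    [K] of [J e]; it contracts by one half on the ball of radius [2 * r1]. Existence is claimed in
    the ball of radius [r1] and uniqueness in the one of radius [2 * r1], which later makes the
    neighbourhoods of radius [r1] disjoint. *)
Lemma zero_continuation e : phi e = 0 -> `|e| <= r - 1 -> saddle (J e) ->
  exists2 rb, 0 < rb & forall r1, 0 < r1 <= rb ->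
  exists C eps1, [/\ 0 <= C, 0 < eps1 & forall eps, 0 <= eps <= eps1 ->
    (exists p, [/\ `|p - e| <= C * eps, `|p - e| <= r1 & phi p + eps *: (B *m p) = 0]) /\
    forall p p', `|p - e| <= 2 * r1 -> `|p' - e| <= 2 * r1 ->
      phi p + eps *: (B *m p) = 0 -> phi p' + eps *: (B *m p') = 0 -> p = p'].
Proof.
move=> phie er /saddle_inv[K KJ]; have [L0 _ _ _ H] := hdata.
have JK := mulmx1C KJ.
pose k := d%:R * `|K| + 1; have k0 : 0 < k by rewrite ltr_pwDr// mulr_ge0.
have Kk u : `|K *m u| <= k * `|u|.
  by rewrite (le_trans (norm_mulmx_le _ _))// ler_wpM2r// /k lerDl.
pose b := d%:R * `|B| + 1; have b0 : 0 < b by rewrite ltr_pwDr// mulr_ge0.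
have Bb u : `|B *m u| <= b * `|u|.
  by rewrite (le_trans (norm_mulmx_le _ _))// ler_wpM2r// /b lerDl.
have r0 : 1 <= r by have := le_trans (normr_ge0 e) er; rewrite subr_ge0.
have r00 : 0 < r := lt_le_trans ltr01 r0.
have kL0 : 0 < 8 * k * L by rewrite !mulr_gt0.
(* The first term keeps [e + u] in the ball of radius [r], the second makes the nonlinear part
   contribute at most a quarter to the contraction factor. *)
exists (Num.min 2^-1 (8 * k * L)^-1) => [|r1 /andP[r10]].
  by rewrite lt_min !invr_gt0 ltr0n.
rewrite le_min => /andP[r12 r1k].
have kLr : 8 * k * L * r1 <= 1 by move: r1k; rewrite -ler_pdivlMl// mulr1.
have q0 : 0 < 4 * k * b * r by rewrite !mulr_gt0.
have C0 : 0 <= 2 * (k * b * r) by rewrite !mulr_ge0// ltW.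
exists (2 * (k * b * r)), (r1 / (4 * k * b * r)); split=> //; first by rewrite divr_gt0.
move=> eps /andP[eps0]; rewrite ler_pdivlMr// => epsr.
have kb0 : 0 <= k * b * eps by rewrite !mulr_ge0// ltW.
have kbr : k * b * eps <= k * b * eps * r by rewrite ler_peMr.
pose T u := - (K *m (phi (e + u) - J e *m u + eps *: (B *m (e + u)))).
have er' u : `|u| <= 2 * r1 -> `|e + u| <= r.
  by move=> ur; rewrite (le_trans (ler_normD _ _))//; lra.
have er0 : `|e| <= r by lra.
have addKB u v w : u + v - (u + w) = v - w by rewrite opprD addrACA subrr add0r.
have TL u v : `|u| <= 2 * r1 -> `|v| <= 2 * r1 -> `|T u - T v| <= `|u - v| / 2.
  move=> ur vr.
  have -> : T u - T v = - (K *m ((phi (e + u) - phi (e + v) - J e *m ((e + u) - (e + v)))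
      + eps *: (B *m (u - v)))).
    rewrite /T -opprD -mulmxBr addKB -(addKB e u v) [B *m (_ - _)]mulmxBr scalerBr.
    congr (- (K *m _)); rewrite addKB mulmxBr.
    move: (phi _) (phi _) (_ *m _) (_ *m _) (_ *: _) (_ *: _) => p1 p2 p3 p4 p5 p6.
    by apply/matrixP => i j; rewrite !mxE; ring.
  rewrite normrN (le_trans (Kk _))//.
  have h1 := H (e + v) (e + u) e (2 * r1) (er' _ vr) (er' _ ur) er0.
  rewrite ![e + _ - e]addrC !addKr in h1; have {}h1 := h1 vr ur.
  have h2 : `|eps *: (B *m (u - v))| <= eps * (b * `|u - v|).
    by rewrite normrZ ger0_norm// ler_wpM2l.
  rewrite (@le_trans _ _ (k * (L * (2 * r1) * `|u - v| + eps * (b * `|u - v|))))//.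
    rewrite ler_wpM2l ?(ltW k0)// (le_trans (ler_normD _ _))// lerD//.
    by rewrite addKB in h1 *.
  have -> : k * (L * (2 * r1) * `|u - v| + eps * (b * `|u - v|)) =
    (2 * (k * L * r1) + k * b * eps) * `|u - v| by ring.
  rewrite [leRHS]mulrC ler_wpM2r//.
  by move: kLr kbr epsr r12 kb0; move: (k) (b) => ? ?; lra.
have Tfix u : T u = u <-> phi (e + u) + eps *: (B *m (e + u)) = 0.
  split=> [Tu|Gu].
    have : J e *m T u = J e *m u by rewrite Tu.
    rewrite /T mulmxN mulmxA JK mul1mx.
    move: (phi _) (J e *m u) (_ *: _) => p1 p2 p3 /eqP.
    by rewrite addrAC opprD opprK -subr_eq0 addrK oppr_eq0 => /eqP.
  rewrite /T addrAC Gu sub0r mulmxN opprK mulmxA KJ mul1mx //.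
have T0 : `|T 0| <= k * b * r * eps.
  rewrite /T addr0 phie mulmx0 subr0 add0r normrN (le_trans (Kk _))//.
  rewrite -!mulrA ler_wpM2l ?(ltW k0)// normrZ ger0_norm// mulrA [leRHS]mulrC ler_wpM2l//.
  by rewrite (le_trans (Bb _))// ler_wpM2l// ltW.
have Cr : 2 * (k * b * r * eps) <= 2 * r1 by move: epsr r10; move: (k) (b) => ? ?; lra.
split.
  have [l lC Tl] := contraction_fixpoint Cr TL T0.
  exists (e + l); rewrite addrC addKr; split.
  - by rewrite (le_trans lC)// [X in X <= _]mulrA.
  - by rewrite (le_trans lC)//; move: epsr r10; move: (k) (b) => ? ?; lra.
  - exact/Tfix.
move=> p p' pe pe'; rewrite -{1 2}[p](subrK e) -{1 2}[p'](subrK e) ![_ - e + e]addrC.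
move=> /Tfix Tp /Tfix Tp'; have := TL _ _ pe pe'; rewrite Tp Tp' opprB addrA subrK.
move=> h; apply/eqP; rewrite -subr_eq0 -normr_le0; lra.
Qed.

End continuation.

(** Away from its zeros [|phi|] attains a positive minimum on a compact set, so that a small
    perturbation creates no zero there. *)
Lemma zero_separation (phi : 'cV[R]_d -> 'cV[R]_d) (r r1 : R) : continuous phi -> 0 < r1 ->
  exists2 m, 0 < m & forall u, `|u| <= r ->
    (forall e, phi e = 0 -> r1 <= `|u - e|) -> m <= `|phi u|.
Proof.
move=> phic r10.
pose K := [set u : 'cV[R]_d | `|u - 0| <= r] `&` \bigcap_(e in [set e | phi e = 0])
  [set u : 'cV[R]_d | r1 <= `|u - e|].
have Kc : compact K.
  apply: compact_closedI; first exact: closed_ball_compact.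
  apply: closed_bigI => e _.
  apply: (@preimage_closed _ _ (fun u : 'cV[R]_d => `|u - e|) [set t | r1 <= t]); last exact: closed_ge.
  move=> u _; apply/continuous_epsP => ep ep0.
  apply/(nbhs_ballP u); exists ep => //= v uv.
  rewrite (le_trans (ler_dist_dist _ _))// opprB addrA subrK.
  by move: uv; rewrite -ball_normE => /ltW.
have KP u : `|u| <= r -> (forall e, phi e = 0 -> r1 <= `|u - e|) -> K u.
  by move=> ur ue; split=> /=; [rewrite subr0|move=> e /= /ue].
have [K0|/set0P K0] := eqVneq K set0.
  by exists 1 => // u ur ue; have := KP u ur ue; rewrite K0.
have [|c cK cmin] := @compact_EVT_min _ R (fun u : 'cV[R]_d => `|phi u|) K K0 Kc.
  exact: continuous_subspaceT (continuous_norm phic).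
exists `|phi c| => [|u ur ue]; last by apply: cmin; rewrite inE; exact: KP.
rewrite normr_gt0; apply/eqP => phic0; move: cK; rewrite inE => -[_ /(_ c phic0)/=].
by rewrite subrr normr0 leNgt r10.
Qed.

End zeros.

(** * From solutions on the line to semiflow connections *)

Section lifted_solution.
Context {R : realType} {d : nat}.
Notation mu := (@lebesgue_measure R).
#[local] Hint Extern 0 (measurable (halfline _)) => exact: measurable_halfline_set : core.
Variables (A M : R -> 'M[R]_d) (phi : 'cV[R]_d -> 'cV[R]_d) (eps C a Q : R).
Hypothesis a0 : 0 < a.
Hypothesis MC : exp_bounded M C a.
Hypothesis phic : forall u : 'cV[R]_d, continuous_at u phi.
Hypothesis mA : measurable_halfline A.
Hypothesis Q0 : 0 <= Q.
Hypothesis AQ : forall (s : R) (u : 'cV[R]_d), 0 <= s ->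
  0 <= dot (A s *m u) u <= Q * expR (- a * s) * dot u u.
Variables (x : R -> 'cV[R]_d) (m : R).
Hypothesis xc : continuous x.
Hypothesis xm : forall t, `|x t| <= m.
Hypothesis xd : forall t : R, vder x t (phi (x t) + eps *: memory M x t).
Implicit Types (p q : 'cV[R]_d).

Definition past (tau s : R) : 'cV[R]_d := x (tau - s) - x tau.

Definition lifted (tau : R) : state R d := (past tau, x tau).

Let h (tau s : R) := dot (A s *m past tau s) (past tau s).

Let energy (tau : R) := (\int[mu]_(s in halfline R) h tau s)%R.

Let measurable_past tau : measurable_halfline (past tau).
Proof.
apply: measurable_halflineB; last by move=> i j; exact: measurable_cst.
apply: measurable_halfline_continuous => s.
apply: (@continuous_comp _ _ _ (fun s => tau - s) x); last exact: xc.
by apply: cvgB; [exact: cvg_cst|exact: cvg_id].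
Qed.

Let mh tau : measurable_fun (halfline R) (h tau).
Proof.
by apply: measurable_dot => //; apply: measurable_halfline_mulmx.
Qed.

Let h_le (tau s b : R) : 0 <= s -> `|past tau s| <= b ->
  `|h tau s| <= Q * d%:R * expR (- a * s) * b ^+ 2.
Proof.
move=> s0 pb; have /andP[h0 hQ] := AQ (past tau s) s0.
rewrite ger0_norm// (le_trans hQ)//.
have -> : Q * d%:R * expR (- a * s) * b ^+ 2 = Q * expR (- a * s) * (d%:R * b ^+ 2) by ring.
rewrite ler_wpM2l ?mulr_ge0 ?expR_ge0// (le_trans (dot_le_norm2 _))// ler_wpM2l//.
by rewrite lerXn2r ?nnegrE// (le_trans _ pb).
Qed.

Let past_le tau s : `|past tau s| <= 2 * m.
Proof. by rewrite (le_trans (ler_normB _ _))// mulr2n mulrDl !mul1r lerD. Qed.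

Let c0 : 0 <= Q * d%:R. Proof. exact: mulr_ge0. Qed.

Let h_exp (tau b s : R) : (forall s : R, 0 <= s -> `|past tau s| <= b) -> 0 <= s ->
  `|h tau s| <= Q * d%:R * b ^+ 2 * expR (- a * s).
Proof. by move=> pb s0; rewrite mulrAC; apply: h_le => //; exact: pb. Qed.

Let energy_le (tau b : R) : (forall s : R, 0 <= s -> `|past tau s| <= b) ->
  energy tau <= Q * d%:R * b ^+ 2 / a.
Proof.
move=> pb; have [_ H] := exp_bounded_integral a0 (mh tau) (fun s => h_exp pb).
exact: le_trans (ler_norm _) H.
Qed.

Let energy_ge0 tau : 0 <= energy tau.
Proof. by apply: Rintegral_ge0 => // s; rewrite halflineP => /(AQ (past tau s))/andP[]. Qed.

Let state_distE tau p : state_dist A (lifted tau) (rest_state p) =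
  Num.sqrt (energy tau + dot (x tau - p) (x tau - p)).
Proof.
rewrite /state_dist enorm_sqr.
have -> : (fun s => (lifted tau).1 s - (rest_state p).1 s) = past tau.
  by apply/funext => s; rewrite /= subr0.
by rewrite sqr_sqrtr// energy_ge0.
Qed.

Let sqrt_small (ep : R) : 0 < ep -> exists2 dl : R, 0 < dl & forall tau p,
  energy tau <= ep ^+ 2 / 2 -> `|x tau - p| <= dl ->
  state_dist A (lifted tau) (rest_state p) <= ep.
Proof.
move=> ep0; have e20 : 0 < ep ^+ 2 / 2 by rewrite divr_gt0// exprn_gt0.
have [dl dl0 H] := small_square (ler0n R d) e20.
exists (dl / 2) => [|tau p E xp]; first by rewrite divr_gt0.
rewrite state_distE -[leRHS]ger0_norm ?(ltW ep0)// -sqrtr_sqr ler_wsqrtr//.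
rewrite (splitr (ep ^+ 2)) lerD//.
rewrite (le_trans (dot_le_norm2 _))//; apply: H.
by rewrite normr_id (le_lt_trans xp)// ltr_pdivrMr// ltr_pMr// ltr1n.
Qed.

Let past_near tau s p ep : `|x tau - p| <= ep -> `|x (tau - s) - p| <= ep ->
  `|past tau s| <= 2 * ep.
Proof.
move=> h1 h2; have -> : past tau s = (x (tau - s) - p) - (x tau - p).
  by rewrite /past opprB addrA subrK.
by rewrite (le_trans (ler_normB _ _))// mulr2n mulrDl !mul1r lerD.
Qed.

Let small_square2 (k e1 : R) : 0 <= k -> 0 < e1 -> exists2 ep, 0 < ep & k * (2 * ep) ^+ 2 <= e1.
Proof.
move=> k0 e10; have [dl dl0 H] := small_square k0 e10.
exists (dl / 4); first by rewrite divr_gt0.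
by apply: H; rewrite gtr0_norm; lra.
Qed.

(** Delays longer than [t - T1] reach back to where [x] is merely bounded; their share of the energy
    is killed by the weight as [t] grows. *)
Lemma lifted_forward p : tends_to x p ->
  state_dist A (lifted t) (rest_state p) @[t --> +oo] --> (0 : R).
Proof.
move=> xp; apply/cvgrPdist_le => ep ep0.
have [dl dl0 H] := sqrt_small ep0.
have e0 : 0 < ep ^+ 2 / 2 / 2 by rewrite !divr_gt0// exprn_gt0.
have a20 : 0 < a / 2 by rewrite divr_gt0.
pose k := Q * d%:R / (a / 2); have k0 : 0 <= k by rewrite divr_ge0// ltW.
have [e1 e10 ke1] := small_square2 k0 e0.
have [T1 _ xT1] := xp e1 e10; have [T2 _ xT2] := xp dl dl0.
pose m2 := k * (2 * m) ^+ 2; have m20 : 0 <= m2 by rewrite mulr_ge0// sqr_ge0.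
(* After a further time [q] the exponential exceeds [m2 / (ep ^+ 2 / 2 / 2)], by the inequality
   between [1 + x] and [exp x]. *)
pose q := m2 / (ep ^+ 2 / 2 / 2) / (a / 2).
have q0 : 0 <= q := divr_ge0 (divr_ge0 m20 (ltW e0)) (ltW a20).
exists (Num.max (T1 + q) T2); split=> [|t]; first exact: num_real.
rewrite gt_max => /andP[/ltW t1 /ltW t2].
rewrite sub0r normrN ger0_norm ?sqrtr_ge0//; apply: H; last exact: xT2.
have pm (s : R) : 0 <= s -> `|h t s| <= Q * d%:R * expR (- a * s) * (2 * m) ^+ 2.
  by move=> s0; apply: h_le.
have pe (s : R) : 0 <= s -> s <= t - T1 ->
    `|h t s| <= Q * d%:R * expR (- a * s) * (2 * e1) ^+ 2.
  by move=> s0 st; apply: h_le => //; apply: (@past_near _ _ p); apply: xT1; lra.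
have := tail_integral a0 c0 (sqr_ge0 _) (sqr_ge0 _) (mh t) pm pe.
rewrite -/(energy t) => /(le_trans (ler_norm _)) h1; apply: (le_trans h1).
have -> : Q * d%:R * ((2 * e1) ^+ 2 + (2 * m) ^+ 2 * expR (- (a / 2) * (t - T1))) / (a / 2) =
    k * (2 * e1) ^+ 2 + m2 * expR (- (a / 2) * (t - T1)) by rewrite /m2 /k; ring.
rewrite [leRHS]splitr lerD// mulNr expRN ler_pdivrMr ?expR_gt0//.
rewrite -ler_pdivrMl// mulrC (le_trans _ (expR_ge1Dx _))//.
have : q <= t - T1 by lra.
rewrite /q ler_pdivrMr// => h2; rewrite mulrC in h2; lra.
Qed.

Lemma lifted_backward p : tends_to (fun t => x (- t)) p ->
  state_dist A (lifted t) (rest_state p) @[t --> -oo] --> (0 : R).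
Proof.
move=> xp; apply/cvgrPdist_le => ep ep0.
have [dl dl0 H] := sqrt_small ep0.
have e0 : 0 < ep ^+ 2 / 2 by rewrite !divr_gt0// exprn_gt0.
pose k := Q * d%:R / a; have k0 : 0 <= k by rewrite divr_ge0// ltW.
have [e1 e10 ke1] := small_square2 k0 e0.
have [T1 _ xT1] := xp e1 e10; have [T2 _ xT2] := xp dl dl0.
exists (- Num.max T1 T2); split=> [|t]; first exact: num_real.
rewrite ltrNr gt_max => /andP[/ltW t1 /ltW t2].
rewrite sub0r normrN ger0_norm ?sqrtr_ge0//.
apply: H; last by have := xT2 _ t2; rewrite opprK.
have pe (s : R) : 0 <= s -> `|past t s| <= 2 * e1.
  move=> s0; have := xT1 (- t) t1; have := xT1 (- (t - s)); rewrite !opprK => h1 h2.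
  by apply: (@past_near _ _ p) => //; apply: h1; lra.
by rewrite (le_trans (energy_le pe))// mulrAC.
Qed.

Lemma lifted_bounded : exists K : R, forall t : R,
  state_dist A (lifted t) (rest_state 0) <= K.
Proof.
exists (Num.sqrt (Q * d%:R * (2 * m) ^+ 2 / a + d%:R * m ^+ 2)) => t.
rewrite state_distE ler_wsqrtr// lerD//; first by apply: energy_le.
rewrite subr0 (le_trans (dot_le_norm2 _))// ler_wpM2l// lerXn2r ?nnegrE//.
exact: le_trans (xm 0).
Qed.

Lemma lifted_in_L2A tau : in_L2A A (lifted tau).1.
Proof.
split; first exact: measurable_past.
have [+ _] := exp_bounded_integral a0 (mh tau) (fun s => h_exp (fun s _ => past_le tau s)).
by move=> /integrable_lty; apply.
Qed.

(** The initial history is itself read off the same orbit, so both branches of [history] reduce to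
    one formula; this is the invariance of the lifted orbit under the semiflow. *)
Lemma history_lifted tau (r s : R) :
  history (lifted tau).1 (fun t => x (tau + t)) r s = past (tau + r) s.
Proof.
rewrite /history /past /=; case: ifP => _; first by rewrite addrA.
by rewrite addr0 addrCA subrr addr0 opprB addrA.
Qed.

Lemma int_past t : int_halfline (fun s => M s *m past t s) =
  memory M x t - int_halfline M *m x t.
Proof.
have H := memoryB a0 MC t xc (fun=> cvg_cst (x t)) xm (fun=> xm t).
by rewrite (memory_cst a0 MC) in H; rewrite H.
Qed.

Lemma lifted_semiflow tau t : 0 <= t -> semiflow M phi eps t (lifted tau) (lifted (t + tau)).
Proof.
move=> t0; pose y r := x (tau + r); pose dy r := phi (y r) + eps *: memory M x (tau + r).
have sc : continuous (fun r : R => tau + r).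
  by move=> r; apply: cvgD; [exact: cvg_cst|exact: cvg_id].
exists y, dy; split.
- split=> [r r0|].
    have -> : y = fun r => x (r + tau) by apply/funext => s; rewrite /y addrC.
    by apply: vder_halfline; apply: vder_shift; rewrite /dy /y [tau + r]addrC; exact: xd.
  apply: continuous_subspaceT; apply: continuous_add => r.
    apply: (@continuous_comp _ _ _ (fun r => x (tau + r)) phi); last exact: phic.
    by apply: (@continuous_comp _ _ _ (fun r => tau + r) x); [exact: sc|exact: xc].
  apply: (cvgZ (cvg_cst _)).
  apply: (@continuous_comp _ _ _ (fun r => tau + r) (memory M x)); first exact: sc.
  exact: (memory_continuous a0 MC xc xm).
- by rewrite /y addr0.
- move=> r r0; rewrite /dy; under eq_fun do rewrite history_lifted.
  rewrite int_past scalerBr /y -addrA; congr (_ + _).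
  by rewrite [RHS]addrC subrK.
- by apply: aeW => s _; rewrite history_lifted [tau + t]addrC.
- by rewrite /y addrC.
Qed.

Lemma semiflow_connection_of_solution p q :
  tends_to (fun t => x (- t)) p -> tends_to x q ->
  semiflow_connection A M phi eps (rest_state p) (rest_state q).
Proof.
move=> xp xq; exists lifted; split.
- exact: lifted_in_L2A.
- exact: lifted_semiflow.
- exact: lifted_bounded.
- exact: lifted_backward.
- exact: lifted_forward.
Qed.

End lifted_solution.

(** * The correspondence between equilibria *)

Section correspondence.
Context {R : realType} {d : nat}.
Variables (A M : R -> 'M[R]_d) (r L : R) (Phi : 'cV[R]_d -> R)
  (phi : 'cV[R]_d -> 'cV[R]_d) (J : 'cV[R]_d -> 'M[R]_d) (epsb : R).
Hypothesis mM : measurable_halfline M.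
Hypothesis hdata : gradient_data r L Phi phi J.
Hypothesis phic : continuous phi.
Hypothesis hfin : finite_set [set e | equilibrium phi e].
Hypothesis Jsaddle : forall e, equilibrium phi e -> saddle (J e).
Hypothesis epsb0 : 0 < epsb.
Hypothesis zero_bounded : forall (eps : R) (u : 'cV[R]_d), 0 <= eps <= epsb ->
  phi u + eps *: (int_halfline M *m u) = 0 -> `|u| <= r - 1.
Implicit Types (e p u : 'cV[R]_d) (eps : R).

Local Notation zero eps u := (phi u + eps *: (int_halfline M *m u) = 0).

Let zero0 e : equilibrium phi e -> zero 0 e.
Proof. by rewrite scale0r addr0. Qed.

Let isolated_zeros : exists2 r1 : R, 0 < r1 & exists2 eps1 : R, 0 < eps1 &
  forall e, equilibrium phi e -> exists2 C : R, 0 <= C &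
  forall eps, 0 <= eps <= eps1 ->
    (exists p, [/\ `|p - e| <= C * eps, `|p - e| <= r1 & zero eps p]) /\
    forall p p', `|p - e| <= 2 * r1 -> `|p' - e| <= 2 * r1 -> zero eps p -> zero eps p' -> p = p'.
Proof.
have [s sE] := (finite_seqP _).1 hfin.
have sP e : e \in s -> equilibrium phi e.
  by move=> es; have : [set e | equilibrium phi e] e by rewrite sE.
have er e : equilibrium phi e -> `|e| <= r - 1.
  by move=> /zero0; apply: zero_bounded; rewrite lexx ltW.
have [r1 r10 H1] := uniform_small (fun e es =>
  zero_continuation (int_halfline M) hdata (sP e es) (er e (sP e es)) (Jsaddle (sP e es))).
exists r1 => //.
have [|eps1 eps10 H2] := @uniform_small R _ s (fun e c => exists2 C : R, 0 <= C &
  forall eps, 0 <= eps <= c ->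
    (exists p, [/\ `|p - e| <= C * eps, `|p - e| <= r1 & zero eps p]) /\
    forall p p', `|p - e| <= 2 * r1 -> `|p' - e| <= 2 * r1 -> zero eps p -> zero eps p' -> p = p').
  move=> e es; have [|C [eps1 [C0 eps10 H]]] := H1 e es r1; first by rewrite r10 lexx.
  exists eps1 => // c /andP[c0 c1]; exists C => // eps /andP[eps0 epsc].
  by apply: H; rewrite eps0 (le_trans epsc).
exists eps1 => // e fe; apply: H2; last by rewrite eps10 lexx.
by have : [set e | equilibrium phi e] e by []; rewrite sE.
Qed.

(** The correspondence is stated for every smaller range [eps1], with the same [N] and [E], because
    the range must shrink again once connections are considered. The linear rate [C * eps] is what
    places the equilibria inside the neighbourhoods of that later step. *)
Lemma corresponding_equilibria_exist : exists2 eps0 : R, 0 < eps0 & exists N E,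
  (forall eps1, 0 < eps1 <= eps0 -> corresponding_equilibria A M phi eps1 N E) /\
  forall e, equilibrium phi e -> exists2 C : R, 0 <= C & forall eps, 0 < eps <= eps0 ->
    `|E e eps - e| <= C * eps /\ zero eps (E e eps).
Proof.
have [r1 r10 [eps1 eps10 H]] := isolated_zeros.
have [m m0 sep] := zero_separation (r - 1) phic r10.
pose b := d%:R * `|int_halfline M|; have b0 : 0 <= b by rewrite mulr_ge0.
pose k := b * `|r - 1| + 1; have k0 : 0 < k by rewrite ltr_pwDr// mulr_ge0.
(* A perturbed zero at distance at least [r1] from all equilibria would have [|phi u|] at least [m],
   whereas the perturbation is at most [eps2 * k], half of [m]. *)
pose eps2 := m / (2 * k).
have eps20 : 0 < eps2 by rewrite divr_gt0// mulr_gt0.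
pose eps0 := Num.min epsb (Num.min eps1 eps2).
have eps00 : 0 < eps0 by rewrite !lt_min epsb0 eps10.
pose N e := [set u : 'cV[R]_d | `|u - e| <= r1].
(* The default [0] is not reached for [e] an equilibrium and [eps] in range, where [EP] identifies
   the value. *)
pose E e eps : 'cV[R]_d := xget 0 [set p | `|p - e| <= r1 /\ zero eps p].
have EP e eps : equilibrium phi e -> 0 < eps <= eps0 ->
    [/\ `|E e eps - e| <= r1, zero eps (E e eps) &
      forall p, `|p - e| <= 2 * r1 -> zero eps p -> p = E e eps].
  move=> fe /andP[epsp]; rewrite !le_min => /and3P[epsb_ epsb1 epsb2].
  have [C C0 /(_ eps)[|[p [_ pr pz]] uniq]] := H e fe; first by rewrite ltW.
  have [Er Ez] : `|E e eps - e| <= r1 /\ zero eps (E e eps).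
    by apply: (@xgetPex _ 0 [set p | `|p - e| <= r1 /\ zero eps p]); exists p.
  split=> // q qr qz; apply: uniq => //.
  by rewrite (le_trans Er)// ler_peMl ?ler1n// ltW.
have zerosE eps u : 0 < eps <= eps0 -> zero eps u -> exists2 e, equilibrium phi e & u = E e eps.
  move=> epsi uz; have /andP[epsp] := epsi; rewrite !le_min => /and3P[epsb_ _ epsb2].
  have ur : `|u| <= r - 1 by apply: zero_bounded uz; rewrite ltW.
  have [e fe ue] : exists2 e, equilibrium phi e & `|u - e| <= r1.
    apply: contrapT => nex; have : m <= `|phi u|.
      apply: sep => // e fe; rewrite leNgt; apply/negP => ue; apply: nex.
      by exists e => //; exact: ltW.
    have -> : phi u = - (eps *: (int_halfline M *m u)) by apply/eqP; rewrite -addr_eq0 uz.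
    rewrite normrN normrZ gtr0_norm//; apply/negP; rewrite -ltNge.
    have h : `|int_halfline M *m u| <= k.
      rewrite (le_trans (norm_mulmx_le _ _))// /k (@le_trans _ _ (b * `|r - 1|))//.
        by rewrite ler_wpM2l// (le_trans ur)// ler_norm.
      by rewrite lerDl.
    rewrite (@le_lt_trans _ _ (eps2 * k))//.
      by apply: ler_pM => //; exact: ltW.
    rewrite /eps2 invfM mulrA -mulrA mulVf ?gt_eqF// mulr1.
    by rewrite ltr_pdivrMr// ltr_pMr// ltr1n.
  exists e => //; have [_ _] := EP e eps fe epsi; apply=> //.
  by rewrite (le_trans ue)// ler_peMl ?ler1n// ltW.
exists eps0 => //; exists N, E; split=> [eps' /andP[eps'0 eps'1]|e fe]; last first.
  have [C C0 HC] := H e fe; exists C => // eps epsi.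
  have [Er Ez uniq] := EP e eps fe epsi; split=> //.
  have /andP[epsp] := epsi; rewrite !le_min => /and3P[_ epsb1 _].
  have [|[p [pC pr pz]] _] := HC eps; first by rewrite ltW.
  by rewrite -(uniq p)// (le_trans pr)// ler_peMl ?ler1n// ltW.
have epsle eps : 0 < eps <= eps' -> 0 < eps <= eps0.
  by move=> /andP[-> h]; rewrite (le_trans h).
split.
- move=> e fe; split; first exact: closed_ball_compact.
  apply: filterS (nbhsx_ballx e r1 r10) => u; rewrite -ball_normE /N/= distrC.
  exact: ltW.
(* A common point would put [e'] within [2 * r1] of [e], and both are zeros for [eps = 0]:
   uniqueness at the unperturbed parameter identifies them. *)
- move=> e e' fe fe' ee'; apply/seteqP; split=> // u [/= ue ue']; apply: ee'.
  have [C C0 /(_ 0)[|_ uniq]] := H e fe; first by rewrite lexx ltW.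
  apply: uniq; [by rewrite subrr normr0 mulr_ge0// ltW| |exact: zero0|exact: zero0].
  rewrite -[e'](subrK u) -addrA (le_trans (ler_normD _ _))// mulr2n mulrDl mul1r.
  by rewrite lerD// distrC.
- move=> eps /epsle epsi e fe; have [Er Ez uniq] := EP e eps fe epsi; split=> //.
    exact: rest_state_equilibrium.
  move=> p /(semiflow_equilibriumP mM)[_ pz] pe; apply: uniq => //.
  by rewrite (le_trans pe)// ler_peMl ?ler1n// ltW.
- move=> eps /epsle epsi p /(semiflow_equilibriumP mM)[p1 pz]; split=> //.
  exact: zerosE.
- move=> e fe; have [C C0 HC] := H e fe.
  apply/cvgrPdist_le => ep ep0.
  have q0 : 0 < ep / (C + 1) by rewrite divr_gt0// ltr_pwDr.
  have q1 : 0 < Num.min eps0 (ep / (C + 1)) by rewrite lt_min eps00.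
  apply: filterS2 (nbhs_right_gt 0) (nbhs_right_lt q1) => eps epsp.
  rewrite lt_min => /andP[/ltW epsb_ epsC].
  have epsi : 0 < eps <= eps0 by rewrite epsp.
  have [Er Ez uniq] := EP e eps fe epsi.
  have := epsb_; rewrite !le_min => /and3P[_ epsb1 _].
  have [|[p [pC pr pz]] _] := HC eps; first by rewrite ltW.
  rewrite distrC -(uniq p)//; last by rewrite (le_trans pr)// ler_peMl ?ler1n// ltW.
  rewrite (le_trans pC)// (@le_trans _ _ ((C + 1) * eps))//.
    by rewrite ler_wpM2r ?(ltW epsp)// lerDl.
  by rewrite mulrC -ler_pdivlMr ?ltr_pwDr// ltW.
Qed.

End correspondence.

(** * Assembly for a dissipative gradient system *)

Section gradient_system.
Context {R : realType} {d : nat}.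
Variables (F : 'cV[R]_d -> R) (R0 C_F : R).
Hypothesis hF : Ck 3 F.
Hypothesis hR0 : 0 < R0.
Hypothesis hC_F : 0 < C_F.
Hypothesis hdiss : forall x : 'cV[R]_d, R0 <= enorm x ->
  C_F * enorm x ^+ 2 <= - dot (grad F x) x.

(** Outside the ball of radius [R0] a zero would need the perturbation to balance the dissipation,
    but for [eps <= epsb] it reaches at most half of it. *)
Lemma perturbed_zero_small (B : 'M[R]_d) : exists2 epsb : R, 0 < epsb &
  forall (eps : R) (u : 'cV[R]_d), 0 <= eps <= epsb -> grad F u + eps *: (B *m u) = 0 ->
  `|u| <= R0 ^+ 2 + 1.
Proof.
pose q := d%:R ^+ 2 * `|B| + 1; have q0 : 0 < q by rewrite ltr_pwDr// mulr_ge0// sqr_ge0.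
exists (C_F / (2 * q)) => [|eps u /andP[eps0 epsb] uz]; first by rewrite divr_gt0// mulr_gt0.
apply: norm_le_of_dot_le; first exact: sqr_ge0.
rewrite leNgt; apply/negP => /ltW uR; have := dissipative_dot hR0 hdiss uR.
have -> : grad F u = - (eps *: (B *m u)) by apply/eqP; rewrite -addr_eq0; apply/eqP.
rewrite dotNl opprK dotZl; apply/negP; rewrite -ltNge.
have u0 : 0 < dot u u by rewrite (lt_le_trans _ uR)// exprn_gt0.
have h : dot (B *m u) u <= q * dot u u.
  rewrite (le_trans (ler_norm _))// (le_trans (quad_le _ _))//.
  by rewrite ler_wpM2r ?dot_ge0// lerDl.
rewrite (@le_lt_trans _ _ (C_F / (2 * q) * (q * dot u u)))//.
  rewrite (@le_trans _ _ (eps * (q * dot u u)))//; first by rewrite ler_wpM2l.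
  by rewrite ler_wpM2r// mulr_ge0 ?dot_ge0// ltW.
have -> : C_F / (2 * q) * (q * dot u u) = C_F * dot u u / 2 by field; rewrite gt_eqF.
by rewrite ltr_pdivrMr// ltr_pMr ?ltr1n// mulr_gt0.
Qed.

Lemma tends_to_bound (x : R -> 'cV[R]_d) e (m : R) : (forall t, `|x t| <= m) ->
  tends_to x e -> `|e| <= m + 1.
Proof.
move=> xm /(_ 1 ltr01)[T _ /(_ T (lexx T))] H.
rewrite -[e](subrK (x T)) (le_trans (ler_normD _ _))// addrC lerD//.
by rewrite distrC.
Qed.

Lemma ode_connectionP ei ej : ode_connection (grad F) ei ej ->
  exists x m, connecting_orbit F x ei ej /\ forall t : R, `|x t| <= m.
Proof.
move=> [x [xd [m xm] xi xj]]; exists x, m; split=> [|t].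
  split=> [t||]; first exact/vderP.
    by apply/tends_to_cvg; move/cvgNy_compNP : xi.
  exact/tends_to_cvg.
exact: le_trans (norm_le_enorm _) (xm t).
Qed.

Lemma nearby_semiflow_connection (A M : R -> 'M[R]_d) (C a Q eps0 : R) ei ej
    (Ei Ej : R -> 'cV[R]_d) (Ci Cj : R) :
  0 < a -> exp_bounded M C a -> measurable_halfline A -> 0 <= Q ->
  (forall (s : R) (u : 'cV[R]_d), 0 <= s ->
    0 <= dot (A s *m u) u <= Q * expR (- a * s) * dot u u) ->
  equilibrium (grad F) ei -> equilibrium (grad F) ej ->
  saddle (jac (grad F) ei) -> saddle (jac (grad F) ej) ->
  transversal_sets (unstable_set (grad F) ei) (stable_set (grad F) ej) ->
  0 < eps0 -> 0 <= Ci -> 0 <= Cj ->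
  (forall eps, 0 < eps <= eps0 -> `|Ei eps - ei| <= Ci * eps /\
    grad F (Ei eps) + eps *: (int_halfline M *m Ei eps) = 0) ->
  (forall eps, 0 < eps <= eps0 -> `|Ej eps - ej| <= Cj * eps /\
    grad F (Ej eps) + eps *: (int_halfline M *m Ej eps) = 0) ->
  ode_connection (grad F) ei ej ->
  exists2 eps1 : R, 0 < eps1 & forall eps, 0 < eps <= eps1 ->
    semiflow_connection A M (grad F) eps (rest_state (Ei eps)) (rest_state (Ej eps)).
Proof.
move=> a0 MC mA Q0 AQ fi fj Ji Jj trans eps00 Ci0 Cj0 HEi HEj /ode_connectionP[x0 [m [x0c x0m]]].
have [x0d x0i x0j] := x0c.
have [K K0 HK] := transversal_bsolvable hF hR0 hC_F hdiss x0c fi fj Ji Jj trans.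
have x0Nm t : `|x0 (- t)| <= m by [].
(* One unit covers the limits of the orbit, the other the distance from the connection to its
   perturbation. *)
have [L hdata] := C3_gradient_data hF (m + 1 + 1).
have mr : m + 1 + 1 - 1 = m + 1 by rewrite addrK.
have x0r t : `|x0 t| <= m + 1 + 1 - 1 by rewrite mr (le_trans (x0m t))// lerDl.
have eir : `|ei| <= m + 1 + 1 - 1 by rewrite mr; exact: tends_to_bound x0Nm x0i.
have ejr : `|ej| <= m + 1 + 1 - 1 by rewrite mr; exact: tends_to_bound x0m x0j.
have [rho rho0 [eps1 eps10 H]] := perturbed_connection a0 MC hdata
  (grad_continuous hF) (jac_continuous hF) x0d x0r x0i x0j eir ejr Ji Jj K0 HK.
have q0 : 0 < Ci + Cj + 1 by rewrite ltr_pwDr// addr_ge0.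
exists (Num.min eps0 (Num.min eps1 (rho / (Ci + Cj + 1)))).
  by rewrite !lt_min eps00 eps10 divr_gt0.
move=> eps /andP[epsp]; rewrite !le_min => /and3P[epsb epsb1].
rewrite ler_pdivlMr// => epsrho.
have epsi : 0 < eps <= eps0 by rewrite epsp.
have [Eid Eiz] := HEi eps epsi; have [Ejd Ejz] := HEj eps epsi.
have Cieps : 0 <= Ci * eps by rewrite mulr_ge0// ltW.
have Cjeps : 0 <= Cj * eps by rewrite mulr_ge0// ltW.
have hsum : Ci * eps + Cj * eps <= rho.
  by rewrite (le_trans _ epsrho)// -mulrDl mulrC ler_wpM2l ?(ltW epsp)// lerDl.
have [|||x [xc xr xd xi xj]] := H eps (Ei eps) (Ej eps) _ _ _ Eiz Ejz.
- by rewrite (ltW epsp).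
- by rewrite (le_trans Eid)// (le_trans _ hsum)// lerDl.
- by rewrite (le_trans Ejd)// (le_trans _ hsum)// lerDr.
exact: (semiflow_connection_of_solution a0 MC (grad_continuous hF) mA Q0 AQ xc xr xd xi xj).
Qed.

End gradient_system.

Theorem theorem6p9 (R : realType) (d : nat) (F : 'cV[R]_d -> R)
  (M A dA : R -> 'M[R]_d) (R0 C_F C_A D_A D_M : R)
  (hF : Ck 3 F)
  (hM : measurable_halfline M)
  (hR0 : 0 < R0) (hC_F : 0 < C_F)
  (hdiss : forall x : 'cV[R]_d, R0 <= enorm x ->
     C_F * enorm x ^+ 2 <= - dot (grad F x) x)
  (hfin : finite_set [set e | equilibrium (grad F) e])
  (hhyp : forall e, equilibrium (grad F) e -> hyperbolic (grad F) e)
  (htrans : forall e e', equilibrium (grad F) e -> equilibrium (grad F) e' ->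
     transversal_sets (unstable_set (grad F) e) (stable_set (grad F) e'))
  (hA : C1_halfline A dA)
  (hApos : forall s : R, 0 <= s -> sym_posdef (A s))
  (hC_A : 0 < C_A) (hD_A : 0 < D_A) (hD_M : 0 < D_M)
  (hAdecay : {ae lebesgue_measure, forall s : R, 0 < s ->
     forall u : 'cV[R]_d, dot (dA s *m u) u <= - C_A * dot (A s *m u) u})
  (hAcond : forall s : R, 0 <= s ->
     lambda_max (A s) <= D_A ^+ 2 * lambda_min (A s))
  (hMbound : forall s : R, 0 <= s ->
     opnorm (M s) <= D_M ^+ 2 * lambda_min (A s))
  (hMsym : (int_halfline M)^T = int_halfline M) :
  exists2 eps0 : R, 0 < eps0 &
  exists N E,
    corresponding_equilibria A M (grad F) eps0 N E /\
    forall ei ej : 'cV[R]_d,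
      equilibrium (grad F) ei -> equilibrium (grad F) ej ->
      ode_connection (grad F) ei ej ->
      forall eps : R, 0 < eps <= eps0 ->
        semiflow_connection A M (grad F) eps
          (rest_state (E ei eps)) (rest_state (E ej eps)).
Proof.
have [C MC] := kernel_exp_bounded hA hApos hC_A hAdecay hM hMbound.
have [Q Q0 AQ0] := weight_le hA hC_A hAdecay.
have mA := weight_measurable hA.
have AQ (s : R) (u : 'cV[R]_d) : 0 <= s ->
    0 <= dot (A s *m u) u <= Q * expR (- C_A * s) * dot u u.
  move=> s0; rewrite AQ0// andbT; have [->|u0] := eqVneq u 0; first by rewrite mulmx0 dot0l.
  by have [_ /(_ u u0)/ltW] := hApos s s0.
have Jsaddle e : equilibrium (grad F) e -> saddle (jac (grad F) e).
  by move=> fe; apply: saddle_of_symmetric; [exact: jac_sym|exact: hhyp].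
have [epsb epsb0 zb] := perturbed_zero_small hR0 hC_F hdiss (int_halfline M).
have [L hdata] := C3_gradient_data hF (R0 ^+ 2 + 1 + 1).
have zb' (eps : R) (u : 'cV[R]_d) : 0 <= eps <= epsb ->
    grad F u + eps *: (int_halfline M *m u) = 0 -> `|u| <= R0 ^+ 2 + 1 + 1 - 1.
  by rewrite addrK; exact: zb.
have [eps0 eps00 [N [E [HE Ebound]]]] := @corresponding_equilibria_exist R d A M _ L F
  (grad F) (jac (grad F)) epsb hM hdata (grad_continuous hF) hfin Jsaddle epsb0 zb'.
have [s sE] := (finite_seqP _).1 hfin.
have sP e : equilibrium (grad F) e <-> e \in s.
  by rewrite -[X in X <-> _]/([set e | equilibrium (grad F) e] e) sE.
(* The threshold of each pair depends on a connection chosen for it; the minimum over the finite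
   list of pairs serves all, and pairs without a connection contribute a dummy threshold [1]. *)
have [|eps1 eps10 conn] := @uniform_small R _ [seq (e, e') | e <- s, e' <- s]
  (fun ee c => ode_connection (grad F) ee.1 ee.2 -> forall eps : R, 0 < eps <= c ->
     semiflow_connection A M (grad F) eps (rest_state (E ee.1 eps)) (rest_state (E ee.2 eps))).
  move=> _ /allpairsP[[ei ej] /= [/sP fi /sP fj ->]].
  have [c|nc] := pselect (ode_connection (grad F) ei ej); last by exists 1.
  have [Ci Ci0 Hi] := Ebound ei fi; have [Cj Cj0 Hj] := Ebound ej fj.
  have [eps1 eps10 H] := nearby_semiflow_connection hF hR0 hC_F hdiss hC_A MC mA Q0 AQ fi fj
    (Jsaddle ei fi) (Jsaddle ej fj) (htrans ei ej fi fj) eps00 Ci0 Cj0 Hi Hj c.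
  exists eps1 => // b /andP[_ bb] _ eps /andP[epsp epsb'].
  by apply: H; rewrite epsp (le_trans epsb').
exists (Num.min eps0 eps1); first by rewrite lt_min eps00.
exists N, E; split; first by apply: HE; rewrite lt_min eps00 eps10 ge_min lexx.
move=> ei ej fi fj c eps /andP[epsp]; rewrite le_min => /andP[_ epse].
have := conn (ei, ej) _ eps1 _ c eps; apply; rewrite ?eps10 ?epsp ?lexx//.
by apply/allpairsP; exists (ei, ej); split=> //; exact/sP.
Qed.
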